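(* Let $H=\mathbb{R}^d$ with Euclidean norm $|\cdot|$. Suppose $\mu=\sum_{i=1}^n\omega_i\,\delta(x_i)$ with $x_i\in\mathbb{S}^{d-1}$, $\omega_i>0$ and $\sum_{i=1}^n\omega_i=1$. Let $\lambda_{\min}$ be the smallest eigenvalue of the matrix $A:=\mathrm{id}_{\mathbb{R}^d}-\sum_{i=1}^n\omega_i\,x_ix_i^{\mathsf T}$ and let $w_{\mathrm{cm}}=\sum_{i=1}^n\omega_ix_i$. Suppose that $q:=4\,|w_{\mathrm{cm}}|/\lambda_{\min}^2<1$ (in particular $\lambda_{\min}>0$) and $w_0:=0$. Then for any $\varepsilon>0$ and $p\in[1,\infty]$, each of the two iterations (N) and (S) described in the context reduces both the hyperbolic distance $d_g(w_k,w_*(\mu))$ between $w_k$ and the conformal barycenter $w_*(\mu)$, and the $p$-Wasserstein distance $W_p(\mu_k,\mu_* )$ between $\mu_k=(\sigma_{w_k})_{\#}\mu$ and the centralized measure $\mu_*=(\sigma_{w_*(\mu)})_{\#}\mu$, to less than $\varepsilon$ in at most $$k\le\big\lceil \log_2|\log_2\varepsilon|-\log_2|\log_2 q|\big\rceil$$ iterations. For this, they require $O(k\,(d^2n+d^3))$ time and $O(d\,n+d^2)$ memory.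
   Context: $\delta(x)$ is the Dirac measure at $x$. $\mathbb{B}=\{z\in\mathbb{R}^d:|z|<1\}$ is the Poincaré ball with metric $g|_w(X,Y)=\frac{4}{(1-|w|^2)^2}\langle X,Y\rangle$, geodesic distance $d_g$, Riemannian exponential map $\exp$ (in particular $\exp_0(u)=\frac{\tanh|u|}{|u|}u$, $\exp_0(0)=0$) and Levi-Civita covariant derivative $\nabla$; $X^\flat=g(X,\cdot)$. $\mathbb{S}=\mathbb{S}^{d-1}$ is the unit sphere with angular distance $d_{\mathbb{S}}(x,y)=\arccos\langle x,y\rangle$. For $w\in\mathbb{B}$, $x\in\mathbb{S}$, the director $V_x(w)\in T_w\mathbb{B}$ is the $g$-unit tangent vector with $\lim_{t\to\infty}\exp_w(tV_x(w))=x$; explicitly $V_x(w)=\frac12\,\frac{(1-|w|^2)^2x-2(1-|w|^2)(1-\langle w,x\rangle)w}{1-2\langle w,x\rangle+|w|^2}$. $F_\mu(w)=\int_{\mathbb{S}}V_x(w)\,\mathrm{d}\mu(x)$; a conformal barycenter of $\mu$ is a zero of $F_\mu$ in $\mathbb{B}$. One has $\nabla F_\mu(w)=\int_{\mathbb{S}}V_x(w)\otimes V_x(w)^\flat\,\mathrm{d}\mu(x)-\mathrm{id}_{T_w\mathbb{B}}$. Shift transformation: $\sigma(w,z)=\sigma_w(z)=\frac{(1-|w|^2)z-(1+|z|^2-2\langle w,z\rangle)w}{1-2\langle w,z\rangle+|w|^2|z|^2}$ for $w\in\mathbb{B}$, $z\in\mathbb{B}\cup\mathbb{S}$. $(\sigma_w)_{\#}\mu$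 is the push-forward, here $\sum_i\omega_i\,\delta(\sigma_w(x_i))$. (N): $v_k=-\nabla F_\mu(w_k)^{-1}F_\mu(w_k)$, $w_{k+1}=\exp_{w_k}(v_k)$. (S): $\mu_k=(\sigma_{w_k})_{\#}\mu$, $u_k=-\nabla F_{\mu_k}(0)^{-1}F_{\mu_k}(0)$, $w_{k+1}=\sigma(-w_k,\exp_0(u_k))$. $W_p$ is the $p$-Wasserstein distance on probability measures on $\mathbb{S}$ with respect to $d_{\mathbb{S}}$ (for $p=\infty$: infimum over transport plans of the essential supremum of $d_{\mathbb{S}}$ on the support of the plan). Time counts exact real arithmetic operations (including elementary functions), memory counts stored real numbers. A negative or $-\infty$ value of the iteration bound means zero iterations, with conventions $\log_2 0=-\infty$ and $|\log_2 0|=\infty$, $\log_2\infty=\infty$. *)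

(* Defs.v *)
From HB Require Import structures.
From mathcomp Require Import all_boot all_order all_algebra.
From mathcomp Require Import all_classical all_reals all_analysis.
Import Order.TTheory GRing.Theory Num.Theory.
Import numFieldNormedType.Exports.

Set Implicit Arguments.
Unset Strict Implicit.
Unset Printing Implicit Defensive.

Local Open Scope classical_set_scope.
Local Open Scope ring_scope.

(* Points and vectors of R^d are row vectors.  The norm that the library puts  *)
(* on 'rV[R]_d is the sup norm; it is used only for the topology and for       *)
(* derivatives.  The Euclidean norm is [enorm].                                *)

Section Euclidean.
Variables (R : realType) (d : nat).
Implicit Types u v : 'rV[R]_d.

Definition dot u v : R := \sum_(i < d) u 0 i * v 0 i.
Definition enorm u : R := Num.sqrt (dot u u).
Definition in_ball u : Prop := enorm u < 1.
Definition in_sphere u : Prop := enorm u = 1.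
Definition sphere_dist u v : R := acos (dot u v).

End Euclidean.

Definition smallest_eigenvalue (R : realType) (d : nat) (A : 'M[R]_d) (a : R) :=
  eigenvalue A a /\ forall b, eigenvalue A b -> a <= b.

Section PoincareBall.
Variables (R : realType) (d : nat).
Implicit Types (w u v X : 'rV[R]_d) (gamma : R -> 'rV[R]_d).

Definition metric_tensor w : 'M[R]_d := (4 / (1 - enorm w ^+ 2) ^+ 2)%:M.

Definition metric w u v : R := (u *m metric_tensor w *m v^T) 0 0.

Definition metric_norm w u : R := Num.sqrt (metric w u u).

(* Christoffel symbols of the second kind, Gamma^k_ij at w *)
Definition christoffel w (k i j : 'I_d) : R :=
  let e a : 'rV[R]_d := delta_mx 0 a in
  let dG a b c : R := 'D_(e a) (fun z => metric_tensor z b c) w in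
  2^-1 * \sum_l invmx (metric_tensor w) k l * (dG i j l + dG j i l - dG l i j).

Definition christoffel_form w u v : 'rV[R]_d :=
  \row_k \sum_i \sum_j christoffel w k i j * u 0 i * v 0 j.

(* Levi-Civita derivative at w of the vector field Y in the direction X *)
Definition covariant_derivative (Y : 'rV[R]_d -> 'rV[R]_d) w X : 'rV[R]_d :=
  'D_X Y w + christoffel_form w X (Y w).

(* The ball is geodesically complete, so geodesics are taken on the whole line *)
Definition is_geodesic gamma : Prop :=
  forall t, [/\ in_ball (gamma t), derivable gamma t 1,
    derivable (derive1 gamma) t 1 &
    derive1 (derive1 gamma) t + christoffel_form (gamma t) (derive1 gamma t) (derive1 gamma t)
      = 0].

(* [xget] picks gamma 1 for the geodesic gamma with the given initial data *)
Definition riemannian_exp w v : 'rV[R]_d :=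
  xget 0 [set y | exists gamma,
    [/\ is_geodesic gamma, gamma 0 = w, derive1 gamma 0 = v & gamma 1 = y]].

Definition admissible_curve u v gamma : Prop :=
  [/\ forall t, derivable gamma t 1, continuous (derive1 gamma),
      forall t, 0 <= t <= 1 -> in_ball (gamma t), gamma 0 = u & gamma 1 = v].

Definition curve_length gamma : \bar R :=
  (\int[lebesgue_measure]_(t in `[0%R, 1%R])
     (metric_norm (gamma t) (derive1 gamma t))%:E)%E.

Definition geodesic_dist u v : \bar R :=
  ereal_inf [set curve_length gamma | gamma in admissible_curve u v].

Definition director (x w : 'rV[R]_d) : 'rV[R]_d :=
  2^-1 *: ((1 - 2 * dot w x + enorm w ^+ 2)^-1 *:
    ((1 - enorm w ^+ 2) ^+ 2 *: x
     - (2 * (1 - enorm w ^+ 2) * (1 - dot w x)) *: w)).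

Definition shift (w z : 'rV[R]_d) : 'rV[R]_d :=
  (1 - 2 * dot w z + enorm w ^+ 2 * enorm z ^+ 2)^-1 *:
    ((1 - enorm w ^+ 2) *: z - (1 + enorm z ^+ 2 - 2 * dot w z) *: w).

End PoincareBall.

(* The measure mu = \sum_i omega_i delta(x_i) is given by its weights omega    *)
(* and atoms x (repetitions allowed); integrals against mu are finite sums.    *)
(* The push-forward by a map f has the same weights and the atoms f (x i).     *)

Section Barycenter.
Variables (R : realType) (d n : nat) (omega : 'I_n -> R).
Implicit Types (x : 'I_n -> 'rV[R]_d) (w : 'rV[R]_d).

Definition mean_field x w : 'rV[R]_d := \sum_i omega i *: director (x i) w.

Definition conformal_barycenter x w : Prop := in_ball w /\ mean_field x w = 0.

(* Row-vector convention: X *m mean_field_jacobian x w is the covariant        *)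
(* derivative of F_mu at w in the direction X, so that the inverse of          *)
(* nabla F_mu(w) acts by right multiplication by the inverse matrix.           *)
Definition mean_field_jacobian x w : 'M[R]_d :=
  lin1_mx (covariant_derivative (mean_field x) w).

Definition newton_direction x w : 'rV[R]_d :=
  - (mean_field x w *m invmx (mean_field_jacobian x w)).

Definition shifted x w : 'I_n -> 'rV[R]_d := fun i => shift w (x i).

Definition newton_step x w : 'rV[R]_d := riemannian_exp w (newton_direction x w).

Definition shift_newton_step x w : 'rV[R]_d :=
  shift (- w) (riemannian_exp 0 (newton_direction (shifted x w) 0)).

End Barycenter.

Variant method := MethodN | MethodS.

Section Iterations.
Variables (R : realType) (d n : nat) (omega : 'I_n -> R) (x : 'I_n -> 'rV[R]_d).

Definition step_of (m : method) : 'rV[R]_d -> 'rV[R]_d :=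
  match m with
  | MethodN => newton_step omega x
  | MethodS => shift_newton_step omega x
  end.

(* the endomorphism that one step of the method from w inverts *)
Definition jacobian_of (m : method) (w : 'rV[R]_d) : 'M[R]_d :=
  match m with
  | MethodN => mean_field_jacobian omega x w
  | MethodS => mean_field_jacobian omega (shifted x w) 0
  end.

Definition iterate (m : method) (k : nat) : 'rV[R]_d := iter k (step_of m) 0.

End Iterations.

Section Wasserstein.
Variables (R : realType) (d : nat).

Definition borel_rV := g_sigma_algebraType (@open 'rV[R]_d).

Definition atomic_measure (n : nat) (omega : 'I_n -> R) (x : 'I_n -> 'rV[R]_d) :
  set borel_rV -> \bar R :=
  fun A => (\sum_(i < n) (omega i)%:E * \d_(x i : borel_rV) A)%E.

Definition is_transport_plan (mu nu : set borel_rV -> \bar R)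
    (rho : {measure set (borel_rV * borel_rV)%type -> \bar R}) : Prop :=
  forall A : set borel_rV, measurable A ->
    pushforward rho fst A = mu A /\ pushforward rho snd A = nu A.

(* For measures concentrated on the unit sphere every plan is concentrated on  *)
(* pairs of points of the sphere, so that the values of [sphere_dist] off the  *)
(* sphere do not matter.  The library's L^p norm is the essential supremum     *)
(* for p = +oo.                                                                *)
Definition wasserstein (p : \bar R) (mu nu : set borel_rV -> \bar R) : \bar R :=
  ereal_inf [set Lnorm rho p (fun z => (sphere_dist z.1 z.2)%:E)
            | rho in is_transport_plan mu nu].

Definition shifted_measure (mu : set borel_rV -> \bar R) (w : 'rV[R]_d) :
  set borel_rV -> \bar R := pushforward mu (shift w : borel_rV -> borel_rV).

End Wasserstein.

Section IterationBound.
Variable R : realType.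
Local Open Scope ereal_scope.

(* [lne] has lne 0 = -oo and lne +oo = +oo *)
Definition log2e (a : \bar R) : \bar R := lne a * ((ln 2)^-1)%:E.

Definition ceile (a : \bar R) : \bar R :=
  match a with
  | r%:E => ((Num.ceil r)%:~R)%:E
  | _ => a
  end.

Definition iteration_bound (eps q : R) : \bar R :=
  maxe 0 (ceile (log2e `|log2e eps%:E| - log2e `|log2e q%:E|)).

End IterationBound.

(* Exact real arithmetic.  Programs are independent of d, n and of the data:   *)
(* natural-number variables serve only as sizes, loop counters and in address  *)
(* computations, and they cannot depend on the contents of the real memory.    *)
(* Every real operation, constant and comparison costs one time unit; the      *)
(* space is one plus the largest address used.                                 *)

Inductive address :=
| IVar of nat
| INum of nat
| IAdd of address & address
| ISub of address & address
| IMul of address & address.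

Variant unary_op := OpSqrt | OpExp | OpLn | OpSin | OpCos.
Variant binary_op := OpAdd | OpSub | OpMul | OpDiv.

(* The address of the result comes first.  [For v e c] runs c with variable v  *)
(* equal to 0, ..., e - 1.                                                     *)
Inductive command :=
| Skip
| Const of address & nat
| Unary of unary_op & address & address
| Binary of binary_op & address & address & address
| IfLe of address & address & command & command
| Seq of command & command
| For of nat & address & command.

Fixpoint ieval (env : nat -> nat) (e : address) : nat :=
  match e with
  | IVar v => env v
  | INum a => a
  | IAdd e1 e2 => (ieval env e1 + ieval env e2)%N
  | ISub e1 e2 => (ieval env e1 - ieval env e2)%N
  | IMul e1 e2 => (ieval env e1 * ieval env e2)%N
  end.

Section Machine.
Variable R : realType.

Record state := State { memory : nat -> R; time_used : nat; space_used : nat }.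

Definition eval_unary (o : unary_op) (a : R) : R :=
  match o with
  | OpSqrt => Num.sqrt a
  | OpExp => expR a
  | OpLn => ln a
  | OpSin => sin a
  | OpCos => cos a
  end.

Definition eval_binary (o : binary_op) (a b : R) : R :=
  match o with
  | OpAdd => a + b
  | OpSub => a - b
  | OpMul => a * b
  | OpDiv => a / b
  end.

Definition charge (addrs : seq nat) (s : state) : state :=
  State (memory s) (time_used s).+1
    (foldr maxn (space_used s) [seq b.+1 | b <- addrs]).

Definition write (a : nat) (r : R) (s : state) : state :=
  State (fun b => if b == a then r else memory s b) (time_used s) (space_used s).

Fixpoint exec (c : command) (env : nat -> nat) (s : state) : state :=
  match c with
  | Skip => s
  | Const e m =>
      let a := ieval env e in write a m%:R (charge [:: a] s)
  | Unary o e e1 =>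
      let a := ieval env e in
      let a1 := ieval env e1 in
      write a (eval_unary o (memory s a1)) (charge [:: a; a1] s)
  | Binary o e e1 e2 =>
      let a := ieval env e in
      let a1 := ieval env e1 in
      let a2 := ieval env e2 in
      write a (eval_binary o (memory s a1) (memory s a2))
        (charge [:: a; a1; a2] s)
  | IfLe e1 e2 c1 c2 =>
      let a1 := ieval env e1 in
      let a2 := ieval env e2 in
      exec (if memory s a1 <= memory s a2 then c1 else c2) env
        (charge [:: a1; a2] s)
  | Seq c1 c2 => exec c2 env (exec c1 env s)
  | For v e c1 =>
      iteri (ieval env e)
        (fun i => exec c1 (fun u => if u == v then i else env u)) s
  end.

Definition size_env (d n : nat) : nat -> nat :=
  fun v => if v == 0%N then d else if v == 1%N then n else 0%N.

(* Layout: omega, then the x_i, then d cells for the current iterate, initially *)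
(* w_0 = 0; the working memory behind them is 0 as well.                        *)
Definition initial_state (d n : nat) (omega : 'I_n -> R) (x : 'I_n -> 'rV[R]_d) :
  state :=
  State
    (nth 0 ([seq omega i | i <- enum 'I_n]
            ++ [seq x i 0 j | i <- enum 'I_n, j <- enum 'I_d]))
    0%N (n + n * d + d)%N.

Definition reads_iterate (d n : nat) (s : state) : 'rV[R]_d :=
  \row_(j < d) memory s (n + n * d + j)%N.

Definition run (P : command) (d n : nat) (k : nat) (s : state) : state :=
  iter k (exec P (size_env d n)) s.

End Machine.

(* Main.v *)
Require Import Defs.
From mathcomp Require Import all_boot all_order all_algebra.
From mathcomp Require Import all_classical all_reals all_analysis.
From mathcomp Require Import measurable_realfun ring lra zify.
Import Order.TTheory GRing.Theory Num.Theory.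
Import numFieldNormedType.Exports.

Set Implicit Arguments.
Unset Strict Implicit.
Unset Printing Implicit Defensive.

Local Open Scope ring_scope.

(* Let y_i = shift w (x_i), m = \sum_i omega_i y_i and H = 1 - \sum_i omega_i y_i y_i^T.  In the
   frame moved by [shift w], the mean field and its covariant derivative at w are m and -H up to
   a conformal factor, and exp_w becomes exp_0, so that (N) and (S) perform the same step: shift
   the origin to the point z = tanh(|g| / 2) g / |g| with g = m H^-1, and pull z back to w.  If H
   is bounded below by l and 4 |m| < l^2, then after the step the new moment is at most
   3/4 (|m| / l)^2 and the new gap is at least l - 2 |m| / l; hence 4 |m| / l^2 is squared by each
   step and stays below q^(2^k).  The increments of w_k decay geometrically, which gives a limit,
   the barycenter b, and monotonicity of the mean field along rays bounds |shift w_k b| by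
   q^(2^k) lambda / 6.  A radial geodesic bounds the hyperbolic distance; the
   coupling that matches the i-th atoms bounds every Wasserstein distance by the largest
   displacement of an atom.

   The program maintains H^-1 by a rank-one (Sherman-Morrison) update for each atom, which costs
   O(d^2 n) per step without pivoting: every partial sum 1 - \sum_(i < k) omega_i y_i y_i^T is
   bounded below by H, hence invertible. *)

(** Shifts do not compose to shifts: [shift (shift (- w) z)] and [shift z \o shift w] differ by an
    isometry. Only isometry-invariant data can pass from one step to the next, namely the norm of
    the moment and the gap, which the Gram matrix of the moved atoms controls. The gap is carried as
    a bound on a quadratic form; the smallest eigenvalue enters once, through a minimum of the
    Rayleigh quotient.

    In one step the Newton vector has length 2s with s <= |m| / (2l). The remainder of the shift
    contributes 2s^2 to the new moment and the difference between s and tanh s another s^2, whence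
    3/4 (|m| / l)^2; each atom moves by at most 2s, which costs the gap 4s <= 2|m| / l.

    Since q may be close to 1, the increments are summed with a second bound, of ratio 3/4 whatever
    q is. It keeps the iterates within Euclidean radius 4/7, so that the limit cannot escape to the
    sphere.

    The exponential map is defined by the geodesic equation, so its value rests on uniqueness of
    geodesics: conservation of speed makes the equation linear in hyperboloid coordinates. *)

Local Notation shift := Defs.shift.

(** * The shift transformation *)

Section Vectors.
Variables (R : realType) (d : nat).
Implicit Types u v w : 'rV[R]_d.

Lemma dotC u v : dot u v = dot v u.
Proof. by apply: eq_bigr => i _; rewrite mulrC. Qed.

Lemma dotDl u v w : dot (u + v) w = dot u w + dot v w.
Proof. by rewrite -big_split; apply: eq_bigr => i _; rewrite mxE mulrDl. Qed.

Lemma dotDr u v w : dot w (u + v) = dot w u + dot w v.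
Proof. by rewrite dotC dotDl !(dotC w). Qed.

Lemma dotZl a u w : dot (a *: u) w = a * dot u w.
Proof. by rewrite mulr_sumr; apply: eq_bigr => i _; rewrite mxE mulrA. Qed.

Lemma dotZr a u w : dot w (a *: u) = a * dot w u.
Proof. by rewrite dotC dotZl dotC. Qed.

Lemma dotNl u w : dot (- u) w = - dot u w.
Proof. by rewrite -scaleN1r dotZl mulN1r. Qed.

Lemma dotNr u w : dot w (- u) = - dot w u.
Proof. by rewrite dotC dotNl dotC. Qed.

Lemma dot0l w : dot 0 w = 0.
Proof. by rewrite -(scale0r w) dotZl mul0r. Qed.

Lemma dot0r w : dot w 0 = 0.
Proof. by rewrite dotC dot0l. Qed.

Lemma dot_suml (I : finType) (F : I -> 'rV[R]_d) w :
  dot (\sum_i F i) w = \sum_i dot (F i) w.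
Proof.
rewrite (big_morph (fun u => dot u w) (id1 := 0) (op1 := +%R)) //; last exact: dot0l.
by move=> u v; exact: dotDl.
Qed.

Lemma dot_sumr (I : finType) (F : I -> 'rV[R]_d) w :
  dot w (\sum_i F i) = \sum_i dot w (F i).
Proof. by rewrite dotC dot_suml; apply: eq_bigr => i _; rewrite dotC. Qed.

Definition dotE := (dotDl, dotDr, dotZl, dotZr, dotNl, dotNr, dot0l, dot0r).

Lemma mulmx_trE u v : u *m v^T = (dot u v)%:M.
Proof.
apply/matrixP => i j; rewrite !ord1 !mxE eqxx mulr1n.
by apply: eq_bigr => k _; rewrite mxE.
Qed.

Lemma dot_delta u i : dot u (delta_mx 0 i) = u 0 i.
Proof.
rewrite /dot (bigD1 i) //= big1 ?addr0 => [|j /negbTE ji];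
  by rewrite mxE eqxx /= ?eqxx ?ji ?mulr1 ?mulr0.
Qed.

Lemma dotvv_ge0 u : 0 <= dot u u.
Proof. by apply: sumr_ge0 => i _; rewrite -expr2 sqr_ge0. Qed.

Lemma sqr_enorm u : enorm u ^+ 2 = dot u u.
Proof. by rewrite sqr_sqrtr // dotvv_ge0. Qed.

Lemma enorm_ge0 u : 0 <= enorm u.
Proof. exact: sqrtr_ge0. Qed.

Lemma dotvv_eq0 u : (dot u u == 0) = (u == 0).
Proof.
apply/eqP/eqP => [uu0|->]; last exact: dot0l.
apply/rowP => i; rewrite mxE; apply/eqP.
rewrite -sqrf_eq0 expr2; move/eqP: uu0; rewrite psumr_eq0 => [|j _]; last first.
  by rewrite -expr2 sqr_ge0.
by move=> /allP/(_ i); rewrite mem_index_enum => /(_ isT).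
Qed.

Lemma enorm_eq0 u : (enorm u == 0) = (u == 0).
Proof. by rewrite -sqrf_eq0 sqr_enorm dotvv_eq0. Qed.

Lemma enorm0 : enorm (0 : 'rV[R]_d) = 0.
Proof. by apply/eqP; rewrite enorm_eq0. Qed.

Lemma enormZ a u : enorm (a *: u) = `|a| * enorm u.
Proof. by rewrite /enorm !dotE mulrA -expr2 sqrtrM ?sqr_ge0 // sqrtr_sqr. Qed.

Lemma enormN u : enorm (- u) = enorm u.
Proof. by rewrite -scaleN1r enormZ normrN1 mul1r. Qed.

(** Cauchy-Schwarz: the squared norm of [enorm v *: u - enorm u *: v] is 2 |u| |v| (|u| |v| -
    <u,v>). *)
Lemma dot_le_enorm u v : dot u v <= enorm u * enorm v.
Proof.
have [->|v0] := eqVneq v 0; first by rewrite dot0r enorm0 mulr0.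
have [->|u0] := eqVneq u 0; first by rewrite dot0l enorm0 mul0r.
have eu : 0 < enorm u by rewrite lt_neqAle eq_sym enorm_eq0 u0 enorm_ge0.
have ev : 0 < enorm v by rewrite lt_neqAle eq_sym enorm_eq0 v0 enorm_ge0.
have := dotvv_ge0 (enorm v *: u - enorm u *: v).
rewrite !dotE -!sqr_enorm (dotC v u).
set a := enorm u in eu *; set b := enorm v in ev *.
rewrite (_ : _ + _ = (2 * (a * b)) * (a * b - dot u v)); last by ring.
by rewrite pmulr_rge0 ?subr_ge0 // ?mulr_gt0.
Qed.

Lemma normr_dot_le u v : `|dot u v| <= enorm u * enorm v.
Proof.
rewrite ler_norml dot_le_enorm andbT lerNl -dotNl.
by rewrite (le_trans (dot_le_enorm _ _)) // enormN.
Qed.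

Lemma enormD u v : enorm (u + v) <= enorm u + enorm v.
Proof.
rewrite -(@ler_pXn2r _ 2) ?nnegrE ?addr_ge0 ?enorm_ge0 //.
rewrite sqrrD !sqr_enorm !dotE (dotC v u).
have := dot_le_enorm u v; lra.
Qed.

Lemma enorm_distC u v : enorm (u - v) = enorm (v - u).
Proof. by rewrite -enormN opprB. Qed.

Lemma enorm_sum (I : finType) (F : I -> 'rV[R]_d) :
  enorm (\sum_i F i) <= \sum_i enorm (F i).
Proof.
elim/big_rec2: _ => [|i x y _ le_xy]; first by rewrite enorm0.
by rewrite (le_trans (enormD _ _)) // lerD2l.
Qed.

Lemma enorm_wsum n (om : 'I_n -> R) (F : 'I_n -> 'rV[R]_d) M :
  (forall i, 0 <= om i) -> \sum_i om i = 1 -> (forall i, enorm (F i) <= M) ->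
  enorm (\sum_i om i *: F i) <= M.
Proof.
move=> om0 om1 FM; rewrite (le_trans (enorm_sum _)) //.
rewrite -[M]mul1r -om1 mulr_suml ler_sum // => i _.
by rewrite enormZ ger0_norm // ler_wpM2l.
Qed.

Lemma enorm_le_sqr u M : 0 <= M -> dot u u <= M ^+ 2 -> enorm u <= M.
Proof. by move=> M0; rewrite -sqr_enorm ler_pXn2r ?nnegrE ?enorm_ge0. Qed.

Lemma in_sphereP u : in_sphere u <-> dot u u = 1.
Proof.
rewrite -sqr_enorm; split => [->|/eqP]; first by rewrite expr1n.
by rewrite sqrf_eq1 => /orP[/eqP//|/eqP e]; have := enorm_ge0 u; rewrite e; lra.
Qed.

Lemma in_ballP u : in_ball u <-> dot u u < 1.
Proof.
rewrite -sqr_enorm /in_ball -[X in _ ^+ 2 < X](expr1n _ 2).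
by rewrite ltr_pXn2r ?nnegrE ?enorm_ge0.
Qed.

Lemma coord_le_enorm u i : `|u 0 i| <= enorm u.
Proof.
rewrite -sqrtr_sqr ler_sqrt ?dotvv_ge0 //.
rewrite /dot (bigD1 i) //= -expr2.
by rewrite lerDl sumr_ge0 // => j _; rewrite -expr2 sqr_ge0.
Qed.

End Vectors.

Section Shift.
Variables (R : realType) (d : nat).
Implicit Types w x y z a b : 'rV[R]_d.

Lemma ball_opp w : in_ball w -> in_ball (- w).
Proof. by rewrite /in_ball enormN. Qed.

Lemma in_ball0 : in_ball (0 : 'rV[R]_d).
Proof. by rewrite /in_ball enorm0. Qed.

Lemma shift_den_gt0 w x : in_ball w -> in_sphere x -> 0 < 1 - 2 * dot w x + dot w w.
Proof.
move=> /in_ballP w1 /in_sphereP x1.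
have -> : 1 - 2 * dot w x + dot w w = dot (x - w) (x - w).
  by rewrite !dotE x1 (dotC x w); ring.
rewrite lt_neqAle eq_sym dotvv_eq0 dotvv_ge0 andbT subr_eq0.
by apply/eqP => xw; move: w1; rewrite -xw x1 ltxx.
Qed.

(** The denominator is |w - z|^2 + (1 - |w|^2)(1 - |z|^2). *)
Lemma shift_ball_den_gt0 w z : in_ball w -> in_ball z ->
  0 < 1 - 2 * dot w z + dot w w * dot z z.
Proof.
move=> /in_ballP w1 /in_ballP z1.
have := dotvv_ge0 (w - z); rewrite !dotE (dotC z w) => h.
have : 0 < (1 - dot w w) * (1 - dot z z) by rewrite mulr_gt0 ?subr_gt0.
lra.
Qed.

Lemma shiftE w z : shift w z = (1 - 2 * dot w z + dot w w * dot z z)^-1 *: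
    ((1 - dot w w) *: z - (1 + dot z z - 2 * dot w z) *: w).
Proof. by rewrite /shift !sqr_enorm. Qed.

(** On the sphere the scaling factor is the Poisson kernel (1 - |w|^2) / |x - w|^2: up to the
    translation by -w, the shift is a scaled inversion of x - w. The Gram identity below and the
    program both use this form. *)
Lemma shift_sphereE w x : in_ball w -> in_sphere x ->
  shift w x = ((1 - dot w w) / (1 - 2 * dot w x + dot w w)) *: (x - w) - w.
Proof.
move=> w1 x1; have D0 := shift_den_gt0 w1 x1.
rewrite shiftE ((in_sphereP x).1 x1) mulr1 scalerBr !scalerA scalerBr.
rewrite -[RHS]addrA -opprD -[X in _ - (_ + X)]scale1r -scalerDl.
congr (_ *: _ - _ *: _); [by rewrite mulrC|field; exact: lt0r_neq0].
Qed.

Lemma shift_0l x : shift 0 x = x.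
Proof. by rewrite shiftE !dotE scaler0 mulr0 mul0r !subr0 addr0 invr1 !scale1r. Qed.

Lemma shift_vv w : shift w w = 0.
Proof.
have e : 1 - dot w w - (1 + dot w w - 2 * dot w w) = 0 by ring.
by rewrite shiftE -scalerBl e scale0r scaler0.
Qed.

(** Conformality: 1 - <x,y> is half the squared chord, and the shift scales a chord by the geometric
    mean of the Poisson kernels at its ends. For x = y it yields invariance of the sphere. *)
Lemma dot_shift_gram w x y : in_ball w -> in_sphere x -> in_sphere y ->
  1 - dot (shift w x) (shift w y) =
  (1 - dot w w) / (1 - 2 * dot w x + dot w w) *
  ((1 - dot w w) / (1 - 2 * dot w y + dot w w)) * (1 - dot x y).
Proof.
move=> w1 x1 y1; have Dx := shift_den_gt0 w1 x1; have Dy := shift_den_gt0 w1 y1.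
rewrite !shift_sphereE // !dotE (dotC x w).
by field; rewrite !gt_eqF.
Qed.

Lemma shift_sphere w x : in_ball w -> in_sphere x -> in_sphere (shift w x).
Proof.
move=> w1 x1; apply/in_sphereP/eqP; rewrite eq_sym -subr_eq0 dot_shift_gram //.
by rewrite ((in_sphereP x).1 x1) subrr mulr0.
Qed.

Lemma dot_shift_ball w z : in_ball w -> in_ball z ->
  1 - dot (shift w z) (shift w z) =
  (1 - dot w w) * (1 - dot z z) / (1 - 2 * dot w z + dot w w * dot z z).
Proof.
move=> w1 z1; have D := shift_ball_den_gt0 w1 z1.
rewrite shiftE !dotE (dotC z w).
by field; rewrite gt_eqF.
Qed.

Lemma shift_ball w z : in_ball w -> in_ball z -> in_ball (shift w z).
Proof.
move=> w1 z1; apply/in_ballP; rewrite -subr_gt0 dot_shift_ball //.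
rewrite divr_gt0 ?shift_ball_den_gt0 // mulr_gt0 // subr_gt0; exact/in_ballP.
Qed.

Lemma shiftK w z : in_ball w -> in_ball z -> shift (- w) (shift w z) = z.
Proof.
move=> w1 z1; have D := shift_ball_den_gt0 w1 z1.
have w1' := (in_ballP w).1 w1.
(* With the image named, the outer shift involves only <w,r> and |r|^2, which are computed
   beforehand. *)
have [r er] : exists r, r = shift w z by exists (shift w z).
rewrite -er; have Er : dot w r = ((1 - dot w w) * dot w z - (1 + dot z z - 2 * dot w z) * dot w w) / (1 - 2 * dot w z + dot w w * dot z z).
  by rewrite er shiftE !dotE mulrC.
have Err : dot r r = 1 - (1 - dot w w) * (1 - dot z z) / (1 - 2 * dot w z + dot w w * dot z z).
  by rewrite -dot_shift_ball // -er subKr.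
have D2 : 0 < 1 - 2 * dot (- w) r + dot (- w) (- w) * dot r r.
  by rewrite shift_ball_den_gt0 //; [exact: ball_opp|rewrite er; exact: shift_ball].
have e : 1 - 2 * dot (- w) r + dot (- w) (- w) * dot r r =
    (1 - dot w w) ^+ 2 / (1 - 2 * dot w z + dot w w * dot z z).
  by rewrite !dotE Er Err; field; rewrite gt_eqF.
rewrite shiftE e !dotE Er Err {1}er shiftE scalerN opprK.
apply/rowP => j; rewrite !mxE; field.
by rewrite !gt_eqF // subr_gt0.
Qed.

Lemma shiftNK w z : in_ball w -> in_ball z -> shift w (shift (- w) z) = z.
Proof. by move=> w1 z1; rewrite -{1}[w]opprK shiftK //; exact: ball_opp. Qed.

(* The Poisson kernel is a cocycle: hence [shift (shift (- w) z)] and [shift z \o shift w]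
   differ by an isometry of the sphere only. *)
Lemma shift_gyration w z x y : in_ball w -> in_ball z -> in_sphere x -> in_sphere y ->
  dot (shift (shift (- w) z) x) (shift (shift (- w) z) y) =
  dot (shift z (shift w x)) (shift z (shift w y)).
Proof.
move=> w1 z1 x1 y1.
have w1' : 0 < 1 - dot w w by rewrite subr_gt0; exact/in_ballP.
have nw1 : in_ball (- w) := ball_opp w1.
pose v := shift (- w) z.
have v1 : in_ball v by exact: shift_ball.
have E := shift_ball_den_gt0 nw1 z1; rewrite !dotE in E.
have Evv : 1 - dot v v = (1 - dot w w) * (1 - dot z z) /
    (1 + 2 * dot w z + dot w w * dot z z).
  rewrite dot_shift_ball // !dotE; congr (_ / _); ring.
have K t : in_sphere t ->
  (1 - dot z z) / (1 - 2 * dot z (shift w t) + dot z z) *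
  ((1 - dot w w) / (1 - 2 * dot w t + dot w w)) =
  (1 - dot v v) / (1 - 2 * dot v t + dot v v).
  move=> t1; have t1' := (in_sphereP t).1 t1.
  have D := shift_den_gt0 w1 t1.
  have D2 := shift_den_gt0 z1 (shift_sphere w1 t1).
  have D3 := shift_den_gt0 v1 t1.
  have e : (1 - 2 * dot v t + dot v v) * (1 + 2 * dot w z + dot w w * dot z z) =
      (1 - 2 * dot z (shift w t) + dot z z) * (1 - 2 * dot w t + dot w w).
    rewrite -[dot v v](subKr 1) Evv /v shiftE shift_sphereE // !dotE (dotC z w).
    field; rewrite !gt_eqF //=.
    by move: E; rewrite (_ : 1 - _ + _ = 1 + 2 * dot w z + dot w w * dot z z) //; ring.
  have E' : 0 < 1 + 2 * dot w z + dot w w * dot z z by lra.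
  by rewrite Evv mulf_div -e; field; rewrite !gt_eqF.
apply: (can_inj (subKr 1)).
rewrite -/v (dot_shift_gram v1 x1 y1).
rewrite (dot_shift_gram z1 (shift_sphere w1 x1) (shift_sphere w1 y1)).
by rewrite (dot_shift_gram w1 x1 y1) -!K //; ring.
Qed.

(** Two expressions of sinh^2 of half the hyperbolic distance, |r|^2 / (1 - |r|^2) for r =
    [shift a b] and |a - b|^2 / ((1 - |a|^2)(1 - |b|^2)), cross-multiplied. It turns the length of a
    step in the moved frame into a Euclidean one. *)
Lemma sqdist_shift a b : in_ball a -> in_ball b ->
  dot (a - b) (a - b) * (1 - dot (shift a b) (shift a b)) =
  dot (shift a b) (shift a b) * ((1 - dot a a) * (1 - dot b b)).
Proof.
move=> a1 b1; have D := shift_ball_den_gt0 a1 b1.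
have h := dot_shift_ball a1 b1.
rewrite h -[dot (shift a b) _](subKr 1) h.
by rewrite !dotE (dotC b a); field; rewrite gt_eqF.
Qed.

End Shift.

(** * One Newton step from the origin *)

Definition moment (R : realType) d n (om : 'I_n -> R) (y : 'I_n -> 'rV[R]_d) :=
  \sum_i om i *: y i.

(* [1 - \sum_i om i *: ((y i)^T *m y i)] is bounded below by [lam] *)
Definition gapped (R : realType) d n (om : 'I_n -> R) (y : 'I_n -> 'rV[R]_d) lam :=
  forall v, \sum_i om i * dot (y i) v ^+ 2 <= (1 - lam) * dot v v.

(** At s = |g| / 2 the doubled argument is |g|, so that one exponential of |g| is evaluated, as in
    the program. *)
Definition tanhR (R : realType) (s : R) := (expR (s + s) - 1) / (expR (s + s) + 1).

Section Tanh.
Variable R : realType.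
Implicit Types s r : R.

Lemma tanhR_ge0 s : 0 <= s -> 0 <= tanhR s.
Proof.
move=> s0; have h := expR_ge1Dx (s + s).
by rewrite divr_ge0 //; lra.
Qed.

Lemma tanhR_lt1 s : tanhR s < 1.
Proof.
rewrite ltr_pdivrMr ?mul1r; first by lra.
by have := expR_gt0 (s + s); lra.
Qed.

Lemma tanhR0 : tanhR (0 : R) = 0.
Proof. by rewrite /tanhR addr0 expR0 subrr mul0r. Qed.

Lemma subr_tanhR_le s : 0 <= s -> s - tanhR s <= s ^+ 2 / 2.
Proof.
move=> s0; rewrite /tanhR expRD; set E := expR s.
have E1 : 1 + s <= E by exact: expR_ge1Dx.
have EE : (1 + s) ^+ 2 <= E * E by rewrite expr2 ler_pM ?addr_ge0.
rewrite lerBlDr -lerBlDl ler_pdivlMr; last by nra.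
(* Cleared of its denominator the claim is E^2 (2 - 2s + s^2) >= 2 + 2s - s^2; with (1 + s)^2 in
   place of E^2 the left side exceeds the right one by s^4. *)
have : 0 <= (E * E - (1 + s) ^+ 2) * (2 - 2 * s + s ^+ 2) by rewrite mulr_ge0 ?subr_ge0 //; nra.
nra.
Qed.

Lemma tanhR_le s : 0 <= s -> tanhR s <= s.
Proof.
move=> s0; rewrite /tanhR ler_pdivrMr; last by have := expR_gt0 (s + s); lra.
(* At x = 2s, nonnegativity of [g] is the claim, doubled; g' >= 0 amounts to 1 - x <= e^(-x). *)
pose g x : R := x * (expR x + 1) - 2 * (expR x - 1).
have dg x : is_derive x (1 : R) g (1 - expR x * (1 - x)).
  by apply: is_derive_eq; rewrite /GRing.scale /=; ring.
have : g 0 <= g (s + s).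
  apply: (@ger0_derive1_ndecr _ g 0 (s + s)); rewrite ?addr_ge0 //.
    move=> x _; rewrite derive1E derive_val subr_ge0.
    rewrite -ler_pdivlMl ?expR_gt0 // mulr1 -expRN.
    by have := expR_ge1Dx (- x); lra.
  by apply: derivable_within_continuous => x _; case: (dg x).
rewrite /g expR0; lra.
Qed.

End Tanh.

(** * The shift by r e for a unit vector e *)

Section ShiftAlongUnit.
Variables (R : realType) (d : nat) (e y : 'rV[R]_d).
Hypotheses (e1 : in_sphere e) (y1 : in_sphere y).

Lemma ball_scale_unit r : 0 <= r -> r < 1 -> in_ball (r *: e).
Proof. by move=> r0 r1; rewrite /in_ball enormZ e1 mulr1 ger0_norm. Qed.

Let c := dot e y.

Lemma normr_dot_unit : c ^+ 2 <= 1.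
Proof.
have := normr_dot_le e y; rewrite e1 y1 mulr1 => h.
by rewrite -(expr1n _ 2) -[c ^+ 2]real_normK ?num_real // ler_pXn2r ?nnegrE.
Qed.

Lemma shift_unit_den_gt0 r : 0 <= r -> r < 1 -> 0 < 1 - 2 * r * c + r ^+ 2.
Proof.
move=> r0 r1; have := shift_den_gt0 (ball_scale_unit r0 r1) y1.
by rewrite !dotE ((in_sphereP e).1 e1) mulr1 -expr2 mulrA.
Qed.

Lemma shift_unitE r : shift (r *: e) y = (1 - 2 * r * c + r ^+ 2)^-1 *:
  ((1 - r ^+ 2) *: y - (2 * (1 - r * c) * r) *: e).
Proof.
rewrite shiftE !dotE ((in_sphereP y).1 y1) ((in_sphereP e).1 e1) scalerA -/c.
by congr (_^-1 *: (_ *: _ - _ *: _)); ring.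
Qed.

Lemma dot_shift_unit r : 0 <= r -> r < 1 ->
  dot e (shift (r *: e) y) = ((1 + r ^+ 2) * c - 2 * r) / (1 - 2 * r * c + r ^+ 2).
Proof.
move=> r0 r1; have D := shift_unit_den_gt0 r0 r1.
rewrite shift_unitE !dotE ((in_sphereP e).1 e1) -/c; field; rewrite gt_eqF //.
Qed.

(** Moving the origin further along e pushes every point of the sphere away from e. Averaged over
    the atoms this is the monotonicity of the mean field along a ray. *)
Lemma dot_shift_unit_decr r0 r1 : 0 <= r0 -> r0 <= r1 -> r1 < 1 ->
  dot e (shift (r1 *: e) y) <= dot e (shift (r0 *: e) y).
Proof.
move=> r00 r01 r11.
have D0 := shift_unit_den_gt0 r00 (le_lt_trans r01 r11).
have D1 := shift_unit_den_gt0 (le_trans r00 r01) r11.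
rewrite !dot_shift_unit //; try lra.
rewrite ler_pdivrMr // mulrAC ler_pdivlMr // -subr_ge0.
rewrite (_ : _ - _ = 2 * (1 - c ^+ 2) * ((r1 - r0) * (1 - r0 * r1))); last by ring.
have := normr_dot_unit => c1.
rewrite mulr_ge0 ?mulr_ge0 ?subr_ge0 //.
by rewrite mulr_ile1 //; lra.
Qed.

(** The squared displacement is 4 r^2 (1 - c^2) / (1 - 2rc + r^2), where denominator minus numerator
    of the fraction is (r - c)^2. *)
Lemma enorm_shift_unitB r : 0 <= r -> r < 1 -> enorm (shift (r *: e) y - y) <= 2 * r.
Proof.
move=> r0 r1; have D := shift_unit_den_gt0 r0 r1.
have z1 := shift_sphere (ball_scale_unit r0 r1) y1.
apply: enorm_le_sqr; first by rewrite mulr_ge0.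
rewrite !(dotDl, dotDr, dotNl, dotNr).
rewrite ((in_sphereP _).1 z1) ((in_sphereP y).1 y1) (dotC y).
have -> : dot (shift (r *: e) y) y = 1 - 2 * r ^+ 2 * ((1 - c ^+ 2) / (1 - 2 * r * c + r ^+ 2)).
  rewrite shift_unitE !dotE ((in_sphereP y).1 y1) -/c; field; rewrite gt_eqF //.
set q := _ / _.
have q1 : q <= 1.
  rewrite ler_pdivrMr // mul1r.
  by have := sqr_ge0 (r - c); lra.
have := ler_wpM2l (sqr_ge0 r) q1; lra.
Qed.

(** First-order expansion in r, valid for all r < 1: the squared remainder is exactly 4 r^4 times
    the same fraction (1 - c^2) / (1 - 2rc + r^2) <= 1. *)
Lemma enorm_shift_unit_taylor r : 0 <= r -> r < 1 ->
  enorm (shift (r *: e) y - y + (2 * r) *: (e - c *: y)) <= 2 * r ^+ 2.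
Proof.
move=> r0 r1; have D := shift_unit_den_gt0 r0 r1.
apply: enorm_le_sqr; first by rewrite mulr_ge0 ?sqr_ge0.
rewrite shift_unitE !dotE ((in_sphereP _).1 y1) ((in_sphereP e).1 e1) (dotC y e) -/c.
set A := (X in X <= _).
have -> : A = 4 * r ^+ 4 * ((1 - c ^+ 2) / (1 - 2 * r * c + r ^+ 2)).
  by rewrite /A; field; rewrite gt_eqF.
rewrite (_ : (2 * r ^+ 2) ^+ 2 = 4 * r ^+ 4 * 1); last by ring.
rewrite ler_wpM2l ?mulr_ge0 ?exprn_ge0 //.
rewrite ler_pdivrMr // mul1r.
by have := sqr_ge0 (r - c); lra.
Qed.

Lemma enorm_proj_le1 : enorm (e - c *: y) <= 1.
Proof.
apply: enorm_le_sqr => //.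
rewrite !dotE ((in_sphereP _).1 y1) ((in_sphereP e).1 e1) (dotC y e) -/c.
by have := sqr_ge0 c; lra.
Qed.

End ShiftAlongUnit.

(** * Moment and gap after a shift *)

Section Frame.
Variables (R : realType) (d n : nat) (om : 'I_n -> R).
Hypotheses (om_gt0 : forall i, 0 < om i) (om1 : \sum_i om i = 1).
Variable y : 'I_n -> 'rV[R]_d.
Hypothesis y1 : forall i, in_sphere (y i).

Let om_ge0 i : 0 <= om i. Proof. exact/ltW. Qed.

(** A difference of squares (a - b)(a + b) in which |a - b| <= 2r |v| by the displacement bound and
    |a + b| <= 2 |v|. *)
Lemma gapped_shift lam e r : in_sphere e -> 0 <= r -> r < 1 -> gapped om y lam ->
  gapped om (fun i => shift (r *: e) (y i)) (lam - 4 * r).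
Proof.
move=> e1 r0 r1 gy v.
have key i : dot (shift (r *: e) (y i)) v ^+ 2 <= dot (y i) v ^+ 2 + 4 * r * dot v v.
  rewrite -lerBlDl subr_sqr -dotDl.
  have -> : dot (shift (r *: e) (y i)) v - dot (y i) v = dot (shift (r *: e) (y i) - y i) v.
    by rewrite !dotE.
  rewrite (le_trans (ler_norm _)) // normrM -sqr_enorm.
  rewrite (_ : 4 * r * _ = (2 * r * enorm v) * (2 * enorm v)); last by ring.
  rewrite ler_pM //.
    rewrite (le_trans (normr_dot_le _ _)) // ler_wpM2r ?enorm_ge0 //.
    exact: enorm_shift_unitB.
  rewrite (le_trans (normr_dot_le _ _)) // ler_wpM2r ?enorm_ge0 //.
  rewrite (le_trans (enormD _ _)) // (y1 i).
  by rewrite (shift_sphere (ball_scale_unit e1 r0 r1) (y1 i)).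
apply: (@le_trans _ _ (\sum_i (om i * dot (y i) v ^+ 2 + om i * (4 * r * dot v v)))).
  by apply: ler_sum => i _; rewrite -mulrDr ler_wpM2l.
rewrite big_split /= -mulr_suml om1 mul1r.
by have := gy v; lra.
Qed.

Lemma sum_dot_projE e : in_sphere e ->
  dot e (\sum_i om i *: (e - dot e (y i) *: y i)) = 1 - \sum_i om i * dot (y i) e ^+ 2.
Proof.
move=> e1; rewrite dot_sumr -om1 -sumrB; apply: eq_bigr => i _.
by rewrite !dotE ((in_sphereP _).1 e1) (dotC (y i) e); ring.
Qed.

Lemma gapped_proj lam e : in_sphere e -> gapped om y lam ->
  lam <= dot e (\sum_i om i *: (e - dot e (y i) *: y i)).
Proof.
move=> e1 gy; rewrite sum_dot_projE //.
by have := gy e; rewrite ((in_sphereP _).1 e1); lra.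
Qed.

(** The last hypothesis is the Newton equation m = g H for g = 2s e; pairing it with e bounds the
    length of g. *)
Lemma newton_step_length lam e s : in_sphere e -> 0 <= s -> gapped om y lam ->
  moment om y = (2 * s) *: \sum_i om i *: (e - dot e (y i) *: y i) ->
  2 * s * lam <= enorm (moment om y).
Proof.
move=> e1 s0 gy my.
have := dot_le_enorm e (moment om y); rewrite e1 mul1r; apply: le_trans.
by rewrite my dotZr ler_wpM2l ?mulr_ge0 // gapped_proj.
Qed.

(** The Newton equation cancels the first-order term of the expansion. What remains is the quadratic
    remainder and the mismatch 2(s - r) between the Newton vector and the shift actually
    performed. *)
Lemma enorm_newton_moment e s r : in_sphere e -> 0 <= r -> r <= s -> r < 1 ->
  moment om y = (2 * s) *: \sum_i om i *: (e - dot e (y i) *: y i) ->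
  enorm (moment om (fun i => shift (r *: e) (y i))) <= 2 * r ^+ 2 + 2 * (s - r).
Proof.
move=> e1 r0 rs r1 my.
have -> : moment om (fun i => shift (r *: e) (y i)) =
   \sum_i om i *: (shift (r *: e) (y i) - y i + (2 * r) *: (e - dot e (y i) *: y i)
      + (2 * (s - r)) *: (e - dot e (y i) *: y i)).
  rewrite -[LHS](subrK (moment om y)) {2}my scaler_sumr -sumrB -big_split /=.
  apply: eq_bigr => i _; apply/rowP => j; rewrite !mxE; ring.
apply: enorm_wsum => // i; rewrite (le_trans (enormD _ _)) // lerD //.
  exact: enorm_shift_unit_taylor.
rewrite enormZ ger0_norm ?mulr_ge0 ?subr_ge0 // ler_piMr ?mulr_ge0 ?subr_ge0 //.
exact: enorm_proj_le1.
Qed.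

Lemma dot_moment_shift_le lam e r : in_sphere e -> 0 <= r -> r < 1 -> gapped om y lam ->
  dot e (moment om (fun i => shift (r *: e) (y i))) <=
  enorm (moment om y) - 2 * r * lam + 2 * r ^+ 2.
Proof.
move=> e1 r0 r1 gy.
have -> : moment om (fun i => shift (r *: e) (y i)) =
   \sum_i om i *: (shift (r *: e) (y i) - y i + (2 * r) *: (e - dot e (y i) *: y i))
   + moment om y - (2 * r) *: \sum_i om i *: (e - dot e (y i) *: y i).
  rewrite scaler_sumr -big_split -sumrB /=.
  apply: eq_bigr => i _; apply/rowP => j; rewrite !mxE; ring.
rewrite !dotE.
set A := \sum_i om i *: (_ - y i + _); set B := \sum_i _.
have hA : dot e A <= 2 * r ^+ 2.
  rewrite (le_trans (dot_le_enorm _ _)) // e1 mul1r; apply: enorm_wsum => // i.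
  exact: enorm_shift_unit_taylor.
have hB : 2 * r * lam <= 2 * r * dot e B by rewrite ler_wpM2l ?mulr_ge0 ?gapped_proj.
have hm : dot e (moment om y) <= enorm (moment om y).
  by rewrite (le_trans (dot_le_enorm _ _)) // e1 mul1r.
lra.
Qed.

(** If r e centers the atoms, then by monotonicity the e-component of the moment is still
    nonnegative at every s <= r, so 2 s lam - 2 s^2 <= M there. A suitable s violates this as soon
    as r exceeds 2M / (3 lam). *)
Lemma centered_shift_close lam e r : in_sphere e -> 0 <= r -> r < 1 -> 0 < lam ->
  gapped om y lam -> 4 * enorm (moment om y) < lam ^+ 2 ->
  moment om (fun i => shift (r *: e) (y i)) = 0 ->
  3 * r * lam <= 2 * enorm (moment om y).
Proof.
move=> e1 r0 r1 lam0 gy hm mr; set M := enorm (moment om y) in hm *.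
have M0 : 0 <= M by exact: enorm_ge0.
have key s : 0 <= s -> s <= r -> 2 * s * lam - 2 * s ^+ 2 <= M.
  move=> s0 sr; have s1 : s < 1 by lra.
  have h1 := dot_moment_shift_le e1 s0 s1 gy.
  have : 0 <= dot e (moment om (fun i => shift (s *: e) (y i))).
    rewrite -(dot0r e) -mr !dot_sumr ler_sum // => i _; rewrite !(dotZr (om i)) ler_wpM2l //.
    exact: (dot_shift_unit_decr e1 (y1 i) s0 sr r1).
  rewrite -/M in h1; lra.
rewrite leNgt; apply/negP => hlt.
(* For M = 0 the choice s = 2M / (3 lam) degenerates to 0; a small positive s takes its place. *)
have [M00|Mn0] := eqVneq M 0.
  have rp : 0 < r by rewrite M00 mulr0 in hlt; nra.
  pose s := Num.min r (lam / 2).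
  have s0 : 0 < s by rewrite lt_min rp; lra.
  have sr : s <= r by rewrite ge_min lexx.
  have sl : s <= lam / 2 by rewrite ge_min lexx orbT.
  by have := key s (ltW s0) sr; rewrite M00; nra.
have Mp : 0 < M by rewrite lt_neqAle eq_sym Mn0.
(* Here 2 s lam = 4M/3, and 2 s^2 <= 2M/9 because 4M < lam^2, so the left side is at least 10M/9 >
   M. *)
pose s := 2 * M / (3 * lam).
have sE : s * lam = 2 / 3 * M by rewrite /s; field; rewrite gt_eqF.
have s0 : 0 <= s by rewrite divr_ge0 ?mulr_ge0 // ltW.
have sr : s <= r by rewrite ler_pdivrMr; lra.
have := key s s0 sr.
have : s ^+ 2 * lam ^+ 2 <= 4 / 9 * M * (lam ^+ 2 / 4).
  by rewrite -exprMn sE; nra.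
rewrite (_ : 4 / 9 * M * _ = M / 9 * lam ^+ 2); last by field.
rewrite ler_pM2r ?exprn_gt0 //; lra.
Qed.

End Frame.

(** * Transfer along equal Gram matrices *)

Section Gram.
Variables (R : realType) (d n : nat) (om : 'I_n -> R).
Hypothesis om_ge0 : forall i, 0 <= om i.
Variables y z : 'I_n -> 'rV[R]_d.
Hypothesis yz : forall i j, dot (y i) (y j) = dot (z i) (z j).

Lemma dot_comb_gram (a : 'I_n -> R) :
  dot (\sum_i a i *: y i) (\sum_i a i *: y i) = dot (\sum_i a i *: z i) (\sum_i a i *: z i).
Proof.
rewrite !dot_suml; apply: eq_bigr => i _; rewrite !dot_sumr; apply: eq_bigr => j _.
by rewrite !dotE yz.
Qed.

Lemma enorm_moment_gram : enorm (moment om y) = enorm (moment om z).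
Proof. by rewrite /enorm dot_comb_gram. Qed.

(* The nonzero eigenvalues of [\sum_i om i *: ((y i)^T *m y i)] are those of a Gram matrix. *)
Lemma gapped_gram lam : lam <= 1 -> gapped om y lam -> gapped om z lam.
Proof.
move=> lam1 gy v.
pose a i := dot (z i) v; pose S := \sum_i om i * a i ^+ 2.
pose g := \sum_i (om i * a i) *: y i; pose gz := \sum_i (om i * a i) *: z i.
have S0 : 0 <= S by apply: sumr_ge0 => i _; rewrite mulr_ge0 ?sqr_ge0.
have SE : S = dot gz v.
  by rewrite dot_suml; apply: eq_bigr => i _; rewrite dotZl /a; ring.
have gE : dot g g = dot gz gz by exact: dot_comb_gram.
have hS : S ^+ 2 <= dot g g * dot v v.
  rewrite gE SE -!sqr_enorm -exprMn -[X in X <= _]real_normK ?num_real //.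
  by rewrite ler_pXn2r ?nnegrE ?mulr_ge0 ?enorm_ge0 // normr_dot_le.
have hg : dot g g <= (1 - lam) * S.
  have E : dot g g = \sum_i om i * (a i * dot (y i) g).
    by rewrite dot_suml; apply: eq_bigr => i _; rewrite dotZl; ring.
  (* With b_i = <y_i, g>, sum 2 t a_i b_i <= t^2 a_i^2 + b_i^2 over the weights. The gap bounds the
     sum of the b_i^2 by t |g|^2, and division by t gives |g|^2 <= t S; t = 0 is treated apart. *)
  pose t := 1 - lam.
  have t0 : 0 <= t by rewrite subr_ge0.
  have h2 : t * (2 * dot g g) <= t * (t * S) + \sum_i om i * dot (y i) g ^+ 2.
    rewrite E !mulr_sumr -big_split /=; apply: ler_sum => i _.
    rewrite -subr_ge0 (_ : _ - _ = om i * (t * a i - dot (y i) g) ^+ 2).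
      by rewrite mulr_ge0 ?sqr_ge0.
    by ring.
  have := gy g; rewrite -/t => h3.
  have [t00|tn0] := eqVneq t 0.
    rewrite -/t t00 mul0r; rewrite t00 mul0r in h3.
    have all0 i : om i * dot (y i) g ^+ 2 = 0.
      have p j : true -> 0 <= om j * dot (y j) g ^+ 2 by rewrite mulr_ge0 ?sqr_ge0.
      have : \sum_i om i * dot (y i) g ^+ 2 == 0 by rewrite eq_le h3 sumr_ge0.
      by rewrite psumr_eq0 // => /allP/(_ i); rewrite mem_index_enum => /(_ isT)/eqP.
    rewrite E big1 // => i _.
    have /eqP := all0 i; rewrite mulf_eq0 sqrf_eq0 => /orP[/eqP->|/eqP->]; ring.
  have tp : 0 < t by rewrite lt_neqAle eq_sym tn0.
  by rewrite -/t -(ler_pM2l tp); lra.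
have [S00|Sn0] := eqVneq S 0.
  by rewrite -/S S00 mulr_ge0 ?dotvv_ge0 // subr_ge0.
have Sp : 0 < S by rewrite lt_neqAle eq_sym Sn0.
rewrite -/S -(ler_pM2l Sp) -expr2 (le_trans hS) //.
by have := ler_wpM2r (dotvv_ge0 v) hg; lra.
Qed.

End Gram.

(** * Quadratic convergence in the moving frame *)

(** Nested intervals [a_k - g_k, a_k + g_k], with g_k the tail of the geometric series; the limit is
    the supremum of the left ends, which gives the error bound at every k. *)
Lemma geometric_cauchy (R : realType) (a : nat -> R) C rho :
  0 <= C -> 0 <= rho -> rho < 1 -> (forall k, `|a k.+1 - a k| <= C * rho ^+ k) ->
  exists l, forall k, `|a k - l| <= C / (1 - rho) * rho ^+ k.
Proof.
move=> C0 rho0 rho1 ha; pose g k := C / (1 - rho) * rho ^+ k.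
have gS k : g k.+1 = g k - C * rho ^+ k.
  by rewrite /g exprS; field; rewrite subr_eq0 gt_eqF.
have g0 k : 0 <= g k by rewrite mulr_ge0 ?exprn_ge0 // divr_ge0 // subr_ge0 ltW.
have up j k : (j <= k)%N -> a j - g j <= a k - g k.
  elim: k => [|k IH]; first by rewrite leqn0 => /eqP->.
  rewrite leq_eqVlt => /orP[/eqP->//|/IH h]; apply: (le_trans h).
  by have := ha k; rewrite ler_norml gS; lra.
have dn j k : (j <= k)%N -> a k + g k <= a j + g j.
  elim: k => [|k IH]; first by rewrite leqn0 => /eqP->.
  rewrite leq_eqVlt => /orP[/eqP->//|/IH h]; apply: (le_trans _ h).
  by have := ha k; rewrite ler_norml gS; lra.
have lr j k : a j - g j <= a k + g k.
  apply: (@le_trans _ _ (a (maxn j k) - g (maxn j k))); first by rewrite up ?leq_maxl.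
  apply: (@le_trans _ _ (a (maxn j k) + g (maxn j k))); last by rewrite dn ?leq_maxr.
  by have := g0 (maxn j k); lra.
pose S := [set a j - g j | j in [set: nat]]%classic.
have hS : has_sup S.
  split; first by exists (a 0%N - g 0%N); exists 0%N.
  by exists (a 0%N + g 0%N) => _ [j _ <-].
exists (sup S) => k; rewrite -/(g k).
have h1 : a k - g k <= sup S by apply: sup_upper_bound => //; exists k.
have h2 : sup S <= a k + g k by apply: ge_sup; [exact: hS.1|move=> _ [j _ <-]].
by rewrite ler_norml; lra.
Qed.

Lemma le_geometric_limit (R : realType) (a b C rho : R) :
  0 <= C -> 0 <= rho -> rho < 1 -> (forall k : nat, a <= b + C * rho ^+ k) -> a <= b.
Proof.
move=> C0 rho0 rho1 h; rewrite leNgt; apply/negP => ba.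
have [C00|Cn0] := eqVneq C 0; first by have := h 0%N; rewrite C00; lra.
have Cp : 0 < C by rewrite lt_neqAle eq_sym Cn0.
have /cvgrPdist_lt : (rho ^+ n @[n --> \oo] --> (0 : R))%classic.
  by apply: cvg_expr; rewrite ger0_norm.
move=> /(_ ((a - b) / C)); rewrite divr_gt0 ?subr_gt0 // => /(_ isT)[N _ /(_ N (leqnn N))].
rewrite /= sub0r normrN ger0_norm ?exprn_ge0 // ltr_pdivlMr //.
by have := h N; lra.
Qed.

Lemma mul_1Bdot_le1 (R : realType) d (a b : 'rV[R]_d) : in_ball a -> in_ball b ->
  (1 - dot a a) * (1 - dot b b) <= 1.
Proof.
move=> /in_ballP a1 /in_ballP b1.
have := dotvv_ge0 a; have := dotvv_ge0 b => b0 a0.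
by rewrite mulr_ile1 ?subr_ge0 ?(ltW a1) ?(ltW b1) // lerBlDr lerDl.
Qed.

(** * Dependence of the shift on its parameter *)

Section Chord.
Variables (R : realType) (d : nat) (a b x : 'rV[R]_d).
Hypotheses (a1 : in_ball a) (b1 : in_ball b) (x1 : in_sphere x).

Lemma enorm_sphere_sub_ge c : 1 - enorm c <= enorm (x - c).
Proof. by rewrite lerBlDr -x1; have := enormD (x - c) c; rewrite subrK. Qed.

(** The distance formula for the inversion p -> p / |p|^2. *)
Lemma enorm_inversionB (p q : 'rV[R]_d) : p != 0 -> q != 0 ->
  enorm ((dot p p)^-1 *: p - (dot q q)^-1 *: q) = enorm (p - q) / (enorm p * enorm q).
Proof.
rewrite -!dotvv_eq0 => p0 q0.
apply: (@pexpIrn _ 2) => //; rewrite ?nnegrE ?divr_ge0 ?mulr_ge0 ?enorm_ge0 //.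
rewrite expr_div_n exprMn !sqr_enorm !dotE (dotC q p).
by field; rewrite p0 q0.
Qed.

(** With I the inversion, [shift c x] is (1 - |c|^2) I(x - c) - c, and the difference splits into
    three terms. The factor 1 - |a|^2 absorbs |x - a| >= 1 - |a|, which leaves 1 - |b| as the only
    denominator. *)
Lemma enorm_shiftB_le : enorm (shift a x - shift b x) <=
  enorm (a - b) * (1 + (1 + 2 * enorm a + enorm b) / (1 - enorm b)).
Proof.
have pa := enorm_sphere_sub_ge a; have qb := enorm_sphere_sub_ge b.
have a1' : 0 < 1 - enorm a by rewrite subr_gt0.
have b1' : 0 < 1 - enorm b by rewrite subr_gt0.
have p0 : 0 < enorm (x - a) by exact: lt_le_trans pa.
have q0 : 0 < enorm (x - b) by exact: lt_le_trans qb.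
pose p := x - a; pose q := x - b.
have E c : in_ball c -> shift c x = (1 - dot c c) *: ((dot (x - c) (x - c))^-1 *: (x - c)) - c.
  move=> c1; rewrite shift_sphereE // scalerA; congr (_ / _ *: _ - _).
  by rewrite !dotE ((in_sphereP _).1 x1) (dotC x c); ring.
have -> : shift a x - shift b x = (b - a) +
   (1 - dot a a) *: ((dot p p)^-1 *: p - (dot q q)^-1 *: q) +
   (dot b b - dot a a) *: ((dot q q)^-1 *: q).
  rewrite !E // -/p -/q; apply/rowP => j; rewrite !mxE; ring.
rewrite mulrDr mulr1.
have q0' : q != 0 by rewrite -enorm_eq0 gt_eqF.
have p0' : p != 0 by rewrite -enorm_eq0 gt_eqF.
have ab : 0 <= enorm (a - b) by exact: enorm_ge0.
rewrite (le_trans (enormD _ _)) //.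
have h1 := enormD (b - a) ((1 - dot a a) *: ((dot p p)^-1 *: p - (dot q q)^-1 *: q)).
have h2 : enorm ((1 - dot a a) *: ((dot p p)^-1 *: p - (dot q q)^-1 *: q)) <=
     enorm (a - b) * ((1 + enorm a) / (1 - enorm b)).
  rewrite enormZ enorm_inversionB // -sqr_enorm.
  have -> : p - q = b - a by rewrite /p /q opprB addrC addrA subrK.
  rewrite enorm_distC ger0_norm; last by rewrite subr_ge0 expr_le1 ?enorm_ge0 // ltW.
  rewrite mulrCA ler_wpM2l // ler_pdivrMr ?mulr_gt0 //.
  rewrite (_ : 1 - _ = (1 + enorm a) * (1 - enorm a)); last by ring.
  rewrite -mulrA ler_wpM2l ?addr_ge0 ?enorm_ge0 //.
  rewrite mulrC ler_pdivlMr // ler_pM //; exact: ltW.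
have h3 : enorm ((dot b b - dot a a) *: ((dot q q)^-1 *: q)) <=
     enorm (a - b) * ((enorm a + enorm b) / (1 - enorm b)).
  rewrite !enormZ -!sqr_enorm -/q.
  rewrite (_ : `|(enorm q ^+ 2)^-1| * enorm q = (enorm q)^-1); last first.
    by rewrite ger0_norm ?invr_ge0 ?sqr_ge0 //; field; rewrite enorm_eq0.
  rewrite subr_sqr normrM -mulrA ler_pM //.
  - by rewrite mulr_ge0 ?invr_ge0 ?enorm_ge0.
  - rewrite ler_norml; have := enormD (a - b) b; have := enormD (b - a) a.
    by rewrite !subrK (enorm_distC b); lra.
  rewrite ger0_norm ?addr_ge0 ?enorm_ge0 // addrC ler_pM ?addr_ge0 ?invr_ge0 ?enorm_ge0 //.
  by rewrite lef_pV2 ?posrE.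
rewrite enorm_distC in h1.
apply: (le_trans (lerD h1 h3)).
rewrite (_ : (1 + 2 * enorm a + enorm b) / (1 - enorm b) =
  (1 + enorm a) / (1 - enorm b) + (enorm a + enorm b) / (1 - enorm b)); last first.
  by rewrite -mulrDl; congr (_ / _); ring.
by rewrite mulrDr; lra.
Qed.

End Chord.

(** * The common step of both methods *)

Section NewtonMap.
Variables (R : realType) (d n : nat) (om : 'I_n -> R).
Implicit Types y x : 'I_n -> 'rV[R]_d.

(* minus the derivative of the mean field at the origin *)
Definition sphere_hessian y : 'M[R]_d := 1%:M - \sum_i om i *: ((y i)^T *m y i).

Definition newton_vector y : 'rV[R]_d := moment om y *m invmx (sphere_hessian y).

(** The exponential at the origin of g / 2; the half appears because directors at the origin have
    Euclidean length 1/2. For g = 0 the quotient is 0 by the convention on division, and so is the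
    point. *)
Definition newton_point y : 'rV[R]_d :=
  (tanhR (enorm (newton_vector y) / 2) / enorm (newton_vector y)) *: newton_vector y.

Definition newton_map x w : 'rV[R]_d :=
  shift (- w) (newton_point (shifted x w)).

Hypotheses (om_gt0 : forall i, 0 < om i) (om1 : \sum_i om i = 1).

Let om_ge0 i : 0 <= om i. Proof. exact/ltW. Qed.

Lemma mul_hessianE y v :
  v *m sphere_hessian y = v - \sum_i om i *: (dot v (y i) *: y i).
Proof.
rewrite mulmxBr mulmx1 mulmx_sumr; congr (_ - _); apply: eq_bigr => i _.
by rewrite -scalemxAr mulmxA mulmx_trE mul_scalar_mx.
Qed.

Lemma mul_hessian_projE y v :
  v *m sphere_hessian y = \sum_i om i *: (v - dot v (y i) *: y i).
Proof.
rewrite mul_hessianE -[v in v - _]scale1r -om1 scaler_suml -sumrB.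
by apply: eq_bigr => i _; rewrite scalerBr.
Qed.

Lemma gapped_hessian y lam v : gapped om y lam ->
  lam * dot v v <= dot (v *m sphere_hessian y) v.
Proof.
move=> gy; rewrite mul_hessianE !dotE dot_suml.
have -> : \sum_i dot (om i *: (dot v (y i) *: y i)) v = \sum_i om i * dot (y i) v ^+ 2.
  by apply: eq_bigr => i _; rewrite !dotZl (dotC v).
by have := gy v; lra.
Qed.

Lemma hessian_gapped y lam :
  (forall v, lam * dot v v <= dot (v *m sphere_hessian y) v) -> gapped om y lam.
Proof.
move=> h v; have := h v; rewrite mul_hessianE !dotE dot_suml.
have -> : \sum_i dot (om i *: (dot v (y i) *: y i)) v = \sum_i om i * dot (y i) v ^+ 2.
  by apply: eq_bigr => i _; rewrite !dotZl (dotC v).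
lra.
Qed.

Lemma hessian_unit y lam : 0 < lam -> gapped om y lam -> sphere_hessian y \in unitmx.
Proof.
move=> lam0 gy; rewrite -row_free_unit; apply: inj_row_free => v vA.
have := gapped_hessian v gy; rewrite vA dot0l pmulr_rle0 // => vv.
by apply/eqP; rewrite -dotvv_eq0 eq_le vv dotvv_ge0.
Qed.

(** The zero vector needs some unit vector to serve as its direction; an atom does, and atoms exist
    since the weights sum to 1. *)
Lemma unit_direction y (v : 'rV[R]_d) : (forall i, in_sphere (y i)) ->
  exists2 e, in_sphere e & v = enorm v *: e.
Proof.
move=> y1; have [->|v0] := eqVneq v 0; last first.
  exists ((enorm v)^-1 *: v); last by rewrite scalerA divff ?enorm_eq0 ?scale1r.
  by rewrite /in_sphere enormZ ger0_norm ?invr_ge0 ?enorm_ge0 // mulVf ?enorm_eq0.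
have [i _] : exists i : 'I_n, true.
  case: n om om1 => [om' |n' _ _]; last by exists ord0.
  by rewrite big_ord0 => /esym/eqP; rewrite oner_eq0.
by exists (y i) => //; rewrite enorm0 scale0r.
Qed.

Lemma newton_point_polar y : (forall i, in_sphere (y i)) ->
  exists2 e, in_sphere e & newton_vector y = enorm (newton_vector y) *: e /\
    newton_point y = tanhR (enorm (newton_vector y) / 2) *: e.
Proof.
move=> y1; have [e e1 ee] := unit_direction (newton_vector y) y1.
exists e => //; split=> //; rewrite /newton_point {3}ee scalerA.
have [->|g0] := eqVneq (enorm (newton_vector y)) 0.
  by rewrite mul0r tanhR0 !mul0r.
by rewrite -mulrA mulVf // mulr1.
Qed.

(** With s half the length of the Newton vector and r = tanh s, the bound 2 r^2 + 2(s - r) is at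
    most 2 s^2 + s^2. *)
Lemma newton_point_step y lam : (forall i, in_sphere (y i)) -> 0 < lam -> gapped om y lam ->
  exists e r s, [/\ in_sphere e, 0 <= r <= s, r < 1, newton_point y = r *: e &
    2 * s * lam <= enorm (moment om y) /\
    enorm (moment om (fun i => shift (newton_point y) (y i))) <= 3 * s ^+ 2].
Proof.
move=> y1 lam0 gy; have [e e1 [ge ze]] := newton_point_polar y1.
set s := enorm (newton_vector y) / 2 in ze.
have s0 : 0 <= s by rewrite divr_ge0 ?enorm_ge0.
have my : moment om y = (2 * s) *: \sum_i om i *: (e - dot e (y i) *: y i).
  rewrite -mul_hessian_projE scalemxAl (_ : 2 * s = enorm (newton_vector y)).
    by rewrite -ge mulmxKV // (hessian_unit lam0).
  by rewrite /s mulrC divfK.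
have r0 := tanhR_ge0 s0; have rs := tanhR_le s0; have r1 := tanhR_lt1 s.
exists e, (tanhR s), s; rewrite r0 rs; split=> //; split.
  exact: newton_step_length e1 s0 gy my.
rewrite ze; apply: (le_trans (enorm_newton_moment om_gt0 om1 y1 e1 r0 rs r1 my)).
have := subr_tanhR_le s0.
have : tanhR s ^+ 2 <= s ^+ 2 by rewrite ler_pXn2r ?nnegrE.
lra.
Qed.

End NewtonMap.

(** * Invariants of the iteration and its limit *)

Section NewtonIteration.
Variables (R : realType) (d n : nat) (om : 'I_n -> R) (x : 'I_n -> 'rV[R]_d) (lam : R).
Hypotheses (om_gt0 : forall i, 0 < om i) (om1 : \sum_i om i = 1).
Hypotheses (x1 : forall i, in_sphere (x i)).
Hypotheses (lam_gt0 : 0 < lam) (lam_le1 : lam <= 1) (gx : gapped om x lam).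

Let om_ge0 i : 0 <= om i. Proof. exact/ltW. Qed.

Lemma shifted_sphere w i : in_ball w -> in_sphere (shifted x w i).
Proof. by move=> w1; exact: shift_sphere. Qed.

Lemma shifted_gyration w z i j : in_ball w -> in_ball z ->
  dot (shifted x (shift (- w) z) i) (shifted x (shift (- w) z) j) =
  dot (shift z (shifted x w i)) (shift z (shifted x w j)).
Proof. by move=> w1 z1; exact: shift_gyration. Qed.

(** The bounds hold for the atoms shifted by [newton_point] in the frame at [w]; the gyration
    identity and the Gram lemmas carry them over to the frame at [w']. From s <= M / (2l) come the
    loss 4r <= 2M/l of the gap and the moment bound 3 s^2 <= 3/4 (M/l)^2. *)
Lemma newton_map_step w l : in_ball w -> 0 < l -> l <= 1 -> gapped om (shifted x w) l ->
  4 * enorm (moment om (shifted x w)) < l ^+ 2 ->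
  let w' := newton_map om x w in
  let M := enorm (moment om (shifted x w)) in
  [/\ in_ball w', gapped om (shifted x w') (l - 2 * M / l),
   enorm (moment om (shifted x w')) <= 3 / 4 * (M / l) ^+ 2 &
   enorm (w' - w) <= 4 / 7 * (M / l)].
Proof.
move=> w1 l0 l1 gw hM w' M.
have y1 i := shifted_sphere i w1.
have [e [r [s [e1 /andP[r0 rs] r1 ze [slM mM]]]]] := newton_point_step om_gt0 om1 y1 l0 gw.
have z1 : in_ball (newton_point om (shifted x w)) by rewrite ze; exact: ball_scale_unit.
have nw1 := ball_opp w1.
have w'1 : in_ball w' by exact: shift_ball.
have w'E : w' = shift (- w) (newton_point om (shifted x w)) by [].
clearbody w'.
have hs : 2 * s <= M / l by rewrite ler_pdivlMr.
have hs2 : s ^+ 2 <= (M / l) ^+ 2 / 4 by nra.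
have M0 : 0 <= M by exact: enorm_ge0.
have Ml : M / l <= 1 / 4 by rewrite ler_pdivrMr //; rewrite -/M in hM; nra.
split=> //.
- apply: (gapped_gram om_ge0 (y := fun i => shift (newton_point om (shifted x w)) (shifted x w i))).
  + by move=> i j; rewrite w'E; exact: esym (shifted_gyration i j w1 z1).
  + have h0 : 0 <= 2 * M / l by rewrite divr_ge0 ?mulr_ge0 // ltW.
    by lra.
  have := gapped_shift om_gt0 om1 y1 e1 r0 r1 gw; rewrite -ze => h v.
  apply: (le_trans (h v)); rewrite ler_wpM2r ?dotvv_ge0 // -mulrA; lra.
- rewrite (enorm_moment_gram om (z := fun i => shift (newton_point om (shifted x w)) (shifted x w i))).
    by apply: (le_trans mM); lra.
  by move=> i j; rewrite w'E; exact: (shifted_gyration i j w1 z1).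
apply: enorm_le_sqr; first by rewrite mulr_ge0 // divr_ge0 // ltW.
have := sqdist_shift w1 w'1.
have zz : dot (newton_point om (shifted x w)) (newton_point om (shifted x w)) = r ^+ 2.
  by rewrite ze dotZl dotZr ((in_sphereP _).1 e1) mulr1 expr2.
have sw : shift w w' = newton_point om (shifted x w) by rewrite w'E shiftNK.
rewrite sw zz -(sqr_enorm (w - w')) enorm_distC sqr_enorm.
set D := dot (w' - w) _ => hD.
have D0 : 0 <= D by exact: dotvv_ge0.
have : 0 <= dot w w by exact: dotvv_ge0.
have : 0 <= dot w' w' by exact: dotvv_ge0.
have /in_ballP := w1; have /in_ballP := w'1 => a1 a2 a3 a4.
have a5 : (1 - dot w w) * (1 - dot w' w') <= 1 by exact: mul_1Bdot_le1.
have r2 : r ^+ 2 <= 1 / 64.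
  have : r <= 1 / 8 by lra.
  by move=> r8; nra.
have r3 : r ^+ 2 <= (M / l) ^+ 2 / 4 by nra.
(* Since 4M < l^2 and l <= 1, M/l <= 1/4 and r <= 1/8. Hence D <= (64/63) r^2 <= (16/63)(M/l)^2,
   below the square of 4/7 (M/l). *)
have : D * (63 / 64) <= r ^+ 2.
  have : r ^+ 2 * ((1 - dot w w) * (1 - dot w' w')) <= r ^+ 2 by rewrite ler_piMr ?sqr_ge0.
  have : D * r ^+ 2 <= D * (1 / 64) by rewrite ler_wpM2l.
  nra.
have : 0 <= (M / l) ^+ 2 by exact: sqr_ge0.
rewrite exprMn; lra.
Qed.

(** In the frame at [w] the point that centers the atoms is [shift w b], up to an isometry of the
    moved atoms. *)
Lemma centered_close w l b : in_ball w -> in_ball b -> 0 < l -> gapped om (shifted x w) l ->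
  4 * enorm (moment om (shifted x w)) < l ^+ 2 -> moment om (shifted x b) = 0 ->
  3 * enorm (shift w b) * l <= 2 * enorm (moment om (shifted x w)).
Proof.
move=> w1 b1 l0 gw hM mb.
have y1 i := shifted_sphere i w1.
have [e e1 ze] := unit_direction om1 (shift w b) y1.
have z1 := shift_ball w1 b1.
apply: (centered_shift_close om_gt0 om1 y1 e1 _ _ l0 gw hM) => //; first exact: enorm_ge0.
apply/eqP; rewrite -ze -enorm_eq0; apply/eqP.
rewrite -(enorm_moment_gram om (y := shifted x b)) ?mb ?enorm0 // => i j.
by rewrite -(shifted_gyration i j w1 z1) shiftK.
Qed.

Hypothesis mx : 4 * enorm (moment om x) < lam ^+ 2.
Let q := 4 * enorm (moment om x) / lam ^+ 2.

Let q_ge0 : 0 <= q. Proof. by rewrite divr_ge0 ?mulr_ge0 ?enorm_ge0 ?exprn_ge0 ?ltW. Qed.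
Let q_lt1 : q < 1. Proof. by rewrite ltr_pdivrMr ?exprn_gt0 ?mul1r. Qed.

Lemma shifted0 : shifted x 0 = x.
Proof. by apply/funext => i; rewrite /shifted shift_0l. Qed.

Let w k := iter k (newton_map om x) 0.

(** The bound by q^(2^k) is the quadratic rate. The bound by (3/4)^k has a ratio that does not
    depend on q and serves to sum the increments. *)
Lemma newton_iterate_bound k : exists l, [/\ in_ball (w k), 0 < l <= lam,
  gapped om (shifted x (w k)) l, 4 * enorm (moment om (shifted x (w k))) <= q ^+ (2 ^ k) * l ^+ 2 &
  4 * enorm (moment om (shifted x (w k))) <= (3 / 4) ^+ k * l ^+ 2].
Proof.
elim: k => [|k [l [w1 /andP[l0 ll] gw h1 h2]]].
  exists lam; rewrite /w /= lam_gt0 lexx shifted0; split=> //; first exact: in_ball0.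
    by rewrite /q expr1 divfK // gt_eqF // exprn_gt0.
  by rewrite expr0 mul1r ltW.
have q1 : q ^+ (2 ^ k) < 1 by rewrite exprn_ilt1 // expn_eq0.
have l2 : 0 < l ^+ 2 by rewrite exprn_gt0.
have hM : 4 * enorm (moment om (shifted x (w k))) < l ^+ 2.
  by apply: (le_lt_trans h1); rewrite -[X in _ < X]mul1r ltr_pM2r.
have [w'1 gw' mw' _] := newton_map_step w1 l0 (le_trans ll lam_le1) gw hM.
set M := enorm (moment om (shifted x (w k))) in hM h1 h2 gw' mw'.
have M0 : 0 <= M by exact: enorm_ge0.
pose a := M / l.
have Ma : M = a * l by rewrite /a divfK // gt_eqF.
have a0 : 0 <= a by rewrite divr_ge0 // ltW.
rewrite -mulrA -/a in gw'; rewrite -/a in mw'; clearbody a.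
have al : 4 * a <= l.
  rewrite -(ler_pM2r l0) -mulrA -Ma -expr2; exact: ltW.
have al1 : 4 * a <= q ^+ (2 ^ k) * l.
  by rewrite -(ler_pM2r l0) -[4 * a * l]mulrA -Ma -mulrA -expr2.
have al2 : 4 * a <= (3 / 4) ^+ k * l.
  by rewrite -(ler_pM2r l0) -[4 * a * l]mulrA -Ma -mulrA -expr2.
exists (l - 2 * a); rewrite /w iterS -/(w k).
split=> //; first by lra.
(* The new gap is at least l/2, since 4a <= l. From 4a <= t l the new moment satisfies 4M' <= 3 a^2
   <= (3/16) t^2 l^2, which is below t^2 (l/2)^2. *)
- rewrite expnSr exprM; set t := q ^+ _ in al1 *.
  have t0 : 0 <= t by rewrite exprn_ge0.
  have a40 : 0 <= 4 * a by rewrite mulr_ge0.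
  have tl0 : 0 <= t * l by rewrite mulr_ge0 // ltW.
  have : (4 * a) ^+ 2 <= (t * l) ^+ 2 by rewrite ler_pXn2r ?nnegrE.
  have : t ^+ 2 * (l / 2) ^+ 2 <= t ^+ 2 * (l - 2 * a) ^+ 2.
    have l20 : 0 <= l / 2 by lra.
    have la0 : l / 2 <= l - 2 * a by lra.
    by rewrite ler_wpM2l ?exprn_ge0 // ler_pXn2r ?nnegrE // (le_trans l20).
  nra.
(* This inequality fixes the ratio: 3 a^2 <= (3/16) t l^2 = (3/4) t (l/2)^2. *)
rewrite exprS; set t := (3 / 4) ^+ k in al2 *.
have t0 : 0 <= t by rewrite exprn_ge0.
have : t * (l / 2) ^+ 2 <= t * (l - 2 * a) ^+ 2.
  have l20 : 0 <= l / 2 by lra.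
  have la0 : l / 2 <= l - 2 * a by lra.
  by rewrite ler_wpM2l // ler_pXn2r ?nnegrE // (le_trans l20).
have : (4 * a) * (4 * a) <= (t * l) * l by rewrite ler_pM ?mulr_ge0.
nra.
Qed.

Lemma newton_iterate_ball k : in_ball (w k).
Proof. by have [l []] := newton_iterate_bound k. Qed.

Lemma newton_iterate_diff k : enorm (w k.+1 - w k) <= 1 / 7 * (3 / 4) ^+ k.
Proof.
have [l [w1 /andP[l0 ll] gw h1 h2]] := newton_iterate_bound k.
have l2 : 0 < l ^+ 2 by rewrite exprn_gt0.
have q1 : q ^+ (2 ^ k) < 1 by rewrite exprn_ilt1 // expn_eq0.
have hM : 4 * enorm (moment om (shifted x (w k))) < l ^+ 2.
  by apply: (le_lt_trans h1); rewrite -[X in _ < X]mul1r ltr_pM2r.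
have [_ _ _ h] := newton_map_step w1 l0 (le_trans ll lam_le1) gw hM.
rewrite /w iterS -/(w k); apply: (le_trans h).
set M := enorm (moment om (shifted x (w k))) in h2 *; set t := (3 / 4) ^+ k in h2 *.
have t0 : 0 <= t by rewrite exprn_ge0.
suff : M / l <= t / 4 by lra.
rewrite ler_pdivrMr //.
have : t * l ^+ 2 <= t * l by rewrite ler_wpM2l // expr2 ler_piMl ?(ltW l0) // (le_trans ll).
lra.
Qed.

Lemma enorm_le_sum_coord (u : 'rV[R]_d) : enorm u <= \sum_j `|u 0 j|.
Proof.
rewrite {1}[u]row_sum_delta (le_trans (enorm_sum _)) // ler_sum // => j _.
by rewrite enormZ {1}/enorm dot_delta mxE !eqxx sqrtr1 mulr1.
Qed.

(** 4/7 is the sum of the series 1/7 (3/4)^k; being below 1 it keeps the limit inside the open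
    ball. *)
Lemma newton_iterate_enorm k : enorm (w k) <= 4 / 7.
Proof.
suff : enorm (w k) <= 4 / 7 * (1 - (3 / 4) ^+ k).
  have : 0 <= ((3 / 4) ^+ k : R) by rewrite exprn_ge0.
  by lra.
elim: k => [|k IH]; first by rewrite /w /= enorm0 expr0 subrr mulr0.
have := enormD (w k.+1 - w k) (w k); rewrite subrK => h; apply: (le_trans h).
by have := newton_iterate_diff k; rewrite exprS; lra.
Qed.

(** The limit is taken coordinate by coordinate; the factor d comes from summing the coordinate
    errors. *)
Lemma newton_iterate_limit :
  exists2 b, in_ball b & forall k, enorm (w k - b) <= d%:R * (4 / 7) * (3 / 4) ^+ k.
Proof.
have h j : exists l, forall k, `|w k 0 j - l| <= 4 / 7 * (3 / 4) ^+ k.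
  have hd k : `|w k.+1 0 j - w k 0 j| <= 1 / 7 * (3 / 4) ^+ k.
    apply: le_trans (newton_iterate_diff k).
    by have := coord_le_enorm (w k.+1 - w k) j; rewrite !mxE.
  have [|||l hl] := geometric_cauchy _ _ _ hd; try lra.
  by exists l => k; have := hl k; rewrite (_ : 1 / 7 / (1 - 3 / 4) = 4 / 7 :> R) //; field.
have d0 : 0 <= d%:R :> R by rewrite ler0n.
have [f hf] := choice h.
pose b : 'rV[R]_d := \row_j f j.
have wb k : enorm (w k - b) <= d%:R * (4 / 7) * (3 / 4) ^+ k.
  rewrite (le_trans (enorm_le_sum_coord _)) //.
  apply: (@le_trans _ _ (\sum_(j < d) 4 / 7 * (3 / 4) ^+ k)).
    by apply: ler_sum => j _; rewrite !mxE.
  by rewrite sumr_const card_ord -[X in X <= _]mulr_natl mulrA.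
exists b => //; rewrite /in_ball.
suff : enorm b <= 4 / 7 by lra.
apply: (@le_geometric_limit _ _ _ (d%:R * (4 / 7)) (3 / 4)); try lra.
move=> k; have := enormD (b - w k) (w k); rewrite subrK enorm_distC.
by have := newton_iterate_enorm k; have := wb k; lra.
Qed.

(** The moments at the iterates tend to 0, and the shift is Lipschitz in its parameter, so the
    moment at the limit vanishes. *)
Lemma centered_exists : exists2 b, in_ball b & moment om (shifted x b) = 0.
Proof.
have [b b1 wb] := newton_iterate_limit; exists b => //.
apply/eqP; rewrite -enorm_eq0 eq_le enorm_ge0 andbT.
have d0 : 0 <= d%:R :> R by rewrite ler0n.
have bb : enorm b <= 4 / 7.
  apply: (@le_geometric_limit _ _ _ (d%:R * (4 / 7)) (3 / 4)); try lra.
  move=> k; have := enormD (b - w k) (w k); rewrite subrK enorm_distC.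
  by have := newton_iterate_enorm k; have := wb k; lra.
pose C : R := 1 / 4 + d%:R * (4 / 7) * (22 / 3).
apply: (@le_geometric_limit _ _ _ C (3 / 4)); rewrite ?add0r; try lra.
  by rewrite /C; lra.
move=> k; rewrite add0r.
have mk : enorm (moment om (shifted x (w k))) <= 1 / 4 * (3 / 4) ^+ k.
  have [l [_ /andP[l0 ll] _ _]] := newton_iterate_bound k.
  have t0 : 0 <= ((3 / 4) ^+ k : R) by rewrite exprn_ge0.
  have : (3 / 4) ^+ k * l ^+ 2 <= (3 / 4) ^+ k * 1.
    by rewrite ler_wpM2l // expr_le1 // ?(le_trans ll) // ltW.
  lra.
(* For parameters of norm at most 4/7 the Lipschitz factor is at most 1 + (1 + 3 * 4/7) / (1 - 4/7)
   = 22/3. *)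
have md : enorm (moment om (shifted x (w k)) - moment om (shifted x b)) <=
    enorm (w k - b) * (22 / 3).
  rewrite /moment -sumrB.
  rewrite (eq_bigr (fun i => om i *: (shifted x (w k) i - shifted x b i))); last first.
    by move=> i _; rewrite scalerBr.
  apply: enorm_wsum => // i.
  apply: (le_trans (enorm_shiftB_le (newton_iterate_ball k) b1 (x1 i))).
  rewrite ler_wpM2l ?enorm_ge0 //.
  have e1 := newton_iterate_enorm k.
  rewrite -lerBrDl ler_pdivrMr; lra.
have := enormD (moment om (shifted x b) - moment om (shifted x (w k))) (moment om (shifted x (w k))).
rewrite subrK enorm_distC /C.
have := wb k; lra.
Qed.

Section AtCenter.
Variable b : 'rV[R]_d.
Hypotheses (b1 : in_ball b) (mb : moment om (shifted x b) = 0).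

Lemma newton_iterate_close k : enorm (shift (w k) b) <= q ^+ (2 ^ k) * (lam / 6).
Proof.
have [l [w1 /andP[l0 ll] gw h1 h2]] := newton_iterate_bound k.
have l2 : 0 < l ^+ 2 by rewrite exprn_gt0.
have q0 : 0 <= q ^+ (2 ^ k) by rewrite exprn_ge0.
have q1 : q ^+ (2 ^ k) < 1 by rewrite exprn_ilt1 // expn_eq0.
have hM : 4 * enorm (moment om (shifted x (w k))) < l ^+ 2.
  by apply: (le_lt_trans h1); rewrite -[X in _ < X]mul1r ltr_pM2r.
have h3 := centered_close w1 b1 l0 gw hM mb.
apply: (@le_trans _ _ (q ^+ (2 ^ k) * (l / 6))); last by rewrite ler_wpM2l //; lra.
rewrite -(ler_pM2r l0); lra.
Qed.

Lemma center_enorm : enorm b <= lam / 6.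
Proof.
have := newton_iterate_close 0; rewrite /w /= shift_0l expn0 expr1 => h.
by apply: (le_trans h); rewrite ler_piMl ?(ltW q_lt1) // divr_ge0 // ltW.
Qed.

(** Shifting by b costs the gap 4 |b| <= 2/3 lam. *)
Lemma center_gapped : gapped om (shifted x b) (lam / 3).
Proof.
have [e e1 be] := unit_direction om1 b x1.
have be1 : enorm b < 1 by [].
have := gapped_shift om_gt0 om1 x1 e1 (enorm_ge0 b) be1 gx; rewrite -be => g v.
apply: (le_trans (g v)); rewrite ler_wpM2r ?dotvv_ge0 //.
by have := center_enorm; lra.
Qed.

Lemma newton_iterate_chord k i :
  enorm (shifted x (w k) i - shifted x b i) <= 11 / 20 * (q ^+ (2 ^ k) * lam).
Proof.
have w1 := newton_iterate_ball k.
have rk := newton_iterate_close k; have bb := center_enorm.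
have q0 : 0 <= q ^+ (2 ^ k) by rewrite exprn_ge0.
have q1 : q ^+ (2 ^ k) <= 1 by rewrite exprn_ile1 // ltW.
have bb6 : enorm b <= 1 / 6 by rewrite (le_trans bb) // ler_wpM2r.
set r := enorm (shift (w k) b) in rk.
have r0 : 0 <= r by exact: enorm_ge0.
have r6 : r <= 1 / 6.
  have : q ^+ (2 ^ k) * (lam / 6) <= 1 * (1 / 6).
    by rewrite ler_pM // ?divr_ge0 ?(ltW lam_gt0) // ler_wpM2r.
  by lra.
(* From r <= 1/6, |w_k - b|^2 <= (36/35) r^2, and 36/35 < (51/50)^2. *)
have wb : enorm (w k - b) <= 51 / 50 * r.
  apply: enorm_le_sqr; first by lra.
  have := sqdist_shift w1 b1; rewrite -(sqr_enorm (shift _ _)) -/r.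
  set D := dot (w k - b) _ => hD.
  have D0 : 0 <= D by exact: dotvv_ge0.
  have : 0 <= dot (w k) (w k) by exact: dotvv_ge0.
  have : 0 <= dot b b by exact: dotvv_ge0.
  have /in_ballP := w1; have /in_ballP := b1 => a1 a2 a3 a4.
  have a5 : (1 - dot (w k) (w k)) * (1 - dot b b) <= 1 by exact: mul_1Bdot_le1.
  have r2 : r ^+ 2 <= 1 / 36 by nra.
  have : r ^+ 2 * ((1 - dot (w k) (w k)) * (1 - dot b b)) <= r ^+ 2 by rewrite ler_piMr ?sqr_ge0.
  have : D * r ^+ 2 <= D * (1 / 36) by rewrite ler_wpM2l.
  nra.
have wn : enorm (w k) <= 17 / 50.
  by have := enormD (w k - b) b; rewrite subrK; lra.
apply: (le_trans (enorm_shiftB_le w1 b1 (x1 i))).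
(* The constants 17/50 for |w_k| and 1/6 for |b| give the factor 323/100; then 51/50 * 323/100 * 1/6
   < 11/20. *)
have h : 1 + (1 + 2 * enorm (w k) + enorm b) / (1 - enorm b) <= 323 / 100.
  by rewrite -lerBrDl ler_pdivrMr; lra.
have : enorm (w k - b) * (1 + (1 + 2 * enorm (w k) + enorm b) / (1 - enorm b)) <=
   (51 / 50 * r) * (323 / 100).
  rewrite ler_pM ?enorm_ge0 // addr_ge0 // divr_ge0 //; last by rewrite subr_ge0 ltW.
  by have := enorm_ge0 (w k); have := enorm_ge0 b; lra.
lra.
Qed.

(** In the frame at b the moment is 0 and the gap positive, so any other centering point is at
    distance 0. *)
Lemma center_unique b' : in_ball b' -> moment om (shifted x b') = 0 -> b = b'.
Proof.
move=> b'1 mb'; have l3 : 0 < lam / 3 by rewrite divr_gt0.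
have hM : 4 * enorm (moment om (shifted x b)) < (lam / 3) ^+ 2.
  by rewrite mb enorm0 mulr0 exprn_gt0.
have := centered_close b1 b'1 l3 center_gapped hM mb'.
rewrite mb enorm0 mulr0 => h.
have : enorm (shift b b') == 0.
  by rewrite eq_le enorm_ge0 andbT -(pmulr_lle0 _ l3) -(@pmulr_rle0 R 3) ?ltr0n // mulrA.
rewrite enorm_eq0 => /eqP e.
by rewrite -(shiftK b1 b'1) e -(shift_vv b) shiftK.
Qed.

End AtCenter.

End NewtonIteration.

(** * The covariant derivative of the mean field *)

Section DirectionalDerivative.
Variables (R : realType) (d : nat).
Implicit Types (w X x : 'rV[R]_d).

Lemma is_derive_line (W : normedModType R) (f : 'rV[R]_d -> W) w X df :
  is_derive (0 : R) (1 : R) (fun t => f (t *: X + w)) df -> is_derive w X f df.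
Proof.
have E : (fun h : R => h^-1 *: ((fun t : R => f (t *: X + w)) (h *: 1 + 0) - f (0 *: X + w))) =
         (fun h : R => h^-1 *: (f (h *: X + w) - f w)).
  by apply/funext => h; rewrite scale0r add0r addr0 /GRing.scale /= mulr1.
move=> [h1 h2]; split.
  by move: h1; rewrite /derivable /= E.
by rewrite -h2 /derive /= E.
Qed.

Lemma is_derive_row (V : normedModType R) (f : V -> 'rV[R]_d) (t v : V) (df : 'rV[R]_d) :
  (forall j, is_derive t v (fun s => f s 0 j) (df 0 j)) -> is_derive t v f df.
Proof.
move=> h; have fd : derivable f t v.
  by apply/derivable_mxP => i j; rewrite ord1; case: (h j).
split=> //; rewrite derive_mx //; apply/matrixP => i j; rewrite !mxE ord1.
by case: (h j).
Qed.

Lemma is_derive_coord (V : normedModType R) (f : V -> 'rV[R]_d) (t v : V) (df : 'rV[R]_d) j :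
  is_derive t v f df -> is_derive t v (fun s => f s 0 j) (df 0 j).
Proof.
move=> [fd <-]; split; first exact: ((derivable_mxP f t v).1 fd 0 j).
by rewrite derive_mx // mxE.
Qed.

Lemma is_derive_inv (V : normedModType R) (f : V -> R) (t v : V) (df : R) :
  f t != 0 -> is_derive t v f df -> is_derive t v (fun s => (f s)^-1) (- df / f t ^+ 2).
Proof.
move=> ft0 [fd <-]; split; first exact: derivableV.
by rewrite deriveV // /GRing.scale /= mulrC mulrN mulNr.
Qed.

Lemma is_derive_lin_poly (a b c : R) :
  is_derive (0 : R) (1 : R) (fun t => a + b * t + c * t ^+ 2) b.
Proof.
apply: is_derive_eq; rewrite /GRing.scale /=; ring.
Qed.

Lemma is_derive_conformal w X : in_ball w ->
  is_derive w X (fun z => 4 / (1 - enorm z ^+ 2) ^+ 2)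
    (16 * dot w X / (1 - dot w w) ^+ 3).
Proof.
move=> /in_ballP w1; apply: is_derive_line.
pose D t : R := 1 - dot w w + (- 2 * dot w X) * t + (- dot X X) * t ^+ 2.
have DE t : 1 - enorm (t *: X + w) ^+ 2 = D t.
  by rewrite sqr_enorm !dotE (dotC X w) /D; ring.
under eq_fun do rewrite DE.
have dD : is_derive (0 : R) (1 : R) D (- 2 * dot w X) by exact: is_derive_lin_poly.
have D0 : D 0 = 1 - dot w w by rewrite /D; ring.
have Dn0 : D 0 ^+ 2 != 0 by rewrite D0 expf_neq0 // gt_eqF // subr_gt0.
have dD2 : is_derive (0 : R) (1 : R) (fun t => D t ^+ 2) (2 * D 0 * (- 2 * dot w X)).
  by apply: is_derive_eq; rewrite /GRing.scale /=; ring.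
have dV := @is_derive_inv _ (fun t => D t ^+ 2) 0 1 _ Dn0 dD2.
apply: is_derive_eq; rewrite /GRing.scale /= D0; field.
by rewrite gt_eqF // subr_gt0.
Qed.

(** The metric is exp(2 phi) times the Euclidean one, with grad phi = 2 w / (1 - |w|^2). The right
    side is the conformal formula <grad phi, u> v + <grad phi, v> u - <u,v> grad phi. *)
Lemma christoffel_formE w u v : in_ball w -> christoffel_form w u v =
  (2 / (1 - dot w w)) *: (dot w u *: v + dot w v *: u - dot u v *: w).
Proof.
move=> w1; have w1' : 0 < 1 - dot w w by rewrite subr_gt0; exact/in_ballP.
have dG a (b c : 'I_d) : 'D_(delta_mx 0 a) (fun z => metric_tensor z b c) w =
    (b == c)%:R * (16 * w 0 a / (1 - dot w w) ^+ 3).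
  have -> : (fun z : 'rV[R]_d => metric_tensor z b c) =
     (fun z => (b == c)%:R *: (4 / (1 - enorm z ^+ 2) ^+ 2)).
    apply/funext => z; rewrite /metric_tensor mxE /GRing.scale /=.
    by case: eqP => _ /=; rewrite ?mulr0n ?mulr1n ?mul0r ?mul1r.
  have h := is_derive_conformal (delta_mx 0 a) w1.
  rewrite deriveZ; last by case: h.
  by rewrite (@derive_val _ _ _ _ _ _ _ h) dot_delta.
have cE k i j : christoffel w k i j = (2 / (1 - dot w w)) *
   ((i == k)%:R * w 0 j + (j == k)%:R * w 0 i - (i == j)%:R * w 0 k).
  rewrite /christoffel.
  have -> : invmx (metric_tensor w) = (((1 - dot w w) ^+ 2) / 4)%:M.
    rewrite /metric_tensor invmx_scalar sqr_enorm invf_div //.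
  rewrite (bigD1 k) //= big1 ?addr0 => [|l lk]; last first.
    by rewrite mxE eq_sym (negbTE lk) mul0r.
  rewrite mxE eqxx !dG mulr1n.
  by field; rewrite gt_eqF.
apply/rowP => k; rewrite !mxE.
transitivity (2 / (1 - dot w w) * \sum_i \sum_j
  ((i == k)%:R * w 0 j + (j == k)%:R * w 0 i - (i == j)%:R * w 0 k) * u 0 i * v 0 j).
  rewrite mulr_sumr; apply: eq_bigr => i _; rewrite mulr_sumr; apply: eq_bigr => j _.
  by rewrite cE !mulrA.
congr (_ * _).
have delta_sum (F : 'I_d -> R) : \sum_i (i == k)%:R * F i = F k.
  rewrite (bigD1 k) //= eqxx mul1r big1 ?addr0 // => i /negbTE ->; by rewrite mul0r.
transitivity (\sum_i (i == k)%:R * (u 0 i * dot w v) +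
    \sum_i w 0 i * u 0 i * (\sum_j (j == k)%:R * v 0 j) - \sum_i w 0 k * (u 0 i * v 0 i)).
  rewrite -big_split -sumrB; apply: eq_bigr => i _ /=.
  transitivity ((i == k)%:R * u 0 i * dot w v + w 0 i * u 0 i * (\sum_j (j == k)%:R * v 0 j)
     - w 0 k * u 0 i * \sum_j (i == j)%:R * v 0 j).
    rewrite /dot !mulr_sumr -big_split -sumrB; apply: eq_bigr => j _ /=; ring.
  congr (_ + _ - _); first by rewrite mulrA.
  rewrite (bigD1 i) //= eqxx mul1r big1 ?addr0 ?mulrA // => j.
  by rewrite eq_sym => /negbTE ->; rewrite mul0r.
rewrite !delta_sum -mulr_sumr -mulr_suml.
by rewrite -/(dot u v) -/(dot w u); ring.
Qed.

(** As [shift w x] is a Euclidean unit vector, the factor, the inverse of 2 / (1 - |w|^2), makes the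
    director a unit vector for the metric. *)
Lemma directorE w x : in_ball w -> in_sphere x ->
  director x w = ((1 - dot w w) / 2) *: shift w x.
Proof.
move=> w1 x1; have D := shift_den_gt0 w1 x1.
rewrite shiftE /director sqr_enorm ((in_sphereP x).1 x1).
by apply/rowP => j; rewrite !mxE; field; rewrite gt_eqF.
Qed.

Lemma is_derive_director w X x : in_ball w -> in_sphere x ->
  is_derive w X (director x)
    (let D := 1 - 2 * dot w x + dot w w in let b := 1 - dot w w in
     (- (dot X w - dot X x) / D ^+ 2) *:
       (b ^+ 2 *: x - (2 * b * (1 - dot w x)) *: w) +
     (2^-1 / D) *: ((- 4 * b * dot w X) *: x - (- 4 * dot w X * (1 - dot w x) - 2 * b * dot X x) *: w
        - (2 * b * (1 - dot w x)) *: X)).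
Proof.
move=> w1 x1; have D0 := shift_den_gt0 w1 x1.
apply: is_derive_row => j; apply: is_derive_line.
pose b t : R := 1 - dot w w + (- 2 * dot w X) * t + (- dot X X) * t ^+ 2.
pose c t : R := 1 - dot w x + (- dot X x) * t + 0 * t ^+ 2.
pose D t : R := 1 - 2 * dot w x + dot w w + (2 * dot w X - 2 * dot X x) * t + dot X X * t ^+ 2.
pose l t : R := w 0 j + X 0 j * t + 0 * t ^+ 2.
have E t : director x (t *: X + w) 0 j =
    2^-1 * ((D t)^-1 * (b t ^+ 2 * x 0 j - 2 * b t * c t * l t)).
  rewrite /director !mxE sqr_enorm !dotE (dotC X w) /D /b /c /l.
  congr (_ * (_ ^-1 * _)); ring.
under eq_fun do rewrite E.
have db : is_derive (0 : R) (1 : R) b (- 2 * dot w X) by exact: is_derive_lin_poly.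
have dc : is_derive (0 : R) (1 : R) c (- dot X x) by exact: is_derive_lin_poly.
have dD : is_derive (0 : R) (1 : R) D (2 * dot w X - 2 * dot X x) by exact: is_derive_lin_poly.
have dl : is_derive (0 : R) (1 : R) l (X 0 j) by exact: is_derive_lin_poly.
have b0 : b 0 = 1 - dot w w by rewrite /b; ring.
have c0 : c 0 = 1 - dot w x by rewrite /c; ring.
have l0 : l 0 = w 0 j by rewrite /l; ring.
have DE0 : D 0 = 1 - 2 * dot w x + dot w w by rewrite /D; ring.
have Dn0 : D 0 != 0 by rewrite DE0 gt_eqF.
have dV := is_derive_inv Dn0 dD.
apply: is_derive_eq; rewrite /GRing.scale /= b0 c0 l0 DE0 !mxE (dotC X w); field.
by rewrite gt_eqF.
Qed.

(** The covariant derivative of V is g(X,V) V - X. The squared factor (1 - |w|^2)/2 of V cancels the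
    conformal factor of g, so that the Jacobian of the mean field is exactly minus
    [sphere_hessian]. *)
Lemma covariant_director w X x : in_ball w -> in_sphere x ->
  'D_X (director x) w + christoffel_form w X (director x w) =
  dot X (shift w x) *: shift w x - X.
Proof.
move=> w1 x1; have D0 := shift_den_gt0 w1 x1.
have w1' : 0 < 1 - dot w w by rewrite subr_gt0; exact/in_ballP.
have h := is_derive_director X w1 x1.
rewrite derive_val christoffel_formE // directorE // shiftE ((in_sphereP x).1 x1) !dotE.
apply/rowP => j; rewrite !mxE (dotC X w); field.
by rewrite !gt_eqF.
Qed.

End DirectionalDerivative.

Section MeanField.
Variables (R : realType) (d n : nat) (om : 'I_n -> R) (x : 'I_n -> 'rV[R]_d).
Hypotheses (om1 : \sum_i om i = 1) (x1 : forall i, in_sphere (x i)).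

Lemma mean_fieldE w : in_ball w ->
  mean_field om x w = ((1 - dot w w) / 2) *: moment om (shifted x w).
Proof.
move=> w1; rewrite /mean_field scaler_sumr; apply: eq_bigr => i _.
by rewrite (directorE w1 (x1 i)) !scalerA (mulrC (om i)).
Qed.

Lemma conformal_barycenterE w :
  conformal_barycenter om x w <-> in_ball w /\ moment om (shifted x w) = 0.
Proof.
split=> -[w1 h]; split=> //; move: h; rewrite mean_fieldE //.
  move=> /eqP; rewrite scaler_eq0 mulf_eq0 invr_eq0 (gt_eqF (ltr0Sn _ 1)) orbF subr_eq0.
  by rewrite gt_eqF /=; [move=> /eqP|exact/in_ballP].
by move=> ->; rewrite scaler0.
Qed.

Lemma covariant_mean_field w X : in_ball w ->
  covariant_derivative (mean_field om x) w X = - (X *m sphere_hessian om (shifted x w)).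
Proof.
move=> w1; rewrite mul_hessian_projE // /covariant_derivative.
have h : is_derive w X (\sum_i (om i *: director (x i))) (\sum_i om i *: 'D_X (director (x i)) w).
  apply: is_derive_sum => i; apply: is_deriveZ.
  by have := is_derive_director X w1 (x1 i) => -[h _]; exact: derivableP.
have -> : mean_field om x = \sum_i (om i *: director (x i)).
  by apply/funext => z; rewrite fct_sumE.
rewrite derive_val fct_sumE.
have -> : christoffel_form w X (\sum_i (om i *: director (x i)) w) =
    \sum_i om i *: christoffel_form w X (director (x i) w).
  rewrite christoffel_formE // dot_sumr dot_sumr.
  under [RHS]eq_bigr do rewrite christoffel_formE //.
  under [RHS]eq_bigr do rewrite scalerA mulrC -scalerA.
  rewrite -scaler_sumr; congr (_ *: _).
  rewrite scaler_sumr !scaler_suml -big_split -sumrB; apply: eq_bigr => i _ /=.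
  by apply/rowP => j; rewrite !(dotZr (om i)) !mxE; ring.
rewrite -big_split -sumrN; apply: eq_bigr => i _ /=.
by rewrite -scalerDr covariant_director // -scalerN opprB.
Qed.

Lemma mean_field_jacobianE w : in_ball w ->
  mean_field_jacobian om x w = - sphere_hessian om (shifted x w).
Proof.
move=> w1; apply/matrixP => i j.
by rewrite mxE covariant_mean_field // -rowE !mxE.
Qed.

Lemma newton_directionE w : in_ball w ->
  sphere_hessian om (shifted x w) \in unitmx ->
  newton_direction om x w = ((1 - dot w w) / 2) *: newton_vector om (shifted x w).
Proof.
move=> w1 Hu; rewrite /newton_direction mean_field_jacobianE // mean_fieldE //.
rewrite -[- sphere_hessian _ _]scaleN1r invmxZ ?unitmxZ ?unitrN1 // invrN invr1 -scalemxAl -scalemxAr.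
by rewrite scaleN1r scalerN opprK.
Qed.

End MeanField.

(** * Geodesics of the ball *)

Section ExponentialOde.
Variables (R : realType) (a : R).

Lemma is_derive_expR_scale (c t : R) : is_derive t (1 : R) (fun s => expR (c * s)) (c * expR (c * t)).
Proof. by apply: is_derive_eq; rewrite /GRing.scale /=; ring. Qed.

Lemma linear_ode1 (c : R) (f : R -> R) : (forall t, is_derive t (1 : R) f (c * f t)) ->
  forall t, f t = expR (c * t) * f 0.
Proof.
move=> df t; pose g s := expR (- c * s) * f s.
have dg s : is_derive s (1 : R) g 0.
  have h1 := is_derive_expR_scale (- c) s; have h2 := df s.
  by apply: is_derive_eq; rewrite /GRing.scale /=; ring.
have := is_derive_0_is_cst t 0 dg; rewrite /g mulr0 expR0 mul1r => <-.
by rewrite mulrA -expRD mulNr subrr expR0 mul1r.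
Qed.

(** f'' = a^2 f splits into first-order equations for f' + a f and f' - a f. Multiplying by 2a
    instead of dividing keeps the statement valid for a = 0. *)
Lemma linear_ode2 (f f' : R -> R) : (forall t, is_derive t (1 : R) f (f' t)) ->
  (forall t, is_derive t (1 : R) f' (a ^+ 2 * f t)) ->
  forall t, 2 * a * f t = expR (a * t) * (f' 0 + a * f 0) - expR (- a * t) * (f' 0 - a * f 0).
Proof.
move=> df df' t.
pose g s := f' s + a * f s; pose h s := f' s - a * f s.
have dg s : is_derive s (1 : R) g (a * g s).
  have h1 := df s; have h2 := df' s.
  by apply: is_derive_eq; rewrite /GRing.scale /= /g; ring.
have dh s : is_derive s (1 : R) h (- a * h s).
  have h1 := df s; have h2 := df' s.
  by apply: is_derive_eq; rewrite /GRing.scale /= /h; ring.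
rewrite -/(g 0) -/(h 0) -(linear_ode1 dg) -(linear_ode1 dh) /g /h; ring.
Qed.

End ExponentialOde.

Lemma normr_tanhR_lt1 (R : realType) (s : R) : `|tanhR s| < 1.
Proof.
have Ep := expR_gt0 (s + s).
rewrite ltr_norml tanhR_lt1 andbT /tanhR ltr_pdivlMr; first by lra.
by rewrite addr_gt0.
Qed.

Section HyperbolicFunctions.
Variables (R : realType) (a : R).

Definition cosha t := (expR (a * t) + expR (- a * t)) / 2.
Definition sinha t := (expR (a * t) - expR (- a * t)) / 2.
Definition hyp (u v t : R) := cosha t * u + sinha t * v.

Lemma cosha0 : cosha 0 = 1.
Proof. by rewrite /cosha !mulr0 expR0; field. Qed.

Lemma sinha0 : sinha 0 = 0.
Proof. by rewrite /sinha !mulr0 expR0 subrr mul0r. Qed.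

Lemma sqr_cosha t : cosha t ^+ 2 = 1 + sinha t ^+ 2.
Proof.
have h : expR (a * t) * expR (- a * t) = 1 by rewrite -expRD mulNr subrr expR0.
rewrite /cosha /sinha; lra.
Qed.

Lemma is_derive_cosha t : is_derive t (1 : R) cosha (a * sinha t).
Proof.
have h1 := is_derive_expR_scale a t; have h2 := is_derive_expR_scale (- a) t.
by apply: is_derive_eq; rewrite /GRing.scale /= /sinha; ring.
Qed.

Lemma is_derive_sinha t : is_derive t (1 : R) sinha (a * cosha t).
Proof.
have h1 := is_derive_expR_scale a t; have h2 := is_derive_expR_scale (- a) t.
by apply: is_derive_eq; rewrite /GRing.scale /= /cosha; ring.
Qed.

Lemma is_derive_hyp u v t : is_derive t (1 : R) (hyp u v) (a * hyp v u t).
Proof.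
have h1 := is_derive_cosha t; have h2 := is_derive_sinha t.
by apply: is_derive_eq; rewrite /GRing.scale /= /hyp; ring.
Qed.

Lemma hyp_ode (f f' : R -> R) : (forall t, is_derive t (1 : R) f (f' t)) ->
  (forall t, is_derive t (1 : R) f' (a ^+ 2 * f t)) ->
  forall t, a * f t = hyp (a * f 0) (f' 0) t.
Proof.
by move=> h1 h2 t; have := linear_ode2 h1 h2 t; rewrite /hyp /cosha /sinha; lra.
Qed.

End HyperbolicFunctions.

(* In the hyperboloid model [(P, T)], with [P = 2 gamma / (1 - |gamma|^2)] and
   [T = (1 + |gamma|^2) / (1 - |gamma|^2)], a geodesic of speed [a] solves the
   linear equation [(P, T)'' = a^2 (P, T)]. *)
Section HyperboloidCurve.
Variables (R : realType) (d : nat) (a T0 TQ : R) (P0 Q : 'rV[R]_d).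
Hypotheses (PP0 : dot P0 P0 = T0 ^+ 2 - 1) (P0Q : dot P0 Q = T0 * TQ).
Hypotheses (QQ : dot Q Q = TQ ^+ 2 + 1).
Hypotheses (T0D_gt0 : 0 < T0 + TQ) (T0B_gt0 : 0 < T0 - TQ).

Local Notation T t := (hyp a T0 TQ t).
Local Notation T' t := (a * hyp a TQ T0 t).
Local Notation P t := (cosha a t *: P0 + sinha a t *: Q).
Local Notation P' t := (a *: (sinha a t *: P0 + cosha a t *: Q)).

(** P / (1 + T) is the projection of the hyperboloid to the ball. The hypotheses place (P0, T0) on
    |P|^2 - T^2 = -1 and make (Q, TQ) a unit tangent vector there; those on T0 + TQ and T0 - TQ keep
    T positive. *)
Definition hyperboloid_curve t := (1 + T t)^-1 *: P t.

Definition hyperboloid_curve' t := (1 + T t)^-1 *: P' t - (T' t / (1 + T t) ^+ 2) *: P t.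

Let G'' t := (a ^+ 2 / (1 + T t) - a ^+ 2 * T t / (1 + T t) ^+ 2 + 2 * T' t ^+ 2 / (1 + T t) ^+ 3) *: P t
  - (2 * T' t / (1 + T t) ^+ 2) *: P' t.

Lemma hyp_gt0 t : 0 < T t.
Proof.
rewrite (_ : T t = (expR (a * t) * (T0 + TQ) + expR (- a * t) * (T0 - TQ)) / 2); last first.
  by rewrite /hyp /cosha /sinha; ring.
by rewrite divr_gt0 // addr_gt0 // mulr_gt0 ?expR_gt0.
Qed.

Let T1_neq0 t : 1 + T t != 0. Proof. by rewrite gt_eqF // addr_gt0 // hyp_gt0. Qed.

Let PP t : dot (P t) (P t) = T t ^+ 2 - 1.
Proof.
transitivity (T t ^+ 2 - (cosha a t ^+ 2 - sinha a t ^+ 2)).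
  by rewrite !(dotDl, dotDr, dotZl, dotZr) PP0 P0Q (dotC Q) P0Q QQ /hyp; ring.
by rewrite sqr_cosha addrK.
Qed.

Let PP' t : dot (P t) (P' t) = T t * T' t.
Proof. rewrite !(dotDl, dotDr, dotZl, dotZr) PP0 P0Q (dotC Q) P0Q QQ /hyp; ring. Qed.

Let P'P' t : dot (P' t) (P' t) = T' t ^+ 2 + a ^+ 2.
Proof.
rewrite !(dotDl, dotDr, dotZl, dotZr) PP0 P0Q (dotC Q) P0Q QQ /hyp.
have -> : a ^+ 2 = a ^+ 2 * (cosha a t ^+ 2 - sinha a t ^+ 2) by rewrite sqr_cosha addrK mulr1.
ring.
Qed.

Lemma is_derive_hyperboloid_curve t :
  is_derive t (1 : R) hyperboloid_curve (hyperboloid_curve' t).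
Proof.
apply: is_derive_row => j.
have h1 := is_derive_cosha a t; have h2 := is_derive_sinha a t.
have h3 := is_derive_hyp a T0 TQ t.
rewrite (_ : (fun s => _) = (fun s => (1 + T s)^-1 * (cosha a s * P0 0 j + sinha a s * Q 0 j))); last first.
  by apply/funext => s; rewrite !mxE.
have d1 : is_derive t (1 : R) (fun s => 1 + T s) (T' t).
  by apply: (is_derive_eq (is_deriveD (is_derive_cst (1 : R) t (1 : R)) h3)); rewrite add0r.
have dV := @is_derive_inv _ _ (fun s => 1 + T s) t 1 _ (T1_neq0 t) d1.
apply: is_derive_eq; rewrite /GRing.scale /= !mxE; ring.
Qed.

Let dG' t : is_derive t (1 : R) hyperboloid_curve' (G'' t).
Proof.
apply: is_derive_row => j.
have h1 := is_derive_cosha a t; have h2 := is_derive_sinha a t.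
have h3 := is_derive_hyp a T0 TQ t; have h4 := is_derive_hyp a TQ T0 t.
rewrite (_ : (fun s => _) = (fun s =>
     (1 + T s)^-1 * (a * (sinha a s * P0 0 j + cosha a s * Q 0 j))
     - T' s * (1 + T s)^-1 * (1 + T s)^-1 * (cosha a s * P0 0 j + sinha a s * Q 0 j))); last first.
  by apply/funext => s; rewrite !mxE -[(_ ^+ 2)^-1]exprVn; ring.
have d1 : is_derive t (1 : R) (fun s => 1 + T s) (T' t).
  by apply: (is_derive_eq (is_deriveD (is_derive_cst (1 : R) t (1 : R)) h3)); rewrite add0r.
have dV := @is_derive_inv _ _ (fun s => 1 + T s) t 1 _ (T1_neq0 t) d1.
have Tn := T1_neq0 t.
by apply: is_derive_eq; rewrite /GRing.scale /= !mxE; field.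
Qed.

Lemma derive1_hyperboloid_curve : derive1 hyperboloid_curve = hyperboloid_curve'.
Proof. by apply/funext => t; rewrite derive1E; case: (is_derive_hyperboloid_curve t). Qed.

Let GG t : dot (hyperboloid_curve t) (hyperboloid_curve t) = (T t - 1) / (1 + T t).
Proof. by rewrite /hyperboloid_curve (dotZl (_^-1)) (dotZr (_^-1)) PP; field; exact: T1_neq0. Qed.

Let GG' t : dot (hyperboloid_curve t) (hyperboloid_curve' t) = T' t / (1 + T t) ^+ 2.
Proof.
rewrite /hyperboloid_curve /hyperboloid_curve' (dotZl (_^-1)) dotDr dotNr.
rewrite (dotZr (_^-1)) (dotZr (_ / _)) PP PP'.
by field; exact: T1_neq0.
Qed.

Let G'G' t : dot (hyperboloid_curve' t) (hyperboloid_curve' t) = a ^+ 2 / (1 + T t) ^+ 2.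
Proof.
rewrite /hyperboloid_curve' !(dotDr, dotNr, dotDl, dotNl).
rewrite !(dotZl (_^-1)) !(dotZl (_ / _)) !(dotZr (_^-1)) !(dotZr (_ / _)).
rewrite (dotC (P' t) (P t)) PP PP' P'P'.
by field; exact: T1_neq0.
Qed.

Let G_den t : 1 - dot (hyperboloid_curve t) (hyperboloid_curve t) = 2 / (1 + T t).
Proof. by rewrite GG; field; exact: T1_neq0. Qed.

Lemma hyperboloid_curve_ball t : in_ball (hyperboloid_curve t).
Proof.
by apply/in_ballP; rewrite -subr_gt0 G_den divr_gt0 // addr_gt0 // hyp_gt0.
Qed.

Lemma hyperboloid_curve_geodesic : is_geodesic hyperboloid_curve.
Proof.
move=> t; have gb := hyperboloid_curve_ball t.
split=> //; first by case: (is_derive_hyperboloid_curve t).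
  by rewrite derive1_hyperboloid_curve; case: (dG' t).
have -> : derive1 (derive1 hyperboloid_curve) t = G'' t.
  by rewrite derive1_hyperboloid_curve derive1E; case: (dG' t).
rewrite derive1_hyperboloid_curve christoffel_formE // G_den GG' G'G'.
have Tn := T1_neq0 t.
by apply/rowP => j; rewrite /hyperboloid_curve' /hyperboloid_curve !mxE; field.
Qed.

Lemma hyperboloid_curve_C1 : continuous (derive1 hyperboloid_curve).
Proof.
rewrite derive1_hyperboloid_curve => t.
by apply/differentiable_continuous/derivable1_diffP; case: (dG' t).
Qed.

Lemma hyperboloid_curve_metric_norm t : 0 <= a ->
  metric_norm (hyperboloid_curve t) (derive1 hyperboloid_curve t) = a.
Proof.
move=> a0; rewrite /metric_norm /metric derive1_hyperboloid_curve /metric_tensor mul_mx_scalar.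
rewrite -scalemxAl mulmx_trE !mxE mulr1n sqr_enorm G_den G'G'.
rewrite (_ : 4 / _ ^+ 2 * _ = a ^+ 2) ?sqrtr_sqr ?ger0_norm //.
by field; exact: T1_neq0.
Qed.

End HyperboloidCurve.

Section Geodesic.
Variables (R : realType) (d : nat) (w e : 'rV[R]_d).
Hypotheses (w1 : in_ball w) (e1 : in_sphere e).

Let b := 1 - dot w w.
Let b_gt0 : 0 < b. Proof. by rewrite subr_gt0; exact/in_ballP. Qed.
Let bn0 : 1 - dot w w != 0. Proof. by rewrite gt_eqF. Qed.

(** The data are the images on the hyperboloid of w and of its unit tangent vector (1 - |w|^2)/2
    e. *)
Definition geodesic_curve a := hyperboloid_curve a
  (2 / (1 - dot w w) - 1) (2 * dot w e / (1 - dot w w))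
  ((2 / (1 - dot w w)) *: w) (e + (2 * dot w e / (1 - dot w w)) *: w).

Let PP0 : dot ((2 / (1 - dot w w)) *: w) ((2 / (1 - dot w w)) *: w) = (2 / (1 - dot w w) - 1) ^+ 2 - 1.
Proof. by rewrite dotZl dotZr; field. Qed.

Let P0Q : dot ((2 / (1 - dot w w)) *: w) (e + (2 * dot w e / (1 - dot w w)) *: w) =
  (2 / (1 - dot w w) - 1) * (2 * dot w e / (1 - dot w w)).
Proof. by rewrite dotDr !dotZl !dotZr; field. Qed.

Let QQ : dot (e + (2 * dot w e / (1 - dot w w)) *: w) (e + (2 * dot w e / (1 - dot w w)) *: w) =
  (2 * dot w e / (1 - dot w w)) ^+ 2 + 1.
Proof.
by rewrite !dotDr !dotDl !dotZl !dotZr ((in_sphereP e).1 e1) (dotC e w); field.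
Qed.

Let T0D_gt0 : 0 < 2 / (1 - dot w w) - 1 + 2 * dot w e / (1 - dot w w).
Proof.
have h2 := shift_den_gt0 (ball_opp w1) e1; rewrite !dotE in h2.
have -> : 2 / (1 - dot w w) - 1 + 2 * dot w e / (1 - dot w w) =
  (1 - 2 * - dot w e + - - dot w w) / (1 - dot w w) by field.
by rewrite divr_gt0.
Qed.

Let T0B_gt0 : 0 < 2 / (1 - dot w w) - 1 - 2 * dot w e / (1 - dot w w).
Proof.
have h2 := shift_den_gt0 w1 e1.
have -> : 2 / (1 - dot w w) - 1 - 2 * dot w e / (1 - dot w w) =
  (1 - 2 * dot w e + dot w w) / (1 - dot w w) by field.
by rewrite divr_gt0.
Qed.

Lemma geodesic_curveP a : is_geodesic (geodesic_curve a).
Proof. exact: hyperboloid_curve_geodesic. Qed.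

Let T1E : 1 + (1 * (2 / (1 - dot w w) - 1) + 0 * (2 * dot w e / (1 - dot w w))) =
  2 / (1 - dot w w).
Proof. by ring. Qed.

Lemma geodesic_curve0 a : geodesic_curve a 0 = w.
Proof.
rewrite /geodesic_curve /hyperboloid_curve /hyp cosha0 sinha0 T1E.
by apply/rowP => j; rewrite !mxE; field.
Qed.

Lemma derive1_geodesic_curve0 a : derive1 (geodesic_curve a) 0 = (a * (1 - dot w w) / 2) *: e.
Proof.
rewrite derive1_hyperboloid_curve // /hyperboloid_curve' /hyp cosha0 sinha0 T1E.
by apply/rowP => j; rewrite !mxE; field.
Qed.

(** This is exp_w = [shift (- w)] composed with exp_0, checked by comparing explicit fractions. *)
Lemma geodesic_curve1 a : geodesic_curve a 1 = shift (- w) (tanhR (a / 2) *: e).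
Proof.
have E : a / 2 + a / 2 = a by field.
rewrite /geodesic_curve /hyperboloid_curve /hyp /cosha /sinha /tanhR E !mulr1 expRN.
have Ep := expR_gt0 a; set E1 := expR a in Ep *.
rewrite shiftE !dotE ((in_sphereP e).1 e1).
apply/rowP => j; rewrite !mxE; field.
rewrite !gt_eqF //; last by rewrite addr_gt0.
(* The denominator left to treat is that of the shift multiplied by (E1 + 1)^2. *)
have r1 := normr_tanhR_lt1 (a / 2); rewrite /tanhR E -/E1 in r1.
have wz1 : in_ball (((E1 - 1) / (E1 + 1)) *: e) by rewrite /in_ball enormZ e1 mulr1.
have := shift_ball_den_gt0 (ball_opp w1) wz1.
rewrite !(dotNl, dotNr, dotZl, dotZr) ((in_sphereP e).1 e1) => h.
have Ep1 : 0 < E1 + 1 by rewrite addr_gt0.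
have : 0 < (E1 + 1) ^+ 2 by rewrite exprn_gt0.
move=> /(mulr_gt0 h); rewrite [X in 0 < X -> _](_ : _ = (E1 + 1 - 2 * ((E1 - 1) * - dot w e)) * (E1 + 1) +
  - - dot w w * ((E1 - 1) * (E1 - 1))) //; field.
by rewrite gt_eqF.
Qed.

Lemma riemannian_exp_geodesic a :
  (forall gamma, is_geodesic gamma -> gamma 0 = w ->
    derive1 gamma 0 = (a * (1 - dot w w) / 2) *: e -> gamma 1 = geodesic_curve a 1) ->
  riemannian_exp w ((a * (1 - dot w w) / 2) *: e) = geodesic_curve a 1.
Proof.
move=> h; apply: xget_unique => [|y [gamma [h1 h2 h3 <-]]]; last exact: h.
exists (geodesic_curve a); rewrite geodesic_curve0 derive1_geodesic_curve0.
by split=> //; exact: geodesic_curveP.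
Qed.

(** The curve is admissible and has constant speed a over a unit time interval. *)
Lemma geodesic_dist_curve a : 0 <= a ->
  (geodesic_dist w (geodesic_curve a 1) <= a%:E)%E.
Proof.
move=> a0; apply: ereal_inf_lbound; exists (geodesic_curve a).
  split=> //.
  - by move=> t; case: (is_derive_hyperboloid_curve a ((2 / (1 - dot w w)) *: w) (e + (2 * dot w e / (1 - dot w w)) *: w) T0D_gt0 T0B_gt0 t).
  - exact: hyperboloid_curve_C1.
  - by move=> t _; exact: hyperboloid_curve_ball.
  - exact: geodesic_curve0.
rewrite /curve_length.
under eq_integral do rewrite hyperboloid_curve_metric_norm //.
by rewrite integral_cst //= lebesgue_measure_itv /= lte_fin ltr01 oppr0 adde0 mule1.
Qed.

End Geodesic.

Lemma is_derive_dot (R : realType) d (f g : R -> 'rV[R]_d) t df dg :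
  is_derive t (1 : R) f df -> is_derive t (1 : R) g dg ->
  is_derive t (1 : R) (fun s => dot (f s) (g s)) (dot df (g t) + dot (f t) dg).
Proof.
move=> hf hg.
have -> : (fun s => dot (f s) (g s)) = \sum_i (fun s => f s 0 i * g s 0 i).
  by apply/funext => s; rewrite fct_sumE.
rewrite /dot -big_split; apply: is_derive_sum => i /=.
have h1 := is_derive_coord i hf; have h2 := is_derive_coord i hg.
by apply: is_derive_eq; rewrite /GRing.scale /=; ring.
Qed.

(** * Uniqueness of geodesics *)

Section GeodesicUnique.
Variables (R : realType) (d : nat) (gamma : R -> 'rV[R]_d).
Hypothesis geo : is_geodesic gamma.

Local Notation g' := (derive1 gamma).
Local Notation g'' := (derive1 (derive1 gamma)).
Local Notation N t := (dot (gamma t) (gamma t)).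
Local Notation p t := (dot (gamma t) (g' t)).
Local Notation v2 t := (dot (g' t) (g' t)).

Let b_gt0 t : 0 < 1 - N t.
Proof. by rewrite subr_gt0; apply/in_ballP; case: (geo t). Qed.

Let bn0 t : 1 - N t != 0. Proof. by rewrite gt_eqF. Qed.

Let dg t : is_derive t (1 : R) gamma (g' t).
Proof. by have [_ h _ _] := geo t; rewrite (derive1E gamma t); exact: derivableP. Qed.

Let dg' t : is_derive t (1 : R) g' (g'' t).
Proof. by rewrite [g'' t]derive1E; apply: derivableP; case: (geo t). Qed.

Let g''E t : g'' t = - (2 / (1 - N t)) *: ((2 * p t) *: g' t - v2 t *: gamma t).
Proof.
case: (geo t) => gb _ _; rewrite christoffel_formE // => /eqP.
rewrite addr_eq0 => /eqP ->; rewrite -scaleNr; congr (_ *: (_ - _)).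
by rewrite -scalerDl; congr (_ *: _); ring.
Qed.

Let dN t : is_derive t (1 : R) (fun s => N s) (2 * p t).
Proof.
by apply: (is_derive_eq (is_derive_dot (dg t) (dg t))); rewrite (dotC (g' t)); ring.
Qed.

Let dp t : is_derive t (1 : R) (fun s => p s) (v2 t - 2 / (1 - N t) * (2 * p t ^+ 2 - v2 t * N t)).
Proof.
apply: (is_derive_eq (is_derive_dot (dg t) (dg' t))).
by rewrite g''E dotZr dotDr dotNr !dotZr; ring.
Qed.

Let dv t : is_derive t (1 : R) (fun s => v2 s) (- (4 * p t * v2 t) / (1 - N t)).
Proof.
apply: (is_derive_eq (is_derive_dot (dg' t) (dg' t))).
rewrite (dotC (g'' t)) g''E dotZr dotDr dotNr !dotZr (dotC (g' t) (gamma t)); field.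
exact: bn0.
Qed.

Let db t : is_derive t (1 : R) (fun s => 1 - N s) (- (2 * p t)).
Proof.
by apply: (is_derive_eq (is_deriveB (is_derive_cst (1 : R) t (1 : R)) (dN t))); rewrite sub0r.
Qed.

Let dbV t : is_derive t (1 : R) (fun s => (1 - N s)^-1) (2 * p t / (1 - N t) ^+ 2).
Proof.
by apply: (is_derive_eq (@is_derive_inv _ _ (fun s => 1 - N s) t 1 _ (bn0 t) (db t))); rewrite opprK.
Qed.

(** Conservation of the squared metric speed, which allows |gamma'|^2 to be replaced by a function
    of |gamma|^2. *)
Lemma geodesic_speed t : 4 * v2 t / (1 - N t) ^+ 2 = 4 * v2 0 / (1 - N 0) ^+ 2.
Proof.
pose k s := 4 * v2 s * ((1 - N s)^-1 * (1 - N s)^-1).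
have kE s : 4 * v2 s / (1 - N s) ^+ 2 = k s by rewrite /k -exprVn expr2.
rewrite !kE; apply: is_derive_0_is_cst => s.
have h1 := dv s; have h2 := dbV s; have bs := bn0 s.
by apply: is_derive_eq; rewrite /GRing.scale /=; field.
Qed.

Variable a : R.
Hypothesis speed : 4 * v2 0 / (1 - N 0) ^+ 2 = a ^+ 2.

Let v2E t : v2 t = a ^+ 2 * (1 - N t) ^+ 2 / 4.
Proof. by rewrite -speed -(geodesic_speed t); field; exact: bn0. Qed.

(** Once |gamma'|^2 is eliminated by the conserved speed, the hyperboloid coordinate T = 2 / (1 -
    |gamma|^2) - 1 satisfies T'' = a^2 T. *)
Lemma geodesic_hyp_time t :
  a * (2 / (1 - N t) - 1) = hyp a (a * (2 / (1 - N 0) - 1)) (4 * p 0 / (1 - N 0) ^+ 2) t.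
Proof.
apply: (@hyp_ode _ a (fun s => 2 / (1 - N s) - 1) (fun s => 4 * p s / (1 - N s) ^+ 2)) => s.
  have h2 := dbV s; have bs := bn0 s.
  by apply: is_derive_eq; rewrite /GRing.scale /=; field.
have -> : (fun s => 4 * p s / (1 - N s) ^+ 2) = (fun s => 4 * p s * ((1 - N s)^-1 * (1 - N s)^-1)).
  by apply/funext => s0; rewrite -exprVn expr2.
have h1 := dp s; have h2 := dbV s; have bs := bn0 s.
by apply: is_derive_eq; rewrite /GRing.scale /= v2E; field.
Qed.

Lemma geodesic_hyp_space t j :
  a * (2 * gamma t 0 j / (1 - N t)) = hyp a (a * (2 * gamma 0 0 j / (1 - N 0)))
    (2 * g' 0 0 j / (1 - N 0) + 4 * p 0 * gamma 0 0 j / (1 - N 0) ^+ 2) t.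
Proof.
apply: (@hyp_ode _ a (fun s => 2 * gamma s 0 j / (1 - N s))
  (fun s => 2 * g' s 0 j / (1 - N s) + 4 * p s * gamma s 0 j / (1 - N s) ^+ 2)) => s.
  have h1 := is_derive_coord j (dg s); have h2 := dbV s; have bs := bn0 s.
  by apply: is_derive_eq; rewrite /GRing.scale /=; field.
have -> : (fun s => 2 * g' s 0 j / (1 - N s) + 4 * p s * gamma s 0 j / (1 - N s) ^+ 2) =
    (fun s => 2 * g' s 0 j / (1 - N s) + 4 * p s * gamma s 0 j * ((1 - N s)^-1 * (1 - N s)^-1)).
  by apply/funext => s0; rewrite -[(_ ^+ 2)^-1]exprVn expr2.
have h1 := is_derive_coord j (dg s); have h2 := dbV s; have h3 := is_derive_coord j (dg' s).
have h4 := dp s; have bs := bn0 s.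
by apply: is_derive_eq; rewrite /GRing.scale /= g''E !mxE v2E; field.
Qed.

(** At speed 0 the hyperboloid formulas, which carry a factor a, give no information; the curve is
    then constant. *)
Lemma geodesic_speed0 t : a = 0 -> gamma t = gamma 0.
Proof.
move=> a0; apply/rowP => j; apply: (@is_derive_0_is_cst R (fun s => gamma s 0 j)) => s.
apply: (is_derive_eq (is_derive_coord j (dg s))).
have /eqP : v2 s = 0 by rewrite v2E a0; ring.
by rewrite dotvv_eq0 => /eqP ->; rewrite mxE.
Qed.

End GeodesicUnique.

Section RiemannianExp.
Variables (R : realType) (d : nat) (w e : 'rV[R]_d).
Hypotheses (w1 : in_ball w) (e1 : in_sphere e).

Let b_gt0 : 0 < 1 - dot w w. Proof. by rewrite subr_gt0; exact/in_ballP. Qed.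

Lemma geodesic_unique a gamma : is_geodesic gamma -> gamma 0 = w ->
  derive1 gamma 0 = (a * (1 - dot w w) / 2) *: e -> gamma 1 = geodesic_curve w e a 1.
Proof.
move=> geo g0 g'0.
have sp : 4 * dot (derive1 gamma 0) (derive1 gamma 0) / (1 - dot (gamma 0) (gamma 0)) ^+ 2 = a ^+ 2.
  by rewrite g0 g'0 dotZl dotZr ((in_sphereP e).1 e1); field; rewrite gt_eqF.
have [a0|a0] := eqVneq a 0.
  rewrite (geodesic_speed0 geo sp 1 a0) g0 /geodesic_curve /hyperboloid_curve /hyp /cosha /sinha a0.
  rewrite oppr0 !mul0r expR0 subrr !mul0r scale0r !addr0 divff // !mul1r scale1r scalerA.
  by rewrite addrC subrK mulVf ?scale1r // mulf_neq0 ?invr_eq0 ?gt_eqF.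
have hT := geodesic_hyp_time geo sp 1.
have hP j := geodesic_hyp_space geo sp 1 j.
have b1 : 1 - dot (gamma 1) (gamma 1) != 0.
  by case: (geo 1) => /in_ballP ? _ _ _; rewrite gt_eqF // subr_gt0.
have {}hT : 2 / (1 - dot (gamma 1) (gamma 1)) = 1 + hyp a (2 / (1 - dot w w) - 1) (2 * dot w e / (1 - dot w w)) 1.
  apply: (mulfI a0); rewrite mulrDr mulr1 -[LHS](subrK a).
  rewrite -[X in _ - X]mulr1 -mulrBr hT g0 g'0 dotZr addrC; congr (_ + _).
  by rewrite /hyp; field; rewrite gt_eqF.
apply/rowP => j; rewrite /geodesic_curve /hyperboloid_curve !mxE -hT.
apply: (mulfI a0); rewrite invf_div.
have -> : a * gamma 1 0 j = (1 - dot (gamma 1) (gamma 1)) / 2 * (a * (2 * gamma 1 0 j / (1 - dot (gamma 1) (gamma 1)))).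
  by field.
rewrite hP g0 g'0 dotZr !mxE [RHS]mulrCA; congr (_ * _).
by rewrite /hyp; field; rewrite gt_eqF.
Qed.

Lemma riemannian_expE s : riemannian_exp w ((s * (1 - dot w w)) *: e) = shift (- w) (tanhR s *: e).
Proof.
have -> : s * (1 - dot w w) = 2 * s * (1 - dot w w) / 2 by field.
rewrite riemannian_exp_geodesic // => [|gamma h1 h2 h3]; last exact: geodesic_unique.
by rewrite geodesic_curve1 // (_ : 2 * s / 2 = s) //; field.
Qed.

Lemma geodesic_dist_le s : 0 <= s ->
  (geodesic_dist w (shift (- w) (tanhR s *: e)) <= (2 * s)%:E)%E.
Proof.
move=> s0; have := geodesic_dist_curve w1 e1 (_ : 0 <= 2 * s).
rewrite geodesic_curve1 // (_ : 2 * s / 2 = s); last by field.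
by apply; rewrite mulr_ge0.
Qed.

End RiemannianExp.

(** * Spectral gap, iteration count and couplings *)

Section Spectral.
Variables (R : realType) (d n : nat) (om : 'I_n -> R) (x : 'I_n -> 'rV[R]_d).
Hypotheses (om_gt0 : forall i, 0 < om i) (om1 : \sum_i om i = 1).
Hypothesis x1 : forall i, in_sphere (x i).

Local Notation A := (sphere_hessian om x).

Lemma dot_hessian_sym u v : dot (u *m A) v = dot u (v *m A).
Proof.
rewrite !mul_hessianE // !(dotDl, dotDr, dotNl, dotNr) dot_suml dot_sumr.
congr (_ - _); apply: eq_bigr => i _.
by rewrite !dotZl !dotZr (dotC (x i) v); ring.
Qed.

Lemma continuous_sumR (T : topologicalType) (I : finType) (F : I -> T -> R) :
  (forall i, continuous (F i)) -> continuous (fun v => \sum_i F i v).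
Proof.
move=> cF; rewrite (_ : (fun v => _) = \sum_i F i); last first.
  by apply/funext => v; rewrite fct_sumE.
apply: (big_ind (fun f : T -> R => continuous f)) => //; first by move=> v; exact: cvg_cst.
by move=> f g cf cg v; exact: cvgD (cf v) (cg v).
Qed.

Lemma continuous_coord i : continuous (fun v : 'rV[R]_d => v 0 i).
Proof. exact: coord_continuous. Qed.

Lemma continuous_dotvv : continuous (fun v : 'rV[R]_d => dot v v).
Proof.
apply: continuous_sumR => i v.
exact: cvgM (@continuous_coord i v) (@continuous_coord i v).
Qed.

Lemma continuous_dot_hessian : continuous (fun v : 'rV[R]_d => dot (v *m A) v).
Proof.
have -> : (fun v => dot (v *m A) v) = (fun v => dot v v - \sum_i om i * dot v (x i) ^+ 2).
  apply/funext => v; rewrite mul_hessianE // !(dotDl, dotNl) dot_suml; congr (_ - _).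
  by apply: eq_bigr => i _; rewrite !dotZl (dotC v); ring.
have c2 i : continuous (fun v : 'rV[R]_d => dot v (x i)).
  apply: continuous_sumR => j v.
  exact: cvgM (@continuous_coord j v) (cvg_cst _).
have c3 : continuous (fun v : 'rV[R]_d => \sum_i om i * dot v (x i) ^+ 2).
  apply: continuous_sumR => i v.
  exact: cvgM (cvg_cst _) (cvgM (c2 i v) (c2 i v)).
move=> v.
exact: cvgB (@continuous_dotvv v) (c3 v).
Qed.

(** The Rayleigh quotient attains its minimum on the compact unit sphere, and the minimum a is an
    eigenvalue: a nonzero residual z = c A - a c at the minimizer c would allow a descent along
    z. *)
Lemma sphere_hessian_gapped lam : (forall a, eigenvalue A a -> lam <= a) -> gapped om x lam.
Proof.
move=> hlam; apply: hessian_gapped => // v.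
pose S := [set u : 'rV[R]_d | dot u u = 1]%classic.
have [i0 _] : exists i : 'I_n, true.
  case: n om om1 => [om' |n' _ _]; last by exists ord0.
  by rewrite big_ord0 => /esym/eqP; rewrite oner_eq0.
have S0 : (S !=set0)%classic by exists (x i0); exact/in_sphereP.
have cS : compact S.
  apply: bounded_closed_compact; last first.
    rewrite (_ : S = (fun v => dot v v) @^-1` [set 1])%classic //.
    apply: closed_comp; last exact: closed_eq.
    by move=> u _; exact: continuous_dotvv.
  exists 1; split; first exact: num_real.
  move=> M M1 u /= u1; have M0 : 0 <= M by rewrite (le_trans _ (ltW M1)).
  rewrite /Num.Def.normr /= mx_normrE (bigmax_le _ M0) //= => -[i j] _ /=.
  rewrite (ord1 i) (le_trans (coord_le_enorm u j)) //.
  by rewrite ((in_sphereP u).2 u1) ltW.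
have [c /set_mem /= c1 cmin] := @EVT_min_rV R d (fun v => dot (v *m A) v) S S0 cS
  (continuous_subspaceT continuous_dot_hessian).
set a := dot (c *m A) c in cmin.
have amin u : a * dot u u <= dot (u *m A) u.
  have [->|u0] := eqVneq u 0; first by rewrite mul0mx !dot0l mulr0.
  have uu : 0 < dot u u by rewrite lt_neqAle eq_sym dotvv_eq0 u0 dotvv_ge0.
  have e0 : enorm u != 0 by rewrite enorm_eq0.
  have := cmin ((enorm u)^-1 *: u).
  rewrite -scalemxAl !dotZl !dotZr -!sqr_enorm => h.
  have {}h : a <= (enorm u)^-1 * ((enorm u)^-1 * dot (u *m A) u).
    apply: h; apply/mem_set; rewrite /S /= !dotZl !dotZr -sqr_enorm; field => //.
  rewrite -ler_pdivlMr ?exprn_gt0 ?lt_neqAle 1?eq_sym ?e0 ?enorm_ge0 //.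
  by rewrite (le_trans h) // expr2 invfM mulrA mulrC.
suff ea : eigenvalue A a.
  by apply: le_trans (amin v); rewrite ler_wpM2r ?dotvv_ge0 // hlam.
apply/eigenvalueP; exists c; last first.
  by rewrite -dotvv_eq0 c1 oner_eq0.
apply/eqP; rewrite -subr_eq0 -dotvv_eq0; apply/negPn/negP.
have [z zE] : exists z, c *m A = z + a *: c by exists (c *m A - a *: c); rewrite subrK.
rewrite zE addrK => z0.
have zz : 0 < dot z z by rewrite lt_neqAle eq_sym z0 dotvv_ge0.
pose B := dot (z *m A) z - a * dot z z.
have B0 : 0 <= B by rewrite subr_ge0.
have ez : dot (c *m A) z = dot z z + a * dot c z.
  by rewrite zE dotDl dotZl.
have key t : 0 <= 2 * t * dot z z + t ^+ 2 * B.
  have := amin (c + t *: z); rewrite -subr_ge0 mulmxDl -scalemxAl.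
  rewrite !(dotDl c, dotDl (c *m A), dotDr (c *m A), dotDr (t *: (z *m A)), dotDr c, dotDr (t *: z)).
  rewrite !(dotZl t) !(dotZr t) (dot_hessian_sym z c) (dotC z (c *m A)) ez c1 -/a (dotC z c).
  by rewrite [X in 0 <= X -> _](_ : _ = 2 * t * dot z z + t ^+ 2 * B) // /B; ring.
(* The minimizer in t would be - |z|^2 / B, but B may be 0; with B + 1 the expression is still
   negative. *)
have := key (- dot z z / (B + 1)).
rewrite (_ : _ + _ = (dot z z ^+ 2 / (B + 1)) * (B / (B + 1) - 2)); last first.
  by field; rewrite gt_eqF // ltr_wpDl.
have B1 : 0 < B + 1 by rewrite ltr_wpDl.
rewrite pmulr_rge0 ?divr_gt0 ?exprn_gt0 // subr_ge0 ler_pdivlMr //; lra.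
Qed.

(** Testing the gap on an atom gives 1 - lam at least the positive weight of that atom. *)
Lemma gapped_lt1 lam : gapped om x lam -> lam < 1.
Proof.
move=> gx.
have [i0 _] : exists i : 'I_n, true.
  case: n om om1 => [om' |n' _ _]; last by exists ord0.
  by rewrite big_ord0 => /esym/eqP; rewrite oner_eq0.
have := gx (x i0); rewrite ((in_sphereP _).1 (x1 i0)) mulr1 (bigD1 i0) //=.
rewrite ((in_sphereP _).1 (x1 i0)) expr1n mulr1.
have : 0 <= \sum_(i < n | i != i0) om i * dot (x i) (x i0) ^+ 2.
  by apply: sumr_ge0 => i _; rewrite mulr_ge0 ?sqr_ge0 // ltW.
by have := om_gt0 i0; lra.
Qed.

End Spectral.

(** * The iteration count *)

Section IterationCount.
Variable R : realType.

Lemma log2e_gt0E (a : R) : 0 < a -> log2e a%:E = (ln a / ln 2)%:E.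
Proof. by move=> a0; rewrite /log2e lne_EFin. Qed.

(** Apart from the cases where k = 0 suffices, k is the nonnegative part of the ceiling, and q^(2^k)
    <= eps reads |log2 eps| <= 2^k |log2 q|. *)
Lemma iteration_count (eps q : R) : 0 < eps -> 0 <= q -> q < 1 ->
  exists k : nat, ((k%:R : R)%:E <= iteration_bound eps q)%E /\ q ^+ (2 ^ k) <= eps.
Proof.
move=> e0 q0 q1.
have k0 : ((0%:R : R)%:E <= iteration_bound eps q)%E by rewrite /iteration_bound le_max lexx.
have [e1|e1] := leP 1 eps; first by exists 0%N; split=> //; rewrite expn0 expr1; lra.
have [qz|qn0] := eqVneq q 0; first by exists 0%N; split=> //; rewrite qz expn0 expr1 ltW.
have qp : 0 < q by rewrite lt_neqAle eq_sym qn0.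
have l2 : 0 < ln 2 :> R by rewrite ln_gt0 // ltr1n.
have lnlt0 (a : R) : 0 < a -> a < 1 -> 0 < - ln a / ln 2.
  by move=> a0 a1; rewrite divr_gt0 // oppr_gt0 ln_lt0 // a0.
set a := - ln eps / ln 2; set b := - ln q / ln 2.
have a0 : 0 < a by exact: lnlt0.
have b0 : 0 < b by exact: lnlt0.
have abE (c : R) : 0 < c -> c < 1 -> `|log2e c%:E|%E = (- ln c / ln 2)%:E.
  move=> c0 c1; rewrite log2e_gt0E //= ltr0_norm ?mulNr // -oppr_gt0 -mulNr.
  exact: lnlt0.
pose c := ln a / ln 2 - ln b / ln 2.
have bE : iteration_bound eps q = maxe 0%E (((Num.ceil c)%:~R : R)%:E).
  by rewrite /iteration_bound !abE // -/a -/b !log2e_gt0E // -EFinB.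
exists `|Num.max (0 : int) (Num.ceil c)|%N.
have kE : (`|Num.max (0 : int) (Num.ceil c)|%N)%:R = Num.max 0 (Num.ceil c)%:~R :> R.
  rewrite natr_absz ger0_norm ?le_max ?lexx //.
  have [h|h] := leP 0 (Num.ceil c); first by rewrite !max_r ?ler0z.
  by rewrite !max_l ?lerz0 ?ltW.
rewrite kE bE; split; first by rewrite EFin_max.
set k := `|_|%N in kE *.
have aE : a = - ln eps / ln 2 by [].
have bE' : b = - ln q / ln 2 by [].
have ck : c <= k%:R by rewrite kE le_max ceil_ge orbT.
clearbody a b k; rewrite -ler_ln ?posrE ?exprn_gt0 // lnXn //.
have : a <= 2 ^+ k * b.
  have tp : 0 < 2 ^+ k :> R by rewrite exprn_gt0.
  have tb : 0 < 2 ^+ k * b by rewrite mulr_gt0.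
  suff : ln a <= ln (2 ^+ k * b) by rewrite ler_ln.
  rewrite lnM // lnXn // -lerBlDr -[X in _ <= X]mulr_natr -ler_pdivrMl //.
  by rewrite mulrC mulrBl.
rewrite aE bE' mulrA ler_pM2r ?invr_gt0 // mulrN lerN2 => h.
by rewrite -mulr_natl natrX.
Qed.

End IterationCount.

(** * Angle and chord *)

Section ChordToAngle.
Variable R : realType.

(** The derivative of sin t - 2t/3 is nonnegative, as cos t = 1 - 2 sin^2(t/2) >= 1 - t^2/2 >=
    7/8. *)
Lemma sin_ge_scale (y : R) : 0 <= y <= 1 / 2 -> 2 / 3 * y <= sin y.
Proof.
move=> /andP[y0 y1].
pose g (t : R) := sin t - 2 / 3 * t.
have dg t : is_derive t (1 : R) g (cos t - 2 / 3).
  by apply: is_derive_eq; rewrite /GRing.scale /=; ring.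
have sin_le (t : R) : 0 <= t -> sin t <= t.
  move=> t0; pose h (s : R) := s - sin s.
  have dh s : is_derive s (1 : R) h (1 - cos s) by apply: is_derive_eq.
  have : h 0 <= h t.
    apply: (@ger0_derive1_ndecr _ h 0 t) => //.
      by move=> s _; rewrite derive1E derive_val subr_ge0 cos_le1.
    by apply: derivable_within_continuous => s _; case: (dh s).
  by rewrite /h sin0; lra.
have : g 0 <= g y.
  apply: (@ger0_derive1_ndecr _ g 0 y) => //.
    move=> t; rewrite in_itv /= => /andP[t0 ty]; rewrite derive1E derive_val.
    have -> : cos t = 1 - 2 * sin (t / 2) ^+ 2.
      rewrite [in LHS](_ : t = (t / 2) *+ 2) ?cos_mulr2n; last by rewrite -mulr_natr divfK.
      by have := cos2Dsin2 (t / 2); rewrite -mulr_natr; lra.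
    have h2 : sin (t / 2) <= t / 2 by apply: sin_le; lra.
    have h3 : 0 <= sin (t / 2).
      have [->|tn0] := eqVneq t 0; first by rewrite mul0r sin0.
      by apply/ltW/sin2_gt0/andP; split; lra.
    by nra.
  by apply: derivable_within_continuous => t _; case: (dg t).
by rewrite /g sin0; lra.
Qed.

(** Compare cosines: cos(3c/2) = 1 - 2 sin^2(3c/4) <= 1 - c^2/2 = <u,v>. The bound 3/5 keeps 3c/4
    below 1/2, where sin is at least 2/3 of its argument. *)
Lemma sphere_dist_le_chord d (u v : 'rV[R]_d) : in_sphere u -> in_sphere v ->
  enorm (u - v) <= 3 / 5 -> `|sphere_dist u v| <= 3 / 2 * enorm (u - v).
Proof.
move=> u1 v1; set c := enorm (u - v) => hc; have c0 : 0 <= c by exact: enorm_ge0.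
have uv : dot u v = 1 - c ^+ 2 / 2.
  rewrite sqr_enorm !(dotDl, dotDr, dotNl, dotNr) ((in_sphereP _).1 u1) ((in_sphereP _).1 v1) (dotC v u).
  by field.
have r1 : -1 <= dot u v <= 1 by rewrite uv; apply/andP; split; nra.
have dl := acos_lepi r1; have d0 := acos_ge0 r1.
rewrite /sphere_dist ger0_norm // leNgt; apply/negP => hlt.
have pi2 := @pi_ge2 R.
have ci : 3 / 2 * c \in `[0, pi] by rewrite in_itv /=; apply/andP; split; lra.
have ai : acos (dot u v) \in `[0, pi] by rewrite in_itv /= d0.
move: hlt; rewrite -(ltr_cos ci ai) acosK ?in_itv // uv.
rewrite (_ : 3 / 2 * c = (3 / 4 * c) *+ 2) ?cos_mulr2n; last by rewrite mulr2n; field.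
have s1 : 2 / 3 * (3 / 4 * c) <= sin (3 / 4 * c) by apply: sin_ge_scale; apply/andP; split; lra.
have s2 : (2 / 3 * (3 / 4 * c)) ^+ 2 <= sin (3 / 4 * c) ^+ 2.
  have s0 : 0 <= 2 / 3 * (3 / 4 * c) by lra.
  by rewrite ler_pXn2r ?nnegrE // (le_trans s0).
have h1 := cos2Dsin2 (3 / 4 * c); rewrite (mulr2n (cos _ ^+ 2)) => h2.
lra.
Qed.

End ChordToAngle.

(** * The coupling of equally indexed atoms *)

Section Coupling.
Variables (R : realType) (d n : nat) (om : 'I_n -> R) (y z : 'I_n -> 'rV[R]_d).
Hypotheses (om_gt0 : forall i, 0 < om i) (om1 : \sum_i om i = 1).

Local Notation T := (borel_rV R d * borel_rV R d)%type.

(** Indexed by [nat] because [msum] takes a sequence of measures. *)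
Definition coupling_atom (k : nat) : {measure set T -> \bar R} :=
  if insub k is Some i
  then mscale (NngNum (ltW (om_gt0 i))) (dirac ((y i, z i) : T))
  else mzero.

Definition coupling : {measure set T -> \bar R} := msum coupling_atom n.

Lemma couplingE A : coupling A = (\sum_(i < n) (om i)%:E * \d_((y i, z i) : T) A)%E.
Proof.
rewrite /coupling /msum /=; apply: eq_bigr => i _.
by rewrite /coupling_atom valK.
Qed.

Lemma coupling_setT : coupling setT = 1%E.
Proof.
rewrite couplingE; under eq_bigr do rewrite diracT mule1.
by rewrite sumEFin om1.
Qed.

Lemma coupling_plan :
  is_transport_plan (@atomic_measure R d n om y) (@atomic_measure R d n om z) coupling.
Proof.
move=> A mA; rewrite /pushforward /atomic_measure !couplingE.
split; apply: eq_bigr => i _; rewrite !diracE; congr (_ * (_%:R)%:E)%E; congr nat_of_bool;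
  by apply/idP/idP; rewrite !inE.
Qed.

Import HBNNSimple.

(** The integral is the supremum over simple functions below g. These are measurable, so each of
    their integrals is a weighted sum of values at the atoms. *)
Lemma ge0_integral_coupling_le (g : T -> \bar R) (M : R) : (forall t, (0 <= g t)%E) ->
  (forall i, (g (y i, z i) <= M%:E)%E) -> (\int[coupling]_t g t <= M%:E)%E.
Proof.
move=> g0 gM; rewrite ge0_integralTE //; apply: ge_ereal_sup => _ [h /= hg <-].
have -> : sintegral coupling h = (\int[coupling]_t (h t)%:E)%E.
  by rewrite integral_nnsfun // patch_setT.
rewrite /coupling ge0_integral_measure_sum //; last 2 first.
- by move=> t _; rewrite lee_fin.
- exact/measurable_EFinP.
have -> : M%:E = (\sum_(i < n) (om i * M)%:E)%E.
  by rewrite sumEFin -mulr_suml om1 mul1r.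
apply: lee_sum => i _; rewrite /coupling_atom valK ge0_integral_mscale //=; last 2 first.
- exact/measurable_EFinP.
- by move=> t _; rewrite lee_fin.
rewrite integral_dirac //; last exact/measurable_EFinP.
rewrite diracT mul1e EFinM lee_pmul2l ?lte_fin //.
exact: le_trans (hg _) (gM i).
Qed.

Lemma measurable_point (v : borel_rV R d) : measurable [set v]%classic.
Proof.
rewrite -[X in measurable X]setCK; apply: measurableC; apply: sub_sigma_algebra => /=.
rewrite openC; exact: (@accessible_closed_set1 'rV[R]_d (hausdorff_accessible (@norm_hausdorff R 'rV[R]_d)) v).
Qed.

Lemma Lnorm_coupling_le (f : T -> R) (p : \bar R) (M : R) : (1 <= p)%E -> 0 <= M ->
  (forall i, `|f (y i, z i)| <= M) -> (Lnorm coupling p (fun t => (f t)%:E) <= M%:E)%E.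
Proof.
move=> p1 M0 fM; rewrite unlock; case: p p1 => [r||//] p1.
  rewrite lee_fin in p1; have r0 : 0 < r by lra.
  have -> : M%:E = ((M `^ r)%:E `^ r^-1)%E.
    by rewrite poweR_EFin -powRrM mulfV ?gt_eqF // powRr1.
  apply: gt0_ler_poweR; rewrite ?invr_ge0 ?(ltW r0) //.
  - by rewrite in_itv /= leey andbT integral_ge0 // => t _; exact: poweR_ge0.
  - by rewrite in_itv /= leey andbT lee_fin powR_ge0.
  apply: ge0_integral_coupling_le => [t|i]; first exact: poweR_ge0.
  rewrite /= lee_fin ge0_ler_powR ?(ltW r0) ?nnegrE //; exact: fM.
(* For p = +oo the norm is an essential supremum, and the complement [N] of the pairs of atoms is a
   null set. *)
rewrite coupling_setT lte_fin ltr01; apply: ereal_inf_lbound.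
pose N := (~` \bigcup_(i in [set: 'I_n]) [set (y i, z i)])%classic : set T.
have mN : measurable N.
  apply: measurableC; apply: fin_bigcup_measurable; first exact: finite_finset.
  move=> i _; rewrite (_ : [set _] = [set y i] `*` [set z i])%classic; last first.
    by apply/seteqP; split => [_ ->//|[u v] /= [-> ->]].
  by apply: measurableX; exact: measurable_point.
exists N; split => //.
  rewrite couplingE big1 // => i _.
  by rewrite diracE memNset ?mule0 // => hN; apply: hN; exists i.
move=> t /= hf; apply/not_notP => tN; apply: hf.
have [i _ ->] : (\bigcup_(i in [set: 'I_n]) [set (y i, z i)])%classic t.
  by apply: contrapT => h; exact: tN.
by rewrite lee_fin; exact: fM.
Qed.

End Coupling.

Lemma shifted_measureE (R : realType) d n (om : 'I_n -> R) (x : 'I_n -> 'rV[R]_d) w :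
  shifted_measure (@atomic_measure R d n om x) w = @atomic_measure R d n om (shifted x w).
Proof.
apply/funext => A; rewrite /shifted_measure /pushforward /atomic_measure.
apply: eq_bigr => i _; rewrite !diracE; congr (_ * (_%:R)%:E)%E; congr nat_of_bool.
Qed.

Lemma wasserstein_shifted_le (R : realType) d n (om : 'I_n -> R) (x : 'I_n -> 'rV[R]_d)
    (a b : 'rV[R]_d) (p : \bar R) (M : R) :
  (forall i, 0 < om i) -> \sum_i om i = 1 -> (1 <= p)%E -> 0 <= M ->
  (forall i, `|sphere_dist (shifted x a i) (shifted x b i)| <= M) ->
  (wasserstein p (shifted_measure (@atomic_measure R d n om x) a)
     (shifted_measure (@atomic_measure R d n om x) b) <= M%:E)%E.
Proof.
move=> om0 om1 p1 M0 hM; rewrite !shifted_measureE.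
apply: le_trans (Lnorm_coupling_le om0 om1 (f := fun t => sphere_dist t.1 t.2) p1 M0 hM).
apply: ereal_inf_lbound; exists (coupling (shifted x a) (shifted x b) om0) => //.
exact: coupling_plan.
Qed.

(** * The program *)

Section Semantics.
Variable R : realType.
Local Notation mem := (nat -> R).

Definition bind_var (env : nat -> nat) v i : nat -> nat := fun u => if u == v then i else env u.

Definition mset (a : nat) (r : R) (m : mem) : mem := fun b => if b == a then r else m b.

(** [exec] stripped of its counters, so that correctness, time and space are treated separately. *)
Fixpoint mexec (c : command) (env : nat -> nat) (m : mem) : mem :=
  match c with
  | Skip => m
  | Const e k => mset (ieval env e) k%:R m
  | Unary o e e1 => mset (ieval env e) (eval_unary o (m (ieval env e1))) m
  | Binary o e e1 e2 =>
      mset (ieval env e) (eval_binary o (m (ieval env e1)) (m (ieval env e2))) m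
  | IfLe e1 e2 c1 c2 =>
      if m (ieval env e1) <= m (ieval env e2) then mexec c1 env m else mexec c2 env m
  | Seq c1 c2 => mexec c2 env (mexec c1 env m)
  | For v e c1 => iteri (ieval env e) (fun i => mexec c1 (bind_var env v i)) m
  end.

Lemma mexec_Seq c1 c2 env m : mexec (Seq c1 c2) env m = mexec c2 env (mexec c1 env m).
Proof. by []. Qed.

Lemma mexec_Skip env m : mexec Skip env m = m. Proof. by []. Qed.

(** A bound computed without the memory: loop lengths depend on the environment only, and a branch
    is charged its costlier side. *)
Fixpoint cost (c : command) (env : nat -> nat) : nat :=
  match c with
  | Skip => 0
  | Const _ _ | Unary _ _ _ | Binary _ _ _ _ => 1
  | IfLe _ _ c1 c2 => (maxn (cost c1 env) (cost c2 env)).+1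
  | Seq c1 c2 => cost c1 env + cost c2 env
  | For v e c1 => \sum_(i < ieval env e) cost c1 (bind_var env v i)
  end%N.

Fixpoint fits (N : nat) (c : command) (env : nat -> nat) : Prop :=
  match c with
  | Skip => True
  | Const e _ => (ieval env e < N)%N
  | Unary _ e e1 => (ieval env e < N)%N /\ (ieval env e1 < N)%N
  | Binary _ e e1 e2 => [/\ (ieval env e < N)%N, (ieval env e1 < N)%N & (ieval env e2 < N)%N]
  | IfLe e1 e2 c1 c2 => [/\ (ieval env e1 < N)%N, (ieval env e2 < N)%N,
                           fits N c1 env & fits N c2 env]
  | Seq c1 c2 => fits N c1 env /\ fits N c2 env
  | For v e c1 => forall i, (i < ieval env e)%N -> fits N c1 (bind_var env v i)
  end.

Fixpoint writes (c : command) (env : nat -> nat) (b : nat) : Prop :=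
  match c with
  | Skip => False
  | Const e _ | Unary _ e _ | Binary _ e _ _ => b = ieval env e
  | IfLe _ _ c1 c2 => writes c1 env b \/ writes c2 env b
  | Seq c1 c2 => writes c1 env b \/ writes c2 env b
  | For v e c1 => exists2 i, (i < ieval env e)%N & writes c1 (bind_var env v i) b
  end.

Lemma memory_exec c env (s : state R) : memory (exec c env s) = mexec c env (memory s).
Proof.
elim: c env s => //= [e1 e2 c1 IH1 c2 IH2|c1 IH1 c2 IH2|v e c IH] env s.
- by case: ifP => _; rewrite ?IH1 ?IH2.
- by rewrite IH2 IH1.
by elim: (ieval env e) => //= k <-; rewrite IH.
Qed.

Lemma time_exec c env (s : state R) : (time_used (exec c env s) <= time_used s + cost c env)%N.
Proof.
elim: c env s => /= [|e k|o e e1|o e e1 e2|e1 e2 c1 IH1 c2 IH2|c1 IH1 c2 IH2|v e c IH] env s; rewrite ?addn1 ?addn0 //.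
- by case: ifP => _; [apply: leq_trans (IH1 _ _) _|apply: leq_trans (IH2 _ _) _];
    rewrite /= addSnnS leq_add2l ltnS ?leq_maxl ?leq_maxr.
- by apply: leq_trans (IH2 _ _) _; rewrite addnA leq_add2r.
elim: (ieval env e) => [|k IHk] /=; first by rewrite big_ord0 addn0.
by rewrite big_ord_recr /= addnA; apply: leq_trans (IH _ _) _; rewrite leq_add2r.
Qed.

Lemma space_exec N c env (s : state R) : fits N c env ->
  (space_used (exec c env s) <= maxn (space_used s) N)%N.
Proof.
elim: c env s => /= [|e k|o e e1|o e e1 e2|e1 e2 c1 IH1 c2 IH2|c1 IH1 c2 IH2|v e c IH] env s.
- by move=> _; exact: leq_maxl.
- by move=> h; rewrite geq_max leq_maxl andbT (leq_trans h) // leq_maxr.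
- by move=> [h1 h2]; rewrite !geq_max leq_maxl andbT (leq_trans h1) ?(leq_trans h2) // leq_maxr.
- by move=> [h1 h2 h3]; rewrite !geq_max leq_maxl andbT (leq_trans h1) ?(leq_trans h2) ?(leq_trans h3) // leq_maxr.
- move=> [h1 h2 h3 h4]; case: ifP => _; [apply: leq_trans (IH1 _ _ h3) _|apply: leq_trans (IH2 _ _ h4) _];
    by rewrite /= !geq_max leq_maxl !leq_maxr andbT (leq_trans h1) ?(leq_trans h2) // leq_maxr.
- by move=> [h1 h2]; apply: leq_trans (IH2 _ _ h2) _; rewrite geq_max leq_maxr andbT; exact: IH1.
elim: (ieval env e) => [|k IHk] h /=; first exact: leq_maxl.
apply: leq_trans (IH _ _ (h k (ltnSn k))) _; rewrite geq_max leq_maxr andbT.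
by apply: IHk => i ik; apply: h; exact: ltnW.
Qed.

Lemma mexec_frame c env (m : mem) b : ~ writes c env b -> mexec c env m b = m b.
Proof.
elim: c env m => //= [e k|o e e1|o e e1 e2|e1 e2 c1 IH1 c2 IH2|c1 IH1 c2 IH2|v e c IH] env m.
- by rewrite /mset; case: eqP.
- by rewrite /mset; case: eqP.
- by rewrite /mset; case: eqP.
- by move=> h; case: ifP => _; [apply: IH1|apply: IH2] => h'; apply: h; [left|right].
- by move=> h; rewrite IH2 ?IH1 // => h'; apply: h; [left|right].
elim: (ieval env e) => [//|k IHk] h /=; rewrite IH ?IHk // => [[i ik hi]|hk]; apply: h.
  by exists i => //; exact: ltnW.
by exists k.
Qed.

Lemma for_inv (I : nat -> mem -> Prop) v e c env m : I 0%N m ->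
  (forall i m', (i < ieval env e)%N -> I i m' -> I i.+1 (mexec c (bind_var env v i) m')) ->
  I (ieval env e) (mexec (For v e c) env m).
Proof.
move=> I0 IS /=.
suff : forall k, (k <= ieval env e)%N -> I k (iteri k (fun i => mexec c (bind_var env v i)) m).
  by apply.
by elim=> //= k IHk ke; apply: IS => //; apply: IHk; exact: ltnW.
Qed.

(* A loop whose [i]-th pass changes, up to the scratch cell [t], only the cells in [T i], and
   reads nothing that the other passes change. *)
Lemma for_map (t : nat) (T : nat -> nat -> bool) (F : nat -> nat -> mem -> R) v e c env m :
  (forall i m' b, (i < ieval env e)%N -> b != t ->
     mexec c (bind_var env v i) m' b = if T i b then F i b m' else m' b) ->
  (forall i m' b, (i < ieval env e)%N -> T i b ->
     (forall b', b' != t -> (forall k, (k < i)%N -> ~~ T k b') -> m' b' = m b') -> F i b m' = F i b m) ->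
  (forall i k b, (i < ieval env e)%N -> (k < i)%N -> T i b -> ~~ T k b) ->
  forall i b, (i < ieval env e)%N -> b != t -> T i b -> mexec (For v e c) env m b = F i b m.
Proof.
move=> hc hF hT.
pose I k (m' : mem) := (forall b, b != t -> (forall i, (i < k)%N -> ~~ T i b) -> m' b = m b) /\
  (forall i b, (i < k)%N -> b != t -> T i b -> m' b = F i b m).
suff [_ h] : I (ieval env e) (mexec (For v e c) env m) by [].
apply: for_inv; first by split.
move=> i m' ie [h1 h2]; split=> [b bt hb|k b].
  rewrite hc // (negbTE (hb i (ltnSn i))) h1 // => k ki; apply: hb; exact: ltnW.
rewrite ltnS leq_eqVlt => /orP[/eqP->|ki] bt Tb; rewrite hc //.
  by rewrite Tb (hF i m' b ie Tb h1).
case: ifP => Tib; last exact: h2.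
by have := hT i k b ie ki Tib; rewrite Tb.
Qed.

Definition dot_command acc t v a1 a2 :=
  Seq (Const acc 0) (For v (IVar 0) (Seq (Binary OpMul t a1 a2) (Binary OpAdd acc acc t))).

(** The operands must avoid the accumulator and the scratch cell; nothing is claimed about the
    content of the scratch cell. *)
Lemma mexec_dot (acc t a1 a2 : address) v env (m : mem) A Tm (A1 A2 : nat -> nat) :
  v != 0%N ->
  ieval env acc = A -> (forall i, ieval (bind_var env v i) acc = A) ->
  (forall i, ieval (bind_var env v i) t = Tm) -> A != Tm ->
  (forall i, ieval (bind_var env v i) a1 = A1 i) -> (forall i, ieval (bind_var env v i) a2 = A2 i) ->
  (forall i, (i < env 0)%N -> [&& A1 i != A, A1 i != Tm, A2 i != A & A2 i != Tm]) ->
  forall b, b != Tm -> mexec (dot_command acc t v a1 a2) env m b =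
    if b == A then \sum_(i < env 0%N) m (A1 i) * m (A2 i) else m b.
Proof.
move=> v0 hA0 hA hT AT h1 h2 hn b bT.
pose I k (m' : mem) := forall b, b != Tm ->
  m' b = if b == A then \sum_(i < k) m (A1 i) * m (A2 i) else m b.
suff : I (env 0%N) (mexec (dot_command acc t v a1 a2) env m) by apply.
rewrite (_ : mexec (dot_command acc t v a1 a2) env m =
  mexec (For v (IVar 0) (Seq (Binary OpMul t a1 a2) (Binary OpAdd acc acc t))) env
    (mset (ieval env acc) 0%:R m)) //.
apply: (@for_inv I v (IVar 0)) => [b' b'T|i m' ie Im' b' b'T].
  by rewrite /mset hA0 big_ord0.
rewrite /= in ie; have /and4P[n1 n2 n3 n4] := hn i ie.
rewrite /= hA hT h1 h2 /mset /=; have [b'A|b'A] := eqVneq b' A; last first.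
  by rewrite (negbTE b'T) Im' // (negbTE b'A).
rewrite (negbTE AT) !eqxx !Im' // eqxx (negbTE n1) (negbTE n3) big_ord_recr //.
Qed.

End Semantics.

(** * Rank-one updates of the inverse *)

Section ShermanMorrison.
Variables (R : realType) (d n : nat) (om : nat -> R) (y : nat -> 'rV[R]_d).

Definition partial_hessian k : 'M[R]_d := 1%:M - \sum_(i < k) om i *: ((y i)^T *m y i).

(** The Sherman-Morrison formula; as B is symmetric, B y^T y B is g^T g for the single row g = y
    B. *)
Fixpoint inverse_update k : 'M[R]_d :=
  if k is k'.+1 then
    let B := inverse_update k' in let g := y k' *m B in
    B + (om k' / (1 - om k' * dot (y k') g)) *: (g^T *m g)
  else 1%:M.

Lemma inverse_update_tr k : (inverse_update k)^T = inverse_update k.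
Proof.
elim: k => [|k IH] /=; first exact: trmx1.
by rewrite linearD /= IH linearZ /= trmx_mul trmxK.
Qed.

Lemma inverse_updateP : 
  (forall k (v : 'rV_d), (k <= n)%N -> v *m partial_hessian k = 0 -> v = 0) ->
  forall k, (k <= n)%N -> inverse_update k *m partial_hessian k = 1%:M.
Proof.
move=> inj; elim=> [|k IH] kn; first by rewrite /partial_hessian big_ord0 subr0 mulmx1.
have {}IH := IH (ltnW kn).
rewrite /= /partial_hessian big_ord_recr /= opprD addrA -/(partial_hessian k).
set B := inverse_update k in IH *; set u := y k; set w := om k; set g := u *m B.
have gA : g *m partial_hessian k = u by rewrite -mulmxA IH mulmx1.
have gT : g^T = B *m u^T by rewrite trmx_mul inverse_update_tr.
have guT : g *m u^T = (dot u g)%:M by rewrite mulmx_trE dotC.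
(* If the denominator vanished, g would be in the kernel of the next partial sum, hence g = 0, then
   u = g times the current sum = 0, and the denominator would be 1. *)
have den : 1 - w * dot u g != 0.
  apply/eqP => den0.
  have gA' : g *m partial_hessian k.+1 = 0.
    rewrite /partial_hessian big_ord_recr /= opprD addrA -/(partial_hessian k) mulmxDr gA.
    rewrite mulmxN -scalemxAr mulmxA guT mul_scalar_mx scalerA -[u in u - _]scale1r -scalerBl.
    by rewrite den0 scale0r.
  have g0 := inj _ _ kn gA'.
  have u0 : u = 0 by rewrite -gA g0 mul0mx.
  by move: den0; rewrite u0 dot0l mulr0 subr0 => /eqP; rewrite oner_eq0.
have E1 : B *m (partial_hessian k - w *: (u^T *m u)) = 1%:M - w *: (g^T *m u).
  by rewrite mulmxBr IH -scalemxAr mulmxA -gT.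
have E2 : g *m (partial_hessian k - w *: (u^T *m u)) = (1 - w * dot u g) *: u.
  by rewrite mulmxBr gA -scalemxAr mulmxA guT mul_scalar_mx scalerA scalerBl scale1r.
rewrite mulmxDl E1 -scalemxAl -mulmxA E2 -scalemxAr scalerA divfK // ?den //.
by rewrite subrK.
Qed.

End ShermanMorrison.

Definition vD := IVar 0.
Definition vN := IVar 1.
Definition vI := IVar 2.
Definition vJ := IVar 3.
Definition vL := IVar 4.

(* Variable 2 counts the atoms, 3 and 4 count coordinates.  Behind the input cells come nine
   scalars [eS], a [d * d] matrix [eB], and three vectors [eY], [eG], [eM].  Scalar 0 is |w|^2,
   1 and 2 are the constants 1 and 2, 3 is 1 - |w|^2; 4 is the scratch cell of all loops and the
   others are temporary. *)
Definition eK := IAdd (IAdd vN (IMul vN vD)) vD.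
Definition eS k := IAdd eK (INum k).
Definition eW j := IAdd (IAdd vN (IMul vN vD)) j.
Definition eX j := IAdd vN (IAdd (IMul vI vD) j).
Definition eB j l := IAdd (IAdd eK (INum 9)) (IAdd (IMul j vD) l).
Definition eK3 := IAdd (IAdd eK (INum 9)) (IMul vD vD).
Definition eY j := IAdd eK3 j.
Definition eG j := IAdd (IAdd eK3 vD) j.
Definition eM j := IAdd (IAdd (IAdd eK3 vD) vD) j.

Definition seqc := foldr Seq Skip.

Definition init_scalars := seqc [::
  Const (eS 1) 1; Const (eS 2) 2; dot_command (eS 0) (eS 4) 3 (eW vJ) (eW vJ);
  Binary OpSub (eS 3) (eS 1) (eS 0)].

Definition init_moment := For 3 vD (Const (eM vJ) 0).
Definition init_zero := For 3 vD (For 4 vD (Const (eB vJ vL) 0)).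
Definition init_diag := For 3 vD (Const (eB vJ vJ) 1).

Definition atom_scale := seqc [::
  dot_command (eS 7) (eS 4) 3 (eW vJ) (eX vJ); Binary OpMul (eS 7) (eS 2) (eS 7);
  Binary OpSub (eS 5) (eS 1) (eS 7); Binary OpAdd (eS 5) (eS 5) (eS 0);
  Binary OpDiv (eS 6) (eS 3) (eS 5)].

Definition atom_shift := For 3 vD (seqc [::
  Binary OpSub (eS 4) (eX vJ) (eW vJ); Binary OpMul (eS 4) (eS 6) (eS 4);
  Binary OpSub (eY vJ) (eS 4) (eW vJ)]).

(** The weight of the i-th atom is stored in cell i, so [vI] used as an address reads it. *)
Definition atom_moment := For 3 vD (seqc [::
  Binary OpMul (eS 4) vI (eY vJ); Binary OpAdd (eM vJ) (eM vJ) (eS 4)]).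

Definition row_product (v : address -> address) :=
  For 3 vD (dot_command (eG vJ) (eS 4) 4 (v vL) (eB vL vJ)).

Definition update_scale := seqc [::
  dot_command (eS 7) (eS 4) 3 (eY vJ) (eG vJ); Binary OpMul (eS 7) vI (eS 7);
  Binary OpSub (eS 7) (eS 1) (eS 7); Binary OpDiv (eS 8) vI (eS 7)].

Definition rank_one_update := For 3 vD (For 4 vD (seqc [::
  Binary OpMul (eS 4) (eG vJ) (eG vL); Binary OpMul (eS 4) (eS 8) (eS 4);
  Binary OpAdd (eB vJ vL) (eB vJ vL) (eS 4)])).

Definition atom_body := seqc [:: atom_scale; atom_shift; atom_moment; row_product eY;
  update_scale; rank_one_update].

(* For [g = 0] the last division is [0 / 0 = 0], which gives the right point [0]. *)
Definition polar_scale := seqc [::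
  dot_command (eS 7) (eS 4) 3 (eG vJ) (eG vJ); Unary OpSqrt (eS 7) (eS 7);
  Unary OpExp (eS 8) (eS 7); Binary OpSub (eS 5) (eS 8) (eS 1);
  Binary OpAdd (eS 8) (eS 8) (eS 1); Binary OpDiv (eS 5) (eS 5) (eS 8);
  Binary OpDiv (eS 6) (eS 5) (eS 7)].

Definition polar_vector := For 3 vD (Binary OpMul (eY vJ) (eS 6) (eG vJ)).

(** For z in [eY], scalar 5 becomes the denominator 1 + 2 <w,z> + |w|^2 |z|^2 of [shift (- w) z],
    and scalar 7 the coefficient 1 + |z|^2 + 2 <w,z> of w. *)
Definition shift_scale := seqc [::
  dot_command (eS 7) (eS 4) 3 (eY vJ) (eY vJ); dot_command (eS 8) (eS 4) 3 (eW vJ) (eY vJ);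
  Binary OpMul (eS 8) (eS 2) (eS 8); Binary OpMul (eS 5) (eS 0) (eS 7);
  Binary OpAdd (eS 5) (eS 5) (eS 8); Binary OpAdd (eS 5) (eS 1) (eS 5);
  Binary OpAdd (eS 7) (eS 1) (eS 7); Binary OpAdd (eS 7) (eS 7) (eS 8)].

Definition shift_iterate := For 3 vD (seqc [::
  Binary OpMul (eW vJ) (eS 7) (eW vJ); Binary OpMul (eS 4) (eS 3) (eY vJ);
  Binary OpAdd (eW vJ) (eW vJ) (eS 4); Binary OpDiv (eW vJ) (eW vJ) (eS 5)]).

Definition newton_program := seqc [:: init_scalars; init_moment; init_zero; init_diag;
  For 2 vN atom_body; row_product eM; polar_scale; polar_vector; shift_scale; shift_iterate].

(** * Correctness and cost of the program *)

Section ProgramCorrect.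
Variables (R : realType) (d n : nat).
Local Notation mem := (nat -> R).
Implicit Types m : mem.
Local Open Scope nat_scope.

Definition aK := n + n * d + d.
Definition aS k := aK + k.
Definition aW j := n + n * d + j.
Definition aX i j := n + (i * d + j).
Definition aB j l := aK + 9 + (j * d + l).
Definition aK3 := aK + 9 + d * d.
Definition aY j := aK3 + j.
Definition aG j := aK3 + d + j.
Definition aM j := aK3 + d + d + j.

Local Notation env := (size_env d n).
Local Notation envi i := (bind_var env 2 i).

Lemma pair_index_lt j l k : j < k -> l < d -> j * d + l < k * d.
Proof.
move=> jk ld; have : j.+1 * d <= k * d by rewrite leq_mul2r jk orbT.
by rewrite mulSn; lia.
Qed.

Lemma pair_index_inj j l j' l' : l < d -> l' < d -> j * d + l = j' * d + l' -> j = j' /\ l = l'.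
Proof.
move=> ld l'd e; have jj : j = j'.
  by have := congr1 (fun k => k %/ d) e; rewrite !divnMDl ?(leq_ltn_trans _ ld) // !divn_small // !addn0.
by split=> //; move: e; rewrite jj; lia.
Qed.

Ltac unfold_addr := rewrite ?/aM ?/aG ?/aY ?/aB ?/aS ?/aW ?/aX ?/aK3 ?/aK.
Lemma mset_eq a r m : mset a r m a = r. Proof. by rewrite /mset eqxx. Qed.
Lemma mset_neq a r m b : b != a -> mset a r m b = m b. Proof. by rewrite /mset => /negbTE ->. Qed.

Local Close Scope nat_scope.

Lemma init_scalarsP m : let m' := mexec init_scalars env m in
  [/\ m' (aS 0) = \sum_(j < d) m (aW j) * m (aW j), m' (aS 1) = 1, m' (aS 2) = 2,
      m' (aS 3) = 1 - \sum_(j < d) m (aW j) * m (aW j) &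
      forall b, (b < aK)%N -> m' b = m b].
Proof.
pose m1 := mset (aS 2) 2 (mset (aS 1) 1 m).
pose m2 := mexec (dot_command (eS 0) (eS 4) 3 (eW vJ) (eW vJ)) env m1.
have E : mexec init_scalars env m = mset (aS 3) (m2 (aS 1) - m2 (aS 0)) m2 by [].
have h b : b != aS 4 -> m2 b = if b == aS 0 then \sum_(j < d) m1 (aW j) * m1 (aW j) else m1 b.
  apply: (@mexec_dot R (eS 0) (eS 4) (eW vJ) (eW vJ) 3 env m1 (aS 0) (aS 4) aW aW) => //.
  by rewrite /aS eqn_add2l.
  by move=> i; rewrite -[X in (_ < X)%N]/d => id; apply/and4P; split; unfold_addr; lia.
have hw : \sum_(j < d) m1 (aW j) * m1 (aW j) = \sum_(j < d) m (aW j) * m (aW j).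
  apply: eq_bigr => j _; have jd := ltn_ord j.
  by rewrite /m1 !mset_neq //; rewrite /aW /aS /aK; lia.
rewrite E; split.
- by rewrite mset_neq ?h ?hw // /aS eqn_add2l.
- by rewrite mset_neq ?h /aS ?eqn_add2l //= /m1 /mset !eqn_add2l.
- by rewrite mset_neq ?h /aS ?eqn_add2l //= /m1 /mset !eqn_add2l.
- rewrite mset_eq -hw; congr (_ - _); first by rewrite h /aS ?eqn_add2l //= /m1 /mset !eqn_add2l.
  by rewrite h ?eqxx // /aS eqn_add2l.
move=> b bK; rewrite mset_neq; last by rewrite /aS; lia.
have b0 : (b == aS 0) = false by apply/eqP; rewrite /aS; lia.
rewrite h ?b0; last by rewrite /aS; lia.
by rewrite /m1 !mset_neq // /aS; lia.
Qed.

(** All passes write the same constant, so the order and repetition of the target cells are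
    immaterial. *)
Lemma for_const (c : command) (T : nat -> nat) (k : R) v m envv :
  envv 0%N = d ->
  (forall i m' b, (i < d)%N -> mexec c (bind_var envv v i) m' b = if b == T i then k else m' b) ->
  forall b, mexec (For v vD c) envv m b = if [exists i : 'I_d, b == T i] then k else m b.
Proof.
move=> ed hc b.
pose I k' (m' : mem) := m' b = if [exists i : 'I_d, (i < k')%N && (b == T i)] then k else m b.
suff h : I d (mexec (For v vD c) envv m).
  rewrite h; congr (if _ then _ else _).
  by apply: eq_existsb => i; rewrite ltn_ord.
have := @for_inv R I v vD c envv m; rewrite /= ed; apply.
  by rewrite /I; case: existsP => // -[i /=].
move=> i m' id Im'; rewrite /I hc //; case: eqP => [bT|bT].
  case: existsP => // hn; case: hn; exists (Ordinal id).
  by rewrite ltnSn bT eqxx.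
rewrite Im'; congr (if _ then _ else _).
apply/existsP/existsP => -[j /andP[ji /eqP bj]]; exists j; rewrite bj eqxx andbT.
  exact: ltnW.
move: ji; rewrite ltnS leq_eqVlt => /orP[/eqP ji|//].
by case: bT; rewrite bj ji.
Qed.

Lemma init_matrixP m j l : (j < d)%N -> (l < d)%N ->
  mexec init_diag env (mexec init_zero env m) (aB j l) = (j == l)%:R.
Proof.
move=> jd ld.
rewrite (@for_const _ (fun i => aB i i) 1 3) //.
case: existsP => [[i /eqP e]|h].
  have [-> ->] : j = i /\ l = i by apply: pair_index_inj => //; move: e; rewrite /aB; lia.
  by rewrite eqxx.
have -> : (j == l) = false.
  by apply/eqP => e; apply: h; exists (Ordinal jd) => /=; rewrite -e.
have row i m' b : (i < d)%N -> mexec (For 4 vD (Const (eB vJ vL) 0)) (bind_var env 3 i) m' b =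
    if [exists l' : 'I_d, b == aB i l'] then 0 else m' b.
  move=> id; exact: (@for_const _ (aB i) 0 4).
pose I k' (m' : mem) := forall j l, (j < k')%N -> (l < d)%N -> m' (aB j l) = 0.
have := @for_inv R I 3 vD (For 4 vD (Const (eB vJ vL) 0)) env m; rewrite {1 2}/I /=.
move=> h'; apply: (h' _ _ j l jd ld) => // i m' id Im' j' l' j'i l'd.
rewrite -[iteri _ _ _]/(mexec (For 4 vD (Const (eB vJ vL) 0)) (bind_var env 3 i) m') row //.
case: existsP => // hn; apply: Im' => //.
move: j'i; rewrite ltnS leq_eqVlt => /orP[/eqP ji|//].
by case: hn; exists (Ordinal l'd); rewrite ji.
Qed.

Lemma atom_scaleP m i : (i < n)%N ->
  mexec atom_scale (envi i) m (aS 6) =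
  m (aS 3) / (m (aS 1) - m (aS 2) * (\sum_(j < d) m (aW j) * m (aX i j)) + m (aS 0)).
Proof.
move=> iN; pose m1 := mexec (dot_command (eS 7) (eS 4) 3 (eW vJ) (eX vJ)) (envi i) m.
have h b : b != aS 4 -> m1 b = if b == aS 7 then \sum_(j < d) m (aW j) * m (aX i j) else m b.
  apply: (@mexec_dot R (eS 7) (eS 4) (eW vJ) (eX vJ) 3 (envi i) m (aS 7) (aS 4) aW (aX i)) => //.
  by rewrite /aS eqn_add2l.
  move=> j; rewrite -[X in (_ < X)%N]/d => jd; have := pair_index_lt iN jd.
  by move=> ?; apply/and4P; split; unfold_addr; lia.
have -> : mexec atom_scale (envi i) m = 
  let m2 := mset (aS 7) (m1 (aS 2) * m1 (aS 7)) m1 in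
  let m3 := mset (aS 5) (m2 (aS 1) - m2 (aS 7)) m2 in
  let m4 := mset (aS 5) (m3 (aS 5) + m3 (aS 0)) m3 in
  mset (aS 6) (m4 (aS 3) / m4 (aS 5)) m4 by [].
cbv zeta.
rewrite /mset /aS !eqn_add2l /= -/(aS 3) -/(aS 1) -/(aS 7) -/(aS 2) -/(aS 0).
by rewrite !h /aS ?eqn_add2l.
Qed.

Ltac mem_simpl := repeat (rewrite mset_eq || (rewrite mset_neq; [| first [assumption | unfold_addr; lia]])).

Lemma atom_shiftP m i j : (i < n)%N -> (j < d)%N ->
  mexec atom_shift (envi i) m (aY j) = m (aS 6) * (m (aX i j) - m (aW j)) - m (aW j).
Proof.
move=> iN jd.
apply: (@for_map R (aS 4) (fun j b => b == aY j)
  (fun j b m => m (aS 6) * (m (aX i j) - m (aW j)) - m (aW j))) => //; last by unfold_addr; lia.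
- move=> k m' b; rewrite -[X in (_ < X)%N]/d => kd bt; have := pair_index_lt iN kd => ik.
  rewrite (_ : mexec _ _ m' =
    let m1 := mset (aS 4) (m' (aX i k) - m' (aW k)) m' in
    let m2 := mset (aS 4) (m1 (aS 6) * m1 (aS 4)) m1 in
    mset (aY k) (m2 (aS 4) - m2 (aW k)) m2) //; cbv zeta.
  by have [->|bY] := eqVneq b (aY k); mem_simpl.
- move=> k m' b; rewrite -[X in (_ < X)%N]/d => kd _ H; have := pair_index_lt iN kd => ik.
  by rewrite !H //; intros; unfold_addr; lia.
by move=> k k' b _ kk /eqP ->; unfold_addr; lia.
Qed.

Lemma atom_momentP m i j : (i < n)%N -> (j < d)%N ->
  mexec atom_moment (envi i) m (aM j) = m (aM j) + m i * m (aY j).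
Proof.
move=> iN jd.
apply: (@for_map R (aS 4) (fun j b => b == aM j)
  (fun j b m => m (aM j) + m i * m (aY j))) => //; last by unfold_addr; lia.
- move=> k m' b; rewrite -[X in (_ < X)%N]/d => kd bt.
  rewrite (_ : mexec _ _ m' =
    let m1 := mset (aS 4) (m' i * m' (aY k)) m' in
    mset (aM k) (m1 (aM k) + m1 (aS 4)) m1) //; cbv zeta.
  by have [->|bY] := eqVneq b (aM k); mem_simpl.
- move=> k m' b; rewrite -[X in (_ < X)%N]/d => kd _ H.
  by rewrite !H //; intros; unfold_addr; lia.
by move=> k k' b _ kk /eqP ->; unfold_addr; lia.
Qed.

(** The operand must avoid the cells of [eG] that are being written: [eY] lies before them and [eM]
    behind. *)
Lemma row_productP m envv (v : address -> address) (V : nat -> nat) j :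
  envv 0%N = d -> envv 1%N = n ->
  (forall i l, ieval (bind_var (bind_var envv 3 i) 4 l) (v vL) = V l) ->
  (forall l, (l < d)%N -> (aK3 <= V l < aG 0)%N \/ (aG d <= V l)%N) -> (j < d)%N ->
  mexec (row_product v) envv m (aG j) = \sum_(l < d) m (V l) * m (aB l j).
Proof.
move=> e0 e1 hV hR jd.
apply: (@for_map R (aS 4) (fun j b => b == aG j)
  (fun j b m => \sum_(l < d) m (V l) * m (aB l j))); rewrite -?[ieval envv vD]/(envv 0%N) ?e0 //; last by unfold_addr; lia.
- move=> k m' b kd bt.
  rewrite (@mexec_dot R (eG vJ) (eS 4) (v vL) (eB vL vJ) 4 (bind_var envv 3 k) m' (aG k) (aS 4) V (aB^~ k)) //=.
  + by rewrite /bind_var /= e0.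
  + by rewrite /bind_var /= e0 e1.
  + by move=> l; rewrite /bind_var /= e0 e1.
  + by move=> l; rewrite /bind_var /= e0 e1.
  + by unfold_addr; lia.
  + by move=> l; rewrite /bind_var /= e0 e1.
  rewrite {1}/bind_var /= e0 => l ld; have := pair_index_lt ld kd; have := hR l ld.
  by unfold_addr => h1 h2; apply/and4P; split; lia.
- move=> k m' b kd _ H; apply: eq_bigr => l _; have ld := ltn_ord l.
  have := pair_index_lt ld kd; have := hR l ld; move: H; unfold_addr => H h1 h2.
  by rewrite !H //; intros; lia.
by move=> k k' b _ kk /eqP ->; unfold_addr; lia.
Qed.

Lemma update_scaleP m i : (i < n)%N ->
  mexec update_scale (envi i) m (aS 8) =
  m i / (m (aS 1) - m i * \sum_(j < d) m (aY j) * m (aG j)).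
Proof.
move=> iN; pose m1 := mexec (dot_command (eS 7) (eS 4) 3 (eY vJ) (eG vJ)) (envi i) m.
have h b : b != aS 4 -> m1 b = if b == aS 7 then \sum_(j < d) m (aY j) * m (aG j) else m b.
  apply: (@mexec_dot R (eS 7) (eS 4) (eY vJ) (eG vJ) 3 (envi i) m (aS 7) (aS 4) aY aG) => //.
  by rewrite /aS eqn_add2l.
  by move=> j; rewrite -[X in (_ < X)%N]/d => jd; apply/and4P; split; unfold_addr; lia.
rewrite (_ : mexec update_scale (envi i) m =
  let m2 := mset (aS 7) (m1 i * m1 (aS 7)) m1 in
  let m3 := mset (aS 7) (m2 (aS 1) - m2 (aS 7)) m2 in
  mset (aS 8) (m3 i / m3 (aS 7)) m3) //; cbv zeta.
mem_simpl; rewrite !h ?eqxx; try by unfold_addr; lia.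
have -> : (i == aS 7) = false by unfold_addr; lia.
by have -> : (aS 1 == aS 7) = false by unfold_addr; lia.
Qed.

(** The update can be made in place, since each entry is computed from its own old value and cells
    outside the matrix. Rows are disjoint intervals of addresses, so both loops are instances of
    [for_map]. *)
Lemma rank_one_updateP m i j l : (i < n)%N -> (j < d)%N -> (l < d)%N ->
  mexec rank_one_update (envi i) m (aB j l) = m (aB j l) + m (aS 8) * (m (aG j) * m (aG l)).
Proof.
move=> iN jd ld.
have inner k m' b : (k < d)%N -> b != aS 4 ->
  mexec (For 4 vD (seqc [:: Binary OpMul (eS 4) (eG vJ) (eG vL); Binary OpMul (eS 4) (eS 8) (eS 4);
    Binary OpAdd (eB vJ vL) (eB vJ vL) (eS 4)])) (bind_var (envi i) 3 k) m' b =
  if (aB k 0 <= b < aB k d)%N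
  then m' b + m' (aS 8) * (m' (aG k) * m' (aG (b - aB k 0))) else m' b.
  move=> kd bt; case: ifP => [/andP[b1 b2]|hb]; last first.
    rewrite mexec_frame // => -[l']; rewrite -[X in (_ < X)%N]/d => l'd h.
    have {h} : b = aS 4 \/ b = aS 4 \/ b = aB k l' \/ False := h.
    by move=> [H|[H|[H|//]]]; move: bt hb H l'd; unfold_addr; lia.
  have [l' [l'd bE]] : exists l', (l' < d)%N /\ b = aB k l'.
    by exists (b - aB k 0)%N; move: b1 b2; unfold_addr => ? ?; split; lia.
  have -> : (b - aB k 0)%N = l' by rewrite bE; unfold_addr; lia.
  apply: (@for_map R (aS 4) (fun l b => b == aB k l)
    (fun l b m => m b + m (aS 8) * (m (aG k) * m (aG l)))) => //; last by rewrite bE.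
  - move=> q m2 b'; rewrite -[X in (_ < X)%N]/d => qd b't; have := pair_index_lt kd qd => kq.
    rewrite (_ : mexec _ _ m2 =
      let m3 := mset (aS 4) (m2 (aG k) * m2 (aG q)) m2 in
      let m4 := mset (aS 4) (m3 (aS 8) * m3 (aS 4)) m3 in
      mset (aB k q) (m4 (aB k q) + m4 (aS 4)) m4) //; cbv zeta.
    by have [->|bY] := eqVneq b' (aB k q); mem_simpl.
  - move=> q m2 b'; rewrite -[X in (_ < X)%N]/d => qd /eqP -> H; have := pair_index_lt kd qd => kq.
    have kk q' : (q' < q)%N -> (k * d + q' < d * d)%N by move=> q'q; lia.
    by rewrite !H //; try (unfold_addr; lia); move=> q' q'q; have := kk q' q'q; unfold_addr; lia.
  by move=> q q' b' _ qq /eqP ->; unfold_addr; lia.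
have jl := pair_index_lt jd ld.
have rows k k' : (k' < k)%N -> (k' * d + d <= k * d)%N.
  by move=> kk; have := leq_mul2r d k'.+1 k; rewrite kk orbT mulSn; lia.
rewrite (@for_map R (aS 4) (fun k b => (aB k 0 <= b < aB k d)%N)
  (fun k b m => m b + m (aS 8) * (m (aG k) * m (aG (b - aB k 0)))) 3 vD _ (envi i) m _ _ _ j) //.
- by have -> : (aB j l - aB j 0)%N = l by unfold_addr; lia.
- move=> k m' b; rewrite -[X in (_ < X)%N]/d => kd /andP[b1 b2] H.
  have kk k' : (k' < k)%N -> (k' * d + d <= k * d)%N by exact: rows.
  have kd' : (k * d + d <= d * d)%N by exact: rows.
  rewrite !H //; try (move: b1 b2; unfold_addr; lia);
    by move=> k' k'k; have := kk k' k'k; move: b1 b2; unfold_addr; lia.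
- move=> k k' b _ kk /andP[b1 b2]; have := rows _ _ kk; move: b1 b2; unfold_addr; lia.
- by unfold_addr; lia.
- by unfold_addr; lia.
Qed.


Lemma polar_scaleP m : let g := Num.sqrt (\sum_(j < d) m (aG j) * m (aG j)) in
  mexec polar_scale env m (aS 6) = (expR g - m (aS 1)) / (expR g + m (aS 1)) / g.
Proof.
pose m1 := mexec (dot_command (eS 7) (eS 4) 3 (eG vJ) (eG vJ)) env m.
have h b : b != aS 4 -> m1 b = if b == aS 7 then \sum_(j < d) m (aG j) * m (aG j) else m b.
  apply: (@mexec_dot R (eS 7) (eS 4) (eG vJ) (eG vJ) 3 env m (aS 7) (aS 4) aG aG) => //.
  by rewrite /aS eqn_add2l.
  by move=> j; rewrite -[X in (_ < X)%N]/d => jd; apply/and4P; split; unfold_addr; lia.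
have h1 : m1 (aS 1) = m (aS 1) by rewrite h /aS ?eqn_add2l.
have h7 : m1 (aS 7) = \sum_(j < d) m (aG j) * m (aG j) by rewrite h /aS ?eqn_add2l //= eqxx.
rewrite (_ : mexec polar_scale env m =
  let m2 := mset (aS 7) (Num.sqrt (m1 (aS 7))) m1 in
  let m3 := mset (aS 8) (expR (m2 (aS 7))) m2 in
  let m4 := mset (aS 5) (m3 (aS 8) - m3 (aS 1)) m3 in
  let m5 := mset (aS 8) (m4 (aS 8) + m4 (aS 1)) m4 in
  let m6 := mset (aS 5) (m5 (aS 5) / m5 (aS 8)) m5 in
  mset (aS 6) (m6 (aS 5) / m6 (aS 7)) m6) //; cbv zeta.
by mem_simpl; rewrite h1 h7.
Qed.

Lemma polar_vectorP m j : (j < d)%N ->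
  mexec polar_vector env m (aY j) = m (aS 6) * m (aG j).
Proof.
move=> jd; apply: (@for_map R (aS 4) (fun j b => b == aY j)
  (fun j b m => m (aS 6) * m (aG j))) => //; last by unfold_addr; lia.
- move=> k m' b; rewrite -[X in (_ < X)%N]/d => kd _ H.
  by rewrite !H //; intros; unfold_addr; lia.
by move=> k k' b _ kk /eqP ->; unfold_addr; lia.
Qed.

Lemma shift_scaleP m : let m' := mexec shift_scale env m in
  let zz := \sum_(j < d) m (aY j) * m (aY j) in let wz := \sum_(j < d) m (aW j) * m (aY j) in
  m' (aS 5) = m (aS 1) + (m (aS 0) * zz + m (aS 2) * wz) /\
  m' (aS 7) = m (aS 1) + zz + m (aS 2) * wz.
Proof.
pose m1 := mexec (dot_command (eS 7) (eS 4) 3 (eY vJ) (eY vJ)) env m.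
have h b : b != aS 4 -> m1 b = if b == aS 7 then \sum_(j < d) m (aY j) * m (aY j) else m b.
  apply: (@mexec_dot R (eS 7) (eS 4) (eY vJ) (eY vJ) 3 env m (aS 7) (aS 4) aY aY) => //.
  by rewrite /aS eqn_add2l.
  by move=> j; rewrite -[X in (_ < X)%N]/d => jd; apply/and4P; split; unfold_addr; lia.
pose m2 := mexec (dot_command (eS 8) (eS 4) 3 (eW vJ) (eY vJ)) env m1.
have h2 b : b != aS 4 -> m2 b = if b == aS 8 then \sum_(j < d) m1 (aW j) * m1 (aY j) else m1 b.
  apply: (@mexec_dot R (eS 8) (eS 4) (eW vJ) (eY vJ) 3 env m1 (aS 8) (aS 4) aW aY) => //.
  by rewrite /aS eqn_add2l.
  by move=> j; rewrite -[X in (_ < X)%N]/d => jd; apply/and4P; split; unfold_addr; lia.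
have h1 k : k != 4 -> k != 7 -> k != 8 -> m2 (aS k) = m (aS k).
  move=> k4 k7 k8; rewrite h2 ?h /aS ?eqn_add2l // (negbTE k8) (negbTE k7) //.
have h7 : m2 (aS 7) = \sum_(j < d) m (aY j) * m (aY j).
  by rewrite h2 ?h /aS ?eqn_add2l //= eqxx.
have h8 : m2 (aS 8) = \sum_(j < d) m (aW j) * m (aY j).
  rewrite h2 ?eqxx; last by rewrite /aS ?eqn_add2l.
  apply: eq_bigr => j _; have jd := ltn_ord j.
  have /negbTE n1 : aW j != aS 7 by unfold_addr; lia.
  have /negbTE n2 : aY j != aS 7 by unfold_addr; lia.
  by rewrite !h ?n1 ?n2 //; unfold_addr; lia.
rewrite (_ : mexec shift_scale env m =
  let m3 := mset (aS 8) (m2 (aS 2) * m2 (aS 8)) m2 in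
  let m4 := mset (aS 5) (m3 (aS 0) * m3 (aS 7)) m3 in
  let m5 := mset (aS 5) (m4 (aS 5) + m4 (aS 8)) m4 in
  let m6 := mset (aS 5) (m5 (aS 1) + m5 (aS 5)) m5 in
  let m7 := mset (aS 7) (m6 (aS 1) + m6 (aS 7)) m6 in
  mset (aS 7) (m7 (aS 7) + m7 (aS 8)) m7) //; cbv zeta.
by split; mem_simpl; rewrite h7 h8 !h1.
Qed.

Lemma shift_iterateP m j : (j < d)%N ->
  mexec shift_iterate env m (aW j) = (m (aS 7) * m (aW j) + m (aS 3) * m (aY j)) / m (aS 5).
Proof.
move=> jd; apply: (@for_map R (aS 4) (fun j b => b == aW j)
  (fun j b m => (m (aS 7) * m (aW j) + m (aS 3) * m (aY j)) / m (aS 5))) => //; last by unfold_addr; lia.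
- move=> k m' b; rewrite -[X in (_ < X)%N]/d => kd bt.
  rewrite (_ : mexec _ _ m' =
    let m1 := mset (aW k) (m' (aS 7) * m' (aW k)) m' in
    let m2 := mset (aS 4) (m1 (aS 3) * m1 (aY k)) m1 in
    let m3 := mset (aW k) (m2 (aW k) + m2 (aS 4)) m2 in
    mset (aW k) (m3 (aW k) / m3 (aS 5)) m3) //; cbv zeta.
  by have [->|bY] := eqVneq b (aW k); mem_simpl.
- move=> k m' b; rewrite -[X in (_ < X)%N]/d => kd _ H.
  by rewrite !H //; intros; unfold_addr; lia.
by move=> k k' b _ kk /eqP ->; unfold_addr; lia.
Qed.

Ltac split_writes H := rewrite /= /bind_var /size_env /=; unfold_addr; intros H;
  repeat match goal with
    | H : _ \/ _ |- _ => destruct H as [H|H]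
    | H : exists2 _, _ & _ |- _ => let k := fresh "k" in destruct H as [k ? H]
    end; try contradiction.

Lemma init_moment_frame m b : (b < aK3)%N -> mexec init_moment env m b = m b.
Proof. by move=> hb; apply: mexec_frame; move: hb; unfold_addr => hb; split_writes H; lia. Qed.

Lemma init_matrix_frame m b : (b < aS 9)%N || (aK3 <= b)%N ->
  mexec init_diag env (mexec init_zero env m) b = m b.
Proof.
move=> hb; rewrite !mexec_frame //; move: hb; unfold_addr => hb; split_writes H.
  have := pair_index_lt (_ : k < d)%N (_ : k0 < d)%N; lia.
have := pair_index_lt (_ : k < d)%N (_ : k < d)%N; lia.
Qed.

Lemma atom_scale_frame m i b : (b < aS 4)%N || (aS 9 <= b)%N ->
  mexec atom_scale (envi i) m b = m b.
Proof. by move=> hb; apply: mexec_frame; move: hb; unfold_addr => hb; split_writes H; lia. Qed.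

Lemma atom_shift_frame m i b : b != aS 4 -> (b < aY 0)%N || (aG 0 <= b)%N ->
  mexec atom_shift (envi i) m b = m b.
Proof.
by move=> b4 hb; apply: mexec_frame; move: b4 hb; unfold_addr => b4 hb; split_writes H; lia.
Qed.

Lemma atom_moment_frame m i b : b != aS 4 -> (b < aM 0)%N ->
  mexec atom_moment (envi i) m b = m b.
Proof.
by move=> b4 hb; apply: mexec_frame; move: b4 hb; unfold_addr => b4 hb; split_writes H; lia.
Qed.

Lemma row_product_frame m envv v b : envv 0%N = d -> envv 1%N = n ->
  b != aS 4 -> (b < aG 0)%N || (aM 0 <= b)%N -> mexec (row_product v) envv m b = m b.
Proof.
move=> e0 e1 b4 hb; apply: mexec_frame; move: b4 hb; unfold_addr => b4 hb.
by rewrite /= /bind_var /= e0 e1; split_writes H; lia.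
Qed.

Lemma update_scale_frame m i b : (b < aS 4)%N || (aS 9 <= b)%N ->
  mexec update_scale (envi i) m b = m b.
Proof. by move=> hb; apply: mexec_frame; move: hb; unfold_addr => hb; split_writes H; lia. Qed.

Lemma rank_one_frame m i b : b != aS 4 -> (b < aS 9)%N || (aK3 <= b)%N ->
  mexec rank_one_update (envi i) m b = m b.
Proof.
move=> b4 hb; apply: mexec_frame; move: b4 hb; unfold_addr => b4 hb; split_writes H; try lia.
have := pair_index_lt (_ : k < d)%N (_ : k0 < d)%N; lia.
Qed.

Lemma polar_scale_frame m b : (b < aS 4)%N || (aS 9 <= b)%N ->
  mexec polar_scale env m b = m b.
Proof. by move=> hb; apply: mexec_frame; move: hb; unfold_addr => hb; split_writes H; lia. Qed.

Lemma polar_vector_frame m b : (b < aY 0)%N || (aG 0 <= b)%N ->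
  mexec polar_vector env m b = m b.
Proof. by move=> hb; apply: mexec_frame; move: hb; unfold_addr => hb; split_writes H; lia. Qed.

Lemma shift_scale_frame m b : (b < aS 4)%N || (aS 9 <= b)%N ->
  mexec shift_scale env m b = m b.
Proof. by move=> hb; apply: mexec_frame; move: hb; unfold_addr => hb; split_writes H; lia. Qed.

Lemma shift_iterate_frame m b : (b < aW 0)%N -> mexec shift_iterate env m b = m b.
Proof. by move=> hb; apply: mexec_frame; move: hb; unfold_addr => hb; split_writes H; lia. Qed.

Lemma atom_bodyP m i : (i < n)%N ->
  let c := m (aS 3) / (m (aS 1) - m (aS 2) * (\sum_(j < d) m (aW j) * m (aX i j)) + m (aS 0)) in
  let u j := c * (m (aX i j) - m (aW j)) - m (aW j) in
  let g l := \sum_(j < d) u j * m (aB j l) in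
  let m' := mexec atom_body (envi i) m in
  [/\ forall j, (j < d)%N -> m' (aM j) = m (aM j) + m i * u j,
      forall j l, (j < d)%N -> (l < d)%N ->
        m' (aB j l) = m (aB j l) + m i / (m (aS 1) - m i * \sum_(k < d) u k * g k) * (g j * g l)
    & forall b, (b < aS 4)%N -> m' b = m b].
Proof.
move=> iN c u g m'.
pose m1 := mexec atom_scale (envi i) m.
pose m2 := mexec atom_shift (envi i) m1.
pose m3 := mexec atom_moment (envi i) m2.
pose m4 := mexec (row_product eY) (envi i) m3.
pose m5 := mexec update_scale (envi i) m4.
have E : m' = mexec rank_one_update (envi i) m5 by [].
have iX j : (j < d)%N -> (aX i j < aW 0)%N.
  by move=> jd; have := pair_index_lt iN jd; unfold_addr; lia.
(* These cells hold the data, the iterate and the scalars that depend on w only. *)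
have small b : (b < aS 4)%N -> [/\ m1 b = m b, m2 b = m b, m3 b = m b, m4 b = m b & m5 b = m b].
  move=> hb; have b4 : b != aS 4 by move: hb; unfold_addr; lia.
  have e1 : m1 b = m b by rewrite /m1 atom_scale_frame ?hb.
  have e2 : m2 b = m b by rewrite /m2 atom_shift_frame //; move: hb; unfold_addr; lia.
  have e3 : m3 b = m b by rewrite /m3 atom_moment_frame //; move: hb; unfold_addr; lia.
  have e4 : m4 b = m b by rewrite /m4 row_product_frame //; move: hb; unfold_addr; lia.
  by split=> //; rewrite /m5 update_scale_frame ?hb.
have hm2 j : (j < d)%N -> m2 (aY j) = u j.
  move=> jd; rewrite /m2 atom_shiftP // /m1 atom_scaleP // -/m1.
  have [-> _ _ _ _] := small (aX i j) (ltac:(have := iX _ jd; unfold_addr; lia)).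
  by have [-> _ _ _ _] := small (aW j) (ltac:(unfold_addr; lia)).
have hm3 j : (j < d)%N -> m3 (aY j) = u j.
  by move=> jd; rewrite /m3 atom_moment_frame ?hm2 //; unfold_addr; lia.
have hB j l : (j < d)%N -> (l < d)%N -> m3 (aB j l) = m (aB j l).
  move=> jd ld; have := pair_index_lt jd ld => jl.
  by rewrite /m3 atom_moment_frame ?/m2 ?atom_shift_frame ?/m1 ?atom_scale_frame //; unfold_addr; lia.
have hg l : (l < d)%N -> m4 (aG l) = g l.
  move=> ld; rewrite /m4 (@row_productP m3 (envi i) eY aY) //; last by move=> k kd; unfold_addr; lia.
  by apply: eq_bigr => j _; rewrite hm3 ?hB.
have hm4 j : (j < d)%N -> m4 (aY j) = u j.
  by move=> jd; rewrite /m4 row_product_frame ?hm3 //; unfold_addr; lia.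
have hm5 : m5 (aS 8) = m i / (m (aS 1) - m i * \sum_(k < d) u k * g k).
  rewrite /m5 update_scaleP //.
  have [_ _ _ -> _] := small i (ltac:(unfold_addr; lia)).
  have [_ _ _ -> _] := small (aS 1) (ltac:(unfold_addr; lia)).
  by congr (_ / (_ - _ * _)); apply: eq_bigr => j _; rewrite hm4 ?hg.
split.
- move=> j jd; rewrite E rank_one_frame; try by unfold_addr; lia.
  rewrite /m5 update_scale_frame; last by unfold_addr; lia.
  rewrite /m4 row_product_frame //; try by unfold_addr; lia.
  rewrite /m3 atom_momentP // hm2 //.
  have [_ -> _ _ _] := small i (ltac:(unfold_addr; lia)).
  by rewrite /m2 atom_shift_frame ?/m1 ?atom_scale_frame //; unfold_addr; lia.
- move=> j l jd ld; rewrite E rank_one_updateP // hm5.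
  have hG k : (k < d)%N -> m5 (aG k) = g k.
    by move=> kd; rewrite /m5 update_scale_frame ?hg //; unfold_addr; lia.
  rewrite !hG //; congr (_ + _); have := pair_index_lt jd ld => jl.
  rewrite /m5 update_scale_frame; last by unfold_addr; lia.
  by rewrite /m4 row_product_frame ?hB //; unfold_addr; lia.
move=> b hb; rewrite E rank_one_frame; try by move: hb; unfold_addr; lia.
by have [_ _ _ _ ->] := small b hb.
Qed.

Variables (omega : 'I_n -> R) (x : 'I_n -> 'rV[R]_d).
Hypothesis omega_gt0 : forall i, 0 < omega i.
Hypothesis x1 : forall i, in_sphere (x i).

(** Extension by 0, because the rank-one recursion runs over [nat]. *)
Definition nat_ext (V : nmodType) (f : 'I_n -> V) k : V := if insub k is Some i then f i else 0.

Lemma nat_extE (V : nmodType) (f : 'I_n -> V) (i : 'I_n) : nat_ext f i = f i.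
Proof. by rewrite /nat_ext valK. Qed.

Definition holds (w : 'rV[R]_d) m := [/\ forall i : 'I_n, m i = omega i,
  forall (i : 'I_n) (j : 'I_d), m (aX i j) = x i 0 j & forall j : 'I_d, m (aW j) = w 0 j].

Lemma partial_sum_le (a : nat -> R) k : (forall i, 0 <= a i) -> (k <= n)%N ->
  \sum_(i < k) a i <= \sum_(i < n) a i.
Proof.
move=> a0 kn; rewrite -(subnKC kn) big_split_ord /= lerDl.
by apply: sumr_ge0.
Qed.

Lemma inverse_update_hessian (y : 'I_n -> 'rV[R]_d) l : 0 < l -> gapped omega y l ->
  inverse_update (nat_ext omega) (nat_ext y) n = invmx (sphere_hessian omega y).
Proof.
move=> l0 gy; have uH := hessian_unit l0 gy.
have EH : partial_hessian (nat_ext omega) (nat_ext y) n = sphere_hessian omega y.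
  by congr (_ - _); apply: eq_bigr => i _; rewrite !nat_extE.
suff H : inverse_update (nat_ext omega) (nat_ext y) n *m sphere_hessian omega y = 1%:M.
  by rewrite -[LHS]mulmx1 -(mulmxV uH) mulmxA H mul1mx.
rewrite -EH; apply: (@inverse_updateP _ _ n) => // k v kn vk0.
have om0 i : 0 <= nat_ext omega i by rewrite /nat_ext; case: insub => // i'; exact: ltW.
have := congr1 (fun u => dot u v) vk0; rewrite dot0l /partial_hessian mulmxBr mulmx1 !dotE.
rewrite mulmx_sumr dot_suml.
rewrite (eq_bigr (fun i : 'I_k => nat_ext omega i * dot (nat_ext y i) v ^+ 2)); last first.
  by move=> i _; rewrite -scalemxAr mulmxA mulmx_trE mul_scalar_mx !dotZl (dotC v) expr2.
move=> /eqP; rewrite subr_eq0 => /eqP h.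
have := @partial_sum_le (fun i => nat_ext omega i * dot (nat_ext y i) v ^+ 2) k _ kn.
rewrite -h (eq_bigr (fun i : 'I_n => omega i * dot (y i) v ^+ 2)); last first.
  by move=> i _; rewrite !nat_extE.
move=> /(_ (fun i => mulr_ge0 (om0 i) (sqr_ge0 _))) h1.
have := gy v; have := dotvv_ge0 v => h2 h3.
apply/eqP; rewrite -dotvv_eq0 eq_le h2 andbT -(pmulr_rle0 _ l0).
by move: h1 h3; rewrite mulrBl mul1r; lra.
Qed.

Lemma atoms_loopP m w : in_ball w -> holds w m ->
  m (aS 0) = dot w w -> m (aS 1) = 1 -> m (aS 2) = 2 -> m (aS 3) = 1 - dot w w ->
  (forall j : 'I_d, m (aM j) = 0) -> (forall j l : 'I_d, m (aB j l) = (j == l)%:R) ->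
  let y := shifted x w in let m' := mexec (For 2 vN atom_body) env m in
  [/\ forall j : 'I_d, m' (aM j) = moment omega y 0 j,
      forall j l : 'I_d, m' (aB j l) = inverse_update (nat_ext omega) (nat_ext y) n j l
    & forall b, (b < aS 4)%N -> m' b = m b].
Proof.
move=> w1 [hom hx hw] h0 h1 h2 h3 hM hB y m'.
pose om_ := nat_ext omega; pose y_ : nat -> 'rV[R]_d := nat_ext y.
pose I k (m' : nat -> R) :=
  [/\ forall j : 'I_d, m' (aM j) = (\sum_(i < k) om_ i *: y_ i) 0 j,
      forall j l : 'I_d, m' (aB j l) = inverse_update om_ y_ k j l
    & forall b, (b < aS 4)%N -> m' b = m b].
have momE : moment omega y = \sum_(i < n) om_ i *: y_ i.
  by apply: eq_bigr => i _; rewrite /om_ /y_ !nat_extE.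
suff [hM' hB' hb] : I n m' by split=> // j; rewrite hM' momE.
apply: (@for_inv R I 2 vN); first split=> // [j|j l].
- by rewrite hM big_ord0 mxE.
- by rewrite hB /= mxE.
move=> i mi; rewrite -[X in (_ < X)%N]/n => iN [hM' hB' hb].
pose i' := Ordinal iN.
have small k : (k < 4)%N -> mi (aS k) = m (aS k).
  by move=> k4; rewrite hb // /aS ltn_add2l.
have hW (j : 'I_d) : mi (aW j) = w 0 j.
  by rewrite hb ?hw //; have := ltn_ord j; rewrite /aW /aS /aK; lia.
have hX (j : 'I_d) : mi (aX i j) = x i' 0 j.
  rewrite hb ?(hx i') //; have := pair_index_lt iN (ltn_ord j).
  by rewrite /aX /aS /aK; lia.
have hi : mi i = omega i' by rewrite hb ?(hom i') // /aS /aK; lia.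
have [] := atom_bodyP mi iN.
set c := _ / _; set u := fun j : nat => c * (mi (aX i j) - mi (aW j)) - mi (aW j).
set g := fun l : nat => \sum_(j < d) u j * mi (aB j l).
have cE : c = (1 - dot w w) / (1 - 2 * dot w (x i') + dot w w).
  by rewrite /c !small // h0 h1 h2 h3; congr (_ / (_ - _ * _ + _)); apply: eq_bigr => j _; rewrite hW hX.
have uE (j : 'I_d) : u j = y i' 0 j.
  by rewrite /u hX hW cE /y /shifted shift_sphereE // !mxE.
have yE : y_ i = y i' by rewrite -[i]/(val i') /y_ nat_extE.
have omE : om_ i = omega i' by rewrite -[i]/(val i') /om_ nat_extE.
have gE (l : 'I_d) : g l = (y_ i *m inverse_update om_ y_ i) 0 l.
  by rewrite /g mxE; apply: eq_bigr => j _; rewrite uE hB' yE.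
rewrite small // h1 hi => hMi hBi hbi; split=> [j|j l|b hb4].
- by rewrite hMi // hM' -/(u j) uE big_ord_recr /= yE omE !mxE.
- rewrite hBi // hB' -/(g j) -/(g l) !gE /= !mxE big_ord1 !mxE omE.
  congr (_ + _ / (_ - _ * _) * _).
  by apply: eq_bigr => k _; rewrite -/(u k) -/(g k) uE gE yE.
- by rewrite hbi // hb.
Qed.

Lemma newton_programP m w l : in_ball w -> 0 < l -> gapped omega (shifted x w) l ->
  holds w m -> holds (newton_map omega x w) (mexec newton_program env m).
Proof.
move=> w1 l0 gw hm; have [hom hx hw] := hm; set y := shifted x w in gw.
have y1 i : in_sphere (y i) by exact: shift_sphere.
pose m1 := mexec init_scalars env m.
pose m2 := mexec init_moment env m1.
pose m3 := mexec init_diag env (mexec init_zero env m2).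
pose m4 := mexec (For 2 vN atom_body) env m3.
pose m5 := mexec (row_product eM) env m4.
pose m6 := mexec polar_scale env m5.
pose m7 := mexec polar_vector env m6.
pose m8 := mexec shift_scale env m7.
have E : mexec newton_program env m = mexec shift_iterate env m8.
  by rewrite /newton_program /seqc [foldr _ _ _]/= 10!mexec_Seq mexec_Skip.
have [s0 s1 s2 s3 sb] := init_scalarsP m; rewrite -/m1 in s0 s1 s2 s3 sb.
have wwE : \sum_(j < d) m (aW j) * m (aW j) = dot w w by apply: eq_bigr => j _; rewrite hw.
rewrite wwE in s0 s3.
have b3 b : (b < aS 9)%N -> m3 b = m1 b.
  by move=> hb; rewrite /m3 init_matrix_frame ?hb // /m2 init_moment_frame //; move: hb; unfold_addr; lia.
have b3K b : (b < aK)%N -> m3 b = m b.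
  by move=> hb; rewrite b3 ?sb //; move: hb; unfold_addr; lia.
have wlt (j : 'I_d) : (aW j < aK)%N by have := ltn_ord j; unfold_addr; lia.
have xlt (i : 'I_n) (j : 'I_d) : (aX i j < aW 0)%N.
  by have := pair_index_lt (ltn_ord i) (ltn_ord j); unfold_addr; lia.
have hm3 : holds w m3.
  split=> [i|i j|j]; rewrite b3K ?hom ?hx ?hw //.
    by have := ltn_ord i; unfold_addr; lia.
  by have := xlt i j; unfold_addr; lia.
have hM3 (j : 'I_d) : m3 (aM j) = 0.
  rewrite /m3 init_matrix_frame; last by unfold_addr; lia.
  rewrite /m2 (@for_const _ aM 0 3) //; case: existsP => // h; case: h.
  by exists j.
have hB3 (j k : 'I_d) : m3 (aB j k) = (j == k)%:R by exact: init_matrixP.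
have a9 k : (k < 9)%N -> (aS k < aS 9)%N by move=> ?; rewrite /aS ltn_add2l.
have [hM4 hB4 b4] := @atoms_loopP m3 w w1 hm3
  (etrans (b3 _ (a9 0 isT)) s0) (etrans (b3 _ (a9 1 isT)) s1) (etrans (b3 _ (a9 2 isT)) s2) (etrans (b3 _ (a9 3 isT)) s3) hM3 hB3.
rewrite -/m4 -/y in hM4 hB4 b4.
have hG5 (j : 'I_d) : m5 (aG j) = newton_vector omega y 0 j.
  rewrite /m5 (@row_productP m4 env eM aM) //; last by move=> k kd; unfold_addr; lia.
  rewrite /newton_vector -(inverse_update_hessian l0 gw) mxE.
  by apply: eq_bigr => k _; rewrite hM4 hB4.
set g := newton_vector omega y in hG5.
have b8 b : (b < aS 4)%N -> [/\ m5 b = m1 b, m6 b = m1 b, m7 b = m1 b & m8 b = m1 b].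
  move=> hb; have e4 : m4 b = m1 b by rewrite b4 ?b3 //; move: hb; unfold_addr; lia.
  have e5 : m5 b = m1 b by rewrite /m5 row_product_frame ?e4 //; move: hb; unfold_addr; lia.
  have e6 : m6 b = m1 b by rewrite /m6 polar_scale_frame ?hb.
  have e7 : m7 b = m1 b by rewrite /m7 polar_vector_frame ?e6 //; move: hb; unfold_addr; lia.
  by split=> //; rewrite /m8 shift_scale_frame ?hb.
have b8K b : (b < aK)%N -> m8 b = m b.
  by move=> hb; rewrite -sb //; have [|_ _ _ //] := b8 b; move: hb; unfold_addr; lia.
set z := newton_point omega y.
have hZ7 (j : 'I_d) : m7 (aY j) = z 0 j.
  rewrite /m7 polar_vectorP // /m6 polar_scaleP polar_scale_frame; last by unfold_addr; lia.
  have [|-> _ _ _] := b8 (aS 1); first by unfold_addr; lia.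
  rewrite s1 hG5 (_ : \sum_(k < d) _ = dot g g); last by apply: eq_bigr => k _; rewrite hG5.
  rewrite -/(enorm g) /z /newton_point -/g [in RHS]mxE /tanhR.
  by rewrite (_ : enorm g / 2 + enorm g / 2 = enorm g) //; lra.
have hW7 (j : 'I_d) : m7 (aW j) = w 0 j.
  have [|_ _ -> _] := b8 (aW j); first by have := wlt j; unfold_addr; lia.
  by rewrite sb ?hw.
split=> [i|i j|j].
- rewrite E shift_iterate_frame; last by have := ltn_ord i; unfold_addr; lia.
  by rewrite b8K ?hom //; have := ltn_ord i; unfold_addr; lia.
- by rewrite E shift_iterate_frame // b8K ?hx //; have := xlt i j; unfold_addr; lia.
rewrite E shift_iterateP //.
have hZ8 (k : 'I_d) : m8 (aY k) = z 0 k by rewrite /m8 shift_scale_frame ?hZ7 //; unfold_addr; lia.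
have hW8 (k : 'I_d) : m8 (aW k) = w 0 k by rewrite b8K ?hw.
have [] := shift_scaleP m7; rewrite -/m8.
rewrite (_ : \sum_(k < d) m7 (aY k) * m7 (aY k) = dot z z); last first.
  by apply: eq_bigr => k _; rewrite hZ7.
rewrite (_ : \sum_(k < d) m7 (aW k) * m7 (aY k) = dot w z); last first.
  by apply: eq_bigr => k _; rewrite hZ7 hW7.
have [|_ _ -> _] := b8 (aS 0); first by unfold_addr; lia.
have [|_ _ -> _] := b8 (aS 1); first by unfold_addr; lia.
have [|_ _ -> _] := b8 (aS 2); first by unfold_addr; lia.
have [|_ _ _ ->] := b8 (aS 3); first by unfold_addr; lia.
rewrite s0 s1 s2 s3 hZ8 hW8 => -> ->.
rewrite /newton_map -/y -/z shiftE !(dotNl, dotNr) opprK !mxE mulrC.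
have -> : 1 - 2 * - dot w z + dot w w * dot z z = 1 + (dot w w * dot z z + 2 * dot w z) by ring.
by congr (_ * _); ring.
Qed.

Lemma nth_allpairs (S T V : Type) (f : S -> T -> V) s t s0 t0 v0 i j :
  (i < size s)%N -> (j < size t)%N ->
  nth v0 [seq f a b | a <- s, b <- t] (i * size t + j) = f (nth s0 s i) (nth t0 t j).
Proof.
move=> + jt; elim: s i => // a s IH [|i] /= hi; rewrite nth_cat size_map.
  by rewrite jt (nth_map t0).
by rewrite mulSn -addnA ltnNge leq_addr /= addKn IH.
Qed.

Lemma initial_holds : holds 0 (memory (initial_state omega x)).
Proof.
have sz : size [seq omega i | i <- enum 'I_n] = n by rewrite size_map size_enum_ord.
split=> [i|i j|j] /=; rewrite nth_cat sz.
- by rewrite ltn_ord (nth_map i) ?size_enum_ord // nth_ord_enum.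
- rewrite /aX ltnNge leq_addr /= addKn.
  have := @nth_allpairs _ _ _ (fun (i : 'I_n) (j : 'I_d) => x i 0 j) (enum 'I_n) (enum 'I_d) i j 0 i j.
  by rewrite !size_enum_ord !nth_ord_enum => -> //; apply: ltn_ord.
have -> : (aW j < n)%N = false by unfold_addr; lia.
(* Cells behind the input list read the default value 0, which is the starting iterate. *)
by rewrite nth_default ?mxE // size_allpairs !size_enum_ord; unfold_addr; lia.
Qed.

Lemma memory_run P k (s : state R) : memory (run P d n k s) = iter k (mexec P env) (memory s).
Proof. by elim: k => //= k <-; rewrite memory_exec. Qed.

Lemma time_run P k (s : state R) : (time_used (run P d n k s) <= time_used s + k * cost P env)%N.
Proof.
elim: k => [|k IH]; first by rewrite addn0.
apply: leq_trans (time_exec _ _ _) _.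
by rewrite mulSn addnCA [leqRHS]addnC leq_add2r.
Qed.

Lemma space_run N P k (s : state R) : fits N P env ->
  (space_used (run P d n k s) <= maxn (space_used s) N)%N.
Proof.
move=> fP; elim: k => [|k IH]; first exact: leq_maxl.
by apply: leq_trans (space_exec _ fP) _; rewrite geq_max IH leq_maxr.
Qed.

Lemma cost_newton_program : cost newton_program env =
  (n * (5 * (d * d) + 10 * d + 9) + 3 * (d * d) + 16 * d + 19)%N.
Proof.
rewrite /= /bind_var /size_env /= !sum_nat_const !card_ord.

lia.
Qed.

Lemma fits_newton_program : fits (aK3 + d + d + d) newton_program env.
Proof.
rewrite /= /bind_var /size_env /=; unfold_addr.
repeat (match goal with
  | |- _ /\ _ => split
  | |- and3 _ _ _ => split
  | |- forall _, _ => intro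
  end); try exact: I; try lia;
  match goal with |- context [(?i * d + ?j)%N] =>
    first [have := @pair_index_lt i j d (ltac:(assumption)) (ltac:(assumption)); lia
          |have := @pair_index_lt i j n (ltac:(assumption)) (ltac:(assumption)); lia] end.
Qed.

End ProgramCorrect.

(** * Convergence and complexity of the two methods *)

Lemma artanh_exists (R : realType) (r : R) : 0 <= r -> r < 1 ->
  exists s, [/\ 0 <= s, tanhR s = r & s <= r / (1 - r)].
Proof.
move=> r0 r1; have r1' : 0 < 1 - r by lra.
have z0 : 0 <= 2 * r / (1 - r) by rewrite divr_ge0 //; lra.
have e : 1 + 2 * r / (1 - r) = (1 + r) / (1 - r) by field; lra.
(* Half the logarithm of (1 + r) / (1 - r), written so that ln(1 + u) <= u gives the upper bound. *)
exists (ln (1 + 2 * r / (1 - r)) / 2); split.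
- by rewrite divr_ge0 // ln_ge0 //; lra.
- rewrite /tanhR; set u := ln _; have -> : u / 2 + u / 2 = u by field.
  rewrite /u lnK ?posrE; last by lra.
  by rewrite e; field; lra.
rewrite ler_pdivrMr // (_ : r / (1 - r) * 2 = 2 * r / (1 - r)); last by field; lra.
by apply: le_ln1Dx; lra.
Qed.

Section Convergence.
Variables (R : realType) (d n : nat) (omega : 'I_n -> R) (x : 'I_n -> 'rV[R]_d).
Hypotheses (omega_gt0 : forall i, 0 < omega i) (omega1 : \sum_i omega i = 1).
Hypothesis x1 : forall i, in_sphere (x i).

(** The Newton direction is s (1 - |w|^2) e with s half the length of the Newton vector, the form
    that [riemannian_expE] evaluates. *)
Lemma newton_stepE w l : in_ball w -> 0 < l -> gapped omega (shifted x w) l ->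
  newton_step omega x w = newton_map omega x w.
Proof.
move=> w1 l0 gw; have y1 i : in_sphere (shifted x w i) by exact: shift_sphere.
have [e e1 [ge pe]] := newton_point_polar omega1 y1.
rewrite /newton_step newton_directionE // ?(hessian_unit l0 gw) // /newton_map pe ge scalerA.
rewrite -riemannian_expE //; congr (riemannian_exp _ (_ *: _)).
by rewrite -ge; field.
Qed.

Lemma shift_newton_stepE w l : in_ball w -> 0 < l -> gapped omega (shifted x w) l ->
  shift_newton_step omega x w = newton_map omega x w.
Proof.
move=> w1 l0 gw; have y1 i : in_sphere (shifted x w i) by exact: shift_sphere.
have [e e1 [ge pe]] := newton_point_polar omega1 y1.
have s0 : shifted (shifted x w) 0 = shifted x w by exact: shifted0.
rewrite /shift_newton_step newton_directionE ?s0 ?(hessian_unit l0 gw) //; last exact: in_ball0.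
rewrite /newton_map pe ge scalerA; congr (shift _ _).
rewrite -[RHS]shift_0l -[X in shift X (tanhR _ *: _)]oppr0 -riemannian_expE //; last exact: in_ball0.
by congr (riemannian_exp _ (_ *: _)); rewrite dot0l -ge; field.
Qed.

Lemma jacobian_of_unit m w l : in_ball w -> 0 < l -> gapped omega (shifted x w) l ->
  jacobian_of omega x m w \in unitmx.
Proof.
move=> w1 l0 gw; have y1 i : in_sphere (shifted x w i) by exact: shift_sphere.
have uN : - sphere_hessian omega (shifted x w) \in unitmx.
  by rewrite -scaleN1r unitmxZ ?unitrN1 // (hessian_unit l0 gw).
have s0 : shifted (shifted x w) 0 = shifted x w by exact: shifted0.
by case: m; rewrite /= mean_field_jacobianE ?s0 //; exact: in_ball0.
Qed.

(** The weights sum to 1, and a space of dimension 0 has no unit vector. Positive sizes let the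
    leading terms absorb the lower-order ones in the complexity bounds. *)
Lemma dim_gt0 : (0 < n)%N /\ (0 < d)%N.
Proof.
have n0 : (0 < n)%N.
  by case: n omega omega1 => // om'; rewrite big_ord0 => /esym/eqP; rewrite oner_eq0.
split=> //; have := x1 (Ordinal n0); case: d x => // x' /in_sphereP.
by rewrite /dot big_ord0 => /esym/eqP; rewrite oner_eq0.
Qed.

(** Every monomial of the cost is at most n d^2, and 62 is the sum of the coefficients. *)
Lemma newton_program_time k :
  (time_used (run newton_program d n k (initial_state omega x)) <= 62 * (k * (d ^ 2 * n + d ^ 3)))%N.
Proof.
have [n0 d0] := dim_gt0.
apply: (leq_trans (time_run _ _ _ _ _)); rewrite add0n mulnCA leq_mul2l; apply/orP; right.
have e1 : (d * 1 <= d * d)%N by rewrite leq_mul2l d0 orbT.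
have e2 : (1 * (d * d) <= n * (d * d))%N by rewrite leq_mul2r n0 orbT.
have e3 : (n * (d * 1) <= n * (d * d))%N by rewrite leq_mul2l e1 orbT.
have e4 : (n * 1 <= n * (d * d))%N by rewrite leq_mul2l; apply/orP; right; lia.
rewrite cost_newton_program; lia.
Qed.

Lemma newton_program_space k :
  (space_used (run newton_program d n k (initial_state omega x)) <= 62 * (d * n + d ^ 2))%N.
Proof.
have [n0 d0] := dim_gt0.
have e1 : (d * 1 <= d * d)%N by rewrite leq_mul2l d0 orbT.
have e2 : (1 * n <= d * n)%N by rewrite leq_mul2r d0 orbT.
apply: (leq_trans (space_run _ _ (fits_newton_program d n))).
by rewrite geq_max /= /aK3 /aK; apply/andP; split; lia.
Qed.

Variable lam : R.
Hypotheses (lam_gt0 : 0 < lam) (gx : gapped omega x lam).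
Hypothesis q_lt1 : 4 * enorm (moment omega x) / lam ^+ 2 < 1.
Let q := 4 * enorm (moment omega x) / lam ^+ 2.

Let lam_lt1 : lam < 1. Proof. exact: gapped_lt1 omega1 x1 _ gx. Qed.
Let lam_le1 : lam <= 1. Proof. exact: ltW. Qed.
Let q_ge0 : 0 <= q. Proof. by rewrite divr_ge0 ?mulr_ge0 ?enorm_ge0 ?exprn_ge0 ?ltW. Qed.
Let mx : 4 * enorm (moment omega x) < lam ^+ 2.
Proof. by move: q_lt1; rewrite ltr_pdivrMr ?exprn_gt0 // mul1r. Qed.

Let bound k := newton_iterate_bound omega_gt0 omega1 x1 lam_gt0 lam_le1 gx mx k.

Lemma iterateE m k : iterate omega x m k = iter k (newton_map omega x) 0.
Proof.
elim: k => // k IH; rewrite /iterate !iterS -/(iterate omega x m k) IH.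
have [l [w1 /andP[l0 _] gw _ _]] := bound k.
by case: m {IH}; [exact: newton_stepE gw|exact: shift_newton_stepE gw].
Qed.

Lemma iterate_regular m k : in_ball (iterate omega x m k) /\
  jacobian_of omega x m (iterate omega x m k) \in unitmx.
Proof.
rewrite iterateE; have [l [w1 /andP[l0 _] gw _ _]] := bound k.
by split=> //; exact: jacobian_of_unit gw.
Qed.

Lemma conformal_barycenter_exists : exists b, unique (conformal_barycenter omega x) b.
Proof.
have [b b1 mb] := centered_exists omega_gt0 omega1 x1 lam_gt0 lam_le1 gx mx.
exists b; split; first exact/(conformal_barycenterE omega x1).
move=> b' /(conformal_barycenterE omega x1) [b'1 mb'].
exact: (center_unique omega_gt0 omega1 x1 lam_gt0 lam_le1 gx mx b1 mb b'1 mb').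
Qed.

Section Rate.
Variables (b : 'rV[R]_d) (k : nat) (eps : R).
Hypotheses (b_center : conformal_barycenter omega x b).
Hypotheses (eps_gt0 : 0 < eps) (q_le : q ^+ (2 ^ k) <= eps).
Local Notation w := (iter k (newton_map omega x) 0).

Let b1 : in_ball b. Proof. by case: b_center. Qed.
Let mb : moment omega (shifted x b) = 0.
Proof. by case: ((conformal_barycenterE omega x1 b).1 b_center). Qed.
Let w1 : in_ball w. Proof. by have [l []] := bound k. Qed.

(** The product is abstracted to a variable T, on which linear arithmetic can work. *)
Lemma rate_bound : exists T : R, [/\ q ^+ (2 ^ k) * lam = T, 0 <= T, T <= 1 & T <= eps].
Proof.
have t0 : 0 <= q ^+ (2 ^ k) by exact: exprn_ge0.
have t1 : q ^+ (2 ^ k) <= 1 by rewrite exprn_ile1 // ltW.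
have tl : q ^+ (2 ^ k) * lam <= q ^+ (2 ^ k) by rewrite ler_piMr.
exists (q ^+ (2 ^ k) * lam); split=> //; first by rewrite mulr_ge0 // ltW.
  exact: le_trans t1.
exact: le_trans q_le.
Qed.

Lemma geodesic_dist_iterate : (geodesic_dist w b < eps%:E)%E.
Proof.
have := newton_iterate_close omega_gt0 omega1 x1 lam_gt0 lam_le1 gx mx b1 mb k.
have [T [TE T0 T1 Te]] := rate_bound; rewrite -/q mulrA TE => hr.
have [e e1 re] := unit_direction omega1 (shift w b) x1.
have [r rE] : exists r, r = enorm (shift w b) by eexists.
have r0 : 0 <= r by rewrite rE enorm_ge0.
rewrite -rE in re hr.
have r6 : r < 1 by lra.
have [s [s0 sr sle]] := artanh_exists r0 r6.
rewrite -(shiftK w1 b1) re -sr; apply: le_lt_trans (geodesic_dist_le w1 e1 s0) _.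
(* The distance is at most 2r / (1 - r) <= 12/5 r because r <= 1/6; with r <= T/6 this is at most
   2/5 T, which makes the inequality strict. *)
have r_eps : 12 / 5 * r < eps by move: (eps_gt0); lra.
rewrite lte_fin; apply: le_lt_trans r_eps.
suff : r / (1 - r) <= 6 / 5 * r by lra.
by rewrite ler_pdivrMr; [nra|lra].
Qed.

Lemma wasserstein_iterate p : (1 <= p)%E ->
  (wasserstein p (shifted_measure (atomic_measure omega x) w)
    (shifted_measure (atomic_measure omega x) b) < eps%:E)%E.
Proof.
move=> p1; have [T [TE T0 T1 Te]] := rate_bound.
(* 33/40 is the chord constant 11/20 times the factor 3/2 from chord to angle. *)
have T_eps : 33 / 40 * T < eps by move: (eps_gt0); lra.
apply: (@le_lt_trans _ _ (33 / 40 * T)%:E); last by rewrite lte_fin.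
apply: wasserstein_shifted_le => // [|i]; first by lra.
have := newton_iterate_chord omega_gt0 omega1 x1 lam_gt0 lam_le1 gx mx b1 mb k i.
rewrite -/q TE => h.
apply: (le_trans (sphere_dist_le_chord _ _ _)); try exact: shift_sphere; first by lra.
by lra.
Qed.

End Rate.

Lemma run_holds k : holds omega x (iter k (newton_map omega x) 0)
  (memory (run newton_program d n k (initial_state omega x))).
Proof.
rewrite memory_run; elim: k => [|k IH]; first exact: initial_holds.
have [l [w1 /andP[l0 _] gw _ _]] := bound k.
by rewrite !iterS; exact: newton_programP gw IH.
Qed.

End Convergence.

Theorem corollary3p3 (R : realType) (m : method) :
  exists (P : command) (C : nat),
  forall (d n : nat) (omega : 'I_n -> R) (x : 'I_n -> 'rV[R]_d) (lambda_min : R),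
  (forall i, in_sphere (x i)) ->
  (forall i, 0 < omega i) ->
  \sum_i omega i = 1 ->
  smallest_eigenvalue (1%:M - \sum_i omega i *: ((x i)^T *m x i)) lambda_min ->
  0 < lambda_min ->
  let w_cm := \sum_i omega i *: x i in
  let q := 4 * enorm w_cm / lambda_min ^+ 2 in
  q < 1 ->
  let mu := atomic_measure omega x in
  let w := iterate omega x m in
  [/\ forall k, in_ball (w k) /\ jacobian_of omega x m (w k) \in unitmx,
      exists2 w_star, unique (conformal_barycenter omega x) w_star &
        forall (eps : R) (p : \bar R), 0 < eps -> (1 <= p)%E ->
        exists k : nat,
          [/\ ((k%:R : R)%:E <= iteration_bound eps q)%E,
              (geodesic_dist (w k) w_star < eps%:E)%E &
              (wasserstein p (shifted_measure mu (w k))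
                 (shifted_measure mu w_star) < eps%:E)%E]
    & forall k : nat,
        let s := run P d n k (initial_state omega x) in
        [/\ reads_iterate d n s = w k,
            (time_used s <= C * (k * (d ^ 2 * n + d ^ 3)))%N &
            (space_used s <= C * (d * n + d ^ 2))%N]].
Proof.
(* One program serves both methods, because their iterates coincide. *)
exists newton_program, 62%N => d n omega x lam x1 omega_gt0 omega1 [_ lam_min] lam_gt0 w_cm q q_lt1 mu w.
have gx : gapped omega x lam by exact: sphere_hessian_gapped.
have wE k : w k = iter k (newton_map omega x) 0 by exact: iterateE gx q_lt1 _ _.
split.
- by move=> k; exact: iterate_regular gx q_lt1 _ _.
- have [b bu] := conformal_barycenter_exists omega_gt0 omega1 x1 lam_gt0 gx q_lt1.
  exists b => // eps p eps0 p1; have bc := bu.1.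
  have q0 : 0 <= q by rewrite divr_ge0 ?mulr_ge0 ?enorm_ge0 ?exprn_ge0 ?ltW.
  have [k [kb kq]] := iteration_count eps0 q0 q_lt1; exists k; rewrite wE; split=> //.
    exact: geodesic_dist_iterate gx q_lt1 _ _ _ bc eps0 kq.
  exact: wasserstein_iterate gx q_lt1 _ _ _ bc eps0 kq _ p1.
move=> k s; split.
- have [_ _ h] := run_holds omega_gt0 omega1 x1 lam_gt0 gx q_lt1 k.
  by apply/rowP => j; rewrite mxE wE; exact: h.
- exact: newton_program_time.
- exact: newton_program_space.
Qed.
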